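(* Let $n\ge2$, $k\ge1$, let $M^n\hookrightarrow\mathbb R^{n+k}$ be an embedded submanifold, $v$ a vector field on $M$, $p\in M$, with $v$ extended to a neighborhood of $p$ in $\mathbb R^{n+k}$ (still denoted $v$). The following hold at $p$. For general $k\ge1$: $$(\tilde\nabla^*\tilde\nabla v)^T=\nabla^*\nabla v+\sum_{l=1}^kW_{N_l}W_{N_l}v+n(\tilde\nabla_{\mathbf H}v)^T-\sum_{l=1}^k(\tilde\nabla_{N_l}\tilde\nabla_{N_l}v-\tilde\nabla_{\tilde\nabla_{N_l}N_l}v)^T,$$ equivalently $$(\tilde\nabla^*\tilde\nabla v)^T=\nabla^*\nabla v-\mathrm{Ric}\,v+n[\mathbf H,v]^T-\sum_{l=1}^k(\tilde\nabla_{N_l}\tilde\nabla_{N_l}v-\tilde\nabla_{\tilde\nabla_{N_l}N_l}v)^T,$$ equivalently $$(\tilde\nabla^*\tilde\nabla v)^T=-\Delta_hv+2\sum_{l=1}^kW_{N_l}W_{N_l}v+n(\tilde\nabla_{\mathbf H}v)^T-nW_{\mathbf H}v-\sum_{l=1}^k(\tilde\nabla_{N_l}\tilde\nabla_{N_l}v-\tilde\nabla_{\tilde\nabla_{N_l}N_l}v)^T;$$ and $$(\tilde\nabla^*\tilde\nabla v+\tilde\nabla\,\widetilde{\operatorname{div}}\,v)^T=\nabla^*\nabla v-\mathrm{Ric}\,v+\nabla\operatorname{div}v+n[\mathbf H,v]^T-\sum_{l=1}^k(\tilde\nabla_{N_l}\tilde\nabla_{N_l}v-\tilde\nabla_{\tilde\nabla_{N_l}N_l}v)^T+\nabla\operatorname{div}^\perp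 v.$$ For a hypersurface $M^n\hookrightarrow\mathbb R^{n+1}$: $$(\tilde\nabla^*\tilde\nabla v)^T=\nabla^*\nabla v+s^2v+nH(\tilde\nabla_Nv)^T-(\tilde\nabla_N\tilde\nabla_Nv)^T+\nabla_{\tilde\nabla_NN}v,$$ equivalently $$(\tilde\nabla^*\tilde\nabla v)^T=\nabla^*\nabla v-\mathrm{Ric}\,v+nH[N,v]^T-(\tilde\nabla_N\tilde\nabla_Nv)^T+\nabla_{\tilde\nabla_NN}v,$$ equivalently $$(\tilde\nabla^*\tilde\nabla v)^T=-\Delta_hv+2s^2v+nH(\tilde\nabla_Nv)^T-nHsv-(\tilde\nabla_N\tilde\nabla_Nv)^T+\nabla_{\tilde\nabla_NN}v;$$ if moreover $v$ is divergence free both on $M$ and on $\mathbb R^{n+1}$, then $$\begin{aligned}(\tilde\nabla^*\tilde\nabla v)^T&=\nabla^*\nabla v-\mathrm{Ric}\,v+nH[N,v]-(\tilde\nabla_N\tilde\nabla_Nv)^T+\nabla_{\tilde\nabla_NN}v\\&=\nabla^*\nabla v+s^2v+nH\tilde\nabla_Nv-(\tilde\nabla_N\tilde\nabla_Nv)^T+\nabla_{\tilde\nabla_NN}v\\&=-\Delta_hv+2s^2v+nH\tilde\nabla_Nv-nHsv-(\tilde\nabla_N\tilde\nabla_Nv)^T+\nabla_{\tilde\nabla_NN}v;\end{aligned}$$ and, with no divergence assumption, $$(\tilde\nabla^*\tilde\nabla v+\tilde\nabla\,\widetilde{\operatorname{div}}\,v)^T=\nabla^*\nabla v-\mathrm{Ric}\,v+\nabla\operatorname{div}v+nH[N,v]^T-(\tilde\nabla_N\tilde\nabla_Nv)^T+\nabla_{\tilde\nabla_NN}v+\nabla\operatorname{div}^\perp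 v.$$
   Context: Everything is smooth. $\tilde g,\tilde\nabla$ are the Euclidean metric and connection; $M$ carries the induced metric $g$ with Levi-Civita connection $\nabla$ ($\tilde\nabla,\nabla$ also denote gradients of functions on the Euclidean space and on $M$). ${}^T,{}^\perp$ are orthogonal projections onto $T_pM$ and $(T_pM)^\perp$. Frames: $E_1,\dots,E_n$ is a local orthonormal (ON) frame on $M$ near $p$, $N_1,\dots,N_k$ a local ON frame of the normal bundle, extended so that together they form an ON frame $\{E_\alpha\}$ of the ambient space in a neighborhood of $p$; for $k=1$, $N=N_1$ is a choice of unit normal. $\mathrm{II}(X,Y)=(\tilde\nabla_XY)^\perp$; for a normal field $\eta$, $g(W_\eta X,Y)=\tilde g(\eta,\mathrm{II}(X,Y))$, i.e. $W_\eta X=-(\tilde\nabla_X\eta)^T$; $\mathbf H=\frac1n\sum_i\mathrm{II}(E_i,E_i)$ (extended to a neighborhood of $p$ in $[\mathbf H,v]$). For $k=1$: shape operator $s=W_N$, so $sX=-\tilde\nabla_XN$; $H=\frac1n\operatorname{tr}s$, $\mathbf H=HN$. $\operatorname{div}v=\sum_ig(\nabla_{E_i}v,E_i)$ on $M$, $\widetilde{\operatorname{div}}\,v=\sum_\alpha\tilde g(\tilde\nabla_{E_\alpha}v,E_\alpha)$ on the ambient neighborhood, and the orthogonal divergence on $M$ is $\operatorname{div}^\perp v=\sum_{l=1}^k\tilde g(\tilde\nabla_{N_l}v,N_l)$. Bochner Laplacian for a Levi-Civita connection $D$ and ON frame $\{F_a\}$: $D^*Dv=-\sum_a(D_{F_a}D_{F_a}v-D_{D_{F_a}F_a}v)$.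 Hodge Laplacian on vector fields of $M$: $-\Delta_hv=\big((dd^*+d^*d)v^\flat\big)^\sharp$. $\mathrm{Ric}\,v=\mathrm{Ric}(v,\cdot)^\sharp$, with $\mathrm{Ric}(X,Y)=\sum_iR(E_i,X,Y,E_i)$ the Ricci tensor of $M$, $R(W,X,Y,Z)=g(\nabla_W\nabla_XY-\nabla_X\nabla_WY-\nabla_{[W,X]}Y,Z)$. *)

(* Defs.v *)
From mathcomp Require Import all_boot all_order all_algebra.
From mathcomp Require Import all_classical all_reals all_analysis.
Set Implicit Arguments.
Unset Strict Implicit.
Unset Printing Implicit Defensive.
Import Order.TTheory GRing.Theory Num.Theory.
Import numFieldNormedType.Exports.
Local Open Scope classical_set_scope.
Local Open Scope ring_scope.

(* Tangent vectors, vector fields and 1-forms are row vectors of components, *)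
(* so that a differential acts by right multiplication by the jacobian.      *)
(* The induced geometry of M near p is the Riemannian geometry (U, g) of an  *)
(* arbitrary chart phi : U -> M, with g the pullback of the Euclidean metric.*)

Section Calculus.
Variable R : realType.

(* C^oo on A (A open in all uses): all iterated directional derivatives are *)
(* Frechet differentiable at the points of A.                               *)
Definition smooth (V W : normedModType R) (A : set V) (f : V -> W) : Prop :=
  forall (s : seq V) (x : V), A x ->
    differentiable (foldr (fun (w : V) (h : V -> W) => 'D_w h) f s) x.

(* With W = 'rV_m and V = 'rV_m this is also the Euclidean Levi-Civita *)
(* connection.                                                         *)
Definition ddir (V W : normedModType R) (X : V -> V) (f : V -> W) : V -> W :=
  fun x => 'D_(X x) f x.

Definition bracket (V : normedModType R) (X Y : V -> V) : V -> V :=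
  fun x => ddir X Y x - ddir Y X x.

(* Iterated Lebesgue integral over R^n; it is only applied to continuous *)
(* functions with compact support.                                       *)
Fixpoint integral_rV (n : nat) : ('rV[R]_n -> R) -> R :=
  if n is n'.+1 return ('rV[R]_n -> R) -> R
  then fun F => Rintegral (@lebesgue_measure R) setT (fun t : R =>
         integral_rV (fun y : 'rV[R]_n' => F (row_mx (t%:M : 'M[R]_1) y)))
  else fun F => F 0.

Definition test_function (n : nat) (W : normedModType R) (U : set 'rV[R]_n)
    (f : 'rV[R]_n -> W) : Prop :=
  smooth setT f /\
  exists K : set 'rV[R]_n,
    [/\ compact K, K `<=` U & forall x, ~ K x -> f x = 0].

End Calculus.

Definition vfield (R : realType) (n : nat) := 'rV[R]_n -> 'rV[R]_n.
Definition metric (R : realType) (n : nat) := 'rV[R]_n -> 'M[R]_n.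
Definition connection (R : realType) (n : nat) :=
  vfield R n -> vfield R n -> vfield R n.
Definition form0 (R : realType) (n : nat) := 'rV[R]_n -> R.
Definition form1 (R : realType) (n : nat) := 'rV[R]_n -> 'rV[R]_n.
Definition form2 (R : realType) (n : nat) := 'rV[R]_n -> 'M[R]_n.

Section Riemannian.
Variables (R : realType) (n : nat).
Implicit Types (U : set 'rV[R]_n) (g : metric R n) (D : connection R n).
Implicit Types (X Y Z W v : vfield R n).

Definition ip g (x u w : 'rV[R]_n) : R := (u *m g x *m w^T) 0 0.

Definition euclid : metric R n := fun _ => 1%:M.

Definition coord_field (j : 'I_n) : vfield R n := fun _ => delta_mx 0 j.

Record levi_civita U g D : Prop := LeviCivita {
  lc_smooth : forall X Y, smooth U X -> smooth U Y -> smooth U (D X Y);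
  lc_addl : forall X Y Z, smooth U X -> smooth U Y -> smooth U Z ->
    forall x, U x -> D (fun y => X y + Y y) Z x = D X Z x + D Y Z x;
  lc_scalel : forall (f : 'rV[R]_n -> R) X Y,
    smooth U f -> smooth U X -> smooth U Y ->
    forall x, U x -> D (fun y => f y *: X y) Y x = f x *: D X Y x;
  lc_addr : forall X Y Z, smooth U X -> smooth U Y -> smooth U Z ->
    forall x, U x -> D X (fun y => Y y + Z y) x = D X Y x + D X Z x;
  lc_leibniz : forall (f : 'rV[R]_n -> R) X Y,
    smooth U f -> smooth U X -> smooth U Y ->
    forall x, U x ->
      D X (fun y => f y *: Y y) x = ddir X f x *: Y x + f x *: D X Y x;
  lc_torsion_free : forall X Y, smooth U X -> smooth U Y ->
    forall x, U x -> D X Y x - D Y X x = bracket X Y x;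
  lc_metric : forall X Y Z, smooth U X -> smooth U Y -> smooth U Z ->
    forall x, U x -> ddir X (fun y => ip g y (Y y) (Z y)) x
                     = ip g x (D X Y x) (Z x) + ip g x (Y x) (D X Z x)
}.

Definition flat g (X : vfield R n) : form1 R n := fun x => X x *m g x.
Definition sharp g (w : form1 R n) : vfield R n := fun x => w x *m invmx (g x).

Definition d0 (f : form0 R n) : form1 R n :=
  fun x => \row_j 'D_(delta_mx 0 j) f x.

(* The (i, j) entry of a 2-form is its value on (d/dx_i, d/dx_j). *)
Definition d1 (w : form1 R n) : form2 R n :=
  fun x => \matrix_(i, j) ('D_(delta_mx 0 i) (fun y => w y 0 j) x
                           - 'D_(delta_mx 0 j) (fun y => w y 0 i) x).

Definition grad g (f : form0 R n) : vfield R n := sharp g (d0 f).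

Definition ip_form1 g (x : 'rV[R]_n) (w e : 'rV[R]_n) : R :=
  (w *m invmx (g x) *m e^T) 0 0.

(* normalized so that theta^i /\ theta^j, i < j, is orthonormal when theta is *)
Definition ip_form2 g (x : 'rV[R]_n) (a b : 'M[R]_n) : R :=
  2%:R^-1 * \sum_i \sum_j \sum_k \sum_l
    invmx (g x) i k * invmx (g x) j l * a i j * b k l.

Definition vol_integral g (F : 'rV[R]_n -> R) : R :=
  integral_rV (fun x => F x * Num.sqrt (\det (g x))).

(* d^* as the formal L^2 adjoint of d, on 1-forms and on 2-forms. *)
Definition formal_adjoint_d0 U g (ds : form1 R n -> form0 R n) : Prop :=
  forall w : form1 R n, smooth U w ->
    smooth U (ds w) /\
    forall f : form0 R n, test_function U f ->
      vol_integral g (fun x => ip_form1 g x (d0 f x) (w x))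
      = vol_integral g (fun x => f x * ds w x).

Definition formal_adjoint_d1 U g (ds : form2 R n -> form1 R n) : Prop :=
  forall b : form2 R n, smooth U b -> (forall x, U x -> (b x)^T = - b x) ->
    smooth U (ds b) /\
    forall w : form1 R n, test_function U w ->
      vol_integral g (fun x => ip_form2 g x (d1 w x) (b x))
      = vol_integral g (fun x => ip_form1 g x (w x) (ds b x)).

(* ((d d^* + d^* d) v^flat)^sharp, i.e. - Delta_h v *)
Definition hodge g (ds1 : form1 R n -> form0 R n) (ds2 : form2 R n -> form1 R n)
    v : vfield R n :=
  sharp g (fun x => d0 (ds1 (flat g v)) x + ds2 (d1 (flat g v)) x).

Definition bochner (I : finType) D (F : I -> vfield R n) v : vfield R n :=
  fun x => - \sum_a (D (F a) (D (F a) v) x - D (D (F a) (F a)) v x).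

Definition divergence (I : finType) D g (F : I -> vfield R n) v : form0 R n :=
  fun x => \sum_a ip g x (D (F a) v x) (F a x).

Definition riemann D g W X Y Z : form0 R n :=
  fun x => ip g x (D W (D X Y) x - D X (D W Y) x - D (bracket W X) Y x) (Z x).

Definition ricci (I : finType) D g (F : I -> vfield R n) X Y : form0 R n :=
  fun x => \sum_a riemann D g (F a) X Y (F a) x.

Definition Ric (I : finType) D g (F : I -> vfield R n) v : vfield R n :=
  sharp g (fun x => \row_j ricci D g F v (coord_field j) x).

End Riemannian.

Section Submanifold.
Variables (R : realType) (n k : nat).
Local Notation ambient := 'rV[R]_(n + k).
Implicit Types (M O : set ambient) (U : set 'rV[R]_n).
Implicit Types (phi : 'rV[R]_n -> ambient).

Record chart M U phi : Prop := Chart {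
  chart_open : open U;
  chart_smooth : smooth U phi;
  chart_immersion : forall x, U x -> row_free (jacobian phi x);
  chart_embedding : exists (O : set ambient) (psi : ambient -> 'rV[R]_n),
    [/\ open O, phi @` U = M `&` O, (forall x, U x -> psi (phi x) = x) &
        {within phi @` U, continuous psi}]
}.

Definition embedded_submanifold M : Prop :=
  forall q, M q -> exists U phi, chart M U phi /\ (phi @` U) q.

(* The tangent and normal spaces of M at phi x, as row spaces. *)
Definition tangent phi (x : 'rV[R]_n) : 'M[R]_(n + k) := <<jacobian phi x>>%MS.
Definition normal phi (x : 'rV[R]_n) : 'M[R]_(n + k) :=
  kermx (jacobian phi x)^T.

Definition tproj phi (x : 'rV[R]_n) (w : ambient) : ambient :=
  w *m proj_mx (tangent phi x) (normal phi x).
Definition nproj phi (x : 'rV[R]_n) (w : ambient) : ambient :=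
  w *m proj_mx (normal phi x) (tangent phi x).

Definition induced_metric phi : metric R n :=
  fun x => jacobian phi x *m (jacobian phi x)^T.

Definition push phi (x : 'rV[R]_n) (u : 'rV[R]_n) : ambient :=
  u *m jacobian phi x.

(* For X tangent to M along M, the field on U with push phi x (pull phi X x) *)
(* = X (phi x); pinvmx is the left inverse of push phi x on its range.       *)
Definition pull phi (X : vfield R (n + k)) : vfield R n :=
  fun x => X (phi x) *m pinvmx (jacobian phi x).

Definition second_form phi (X Y : vfield R (n + k)) (x : 'rV[R]_n) : ambient :=
  nproj phi x (ddir X Y (phi x)).

Definition weingarten phi (eta : vfield R (n + k)) (x : 'rV[R]_n) (w : ambient)
    : ambient :=
  - tproj phi x ('D_w eta (phi x)).

Definition mean_curvature phi (E : 'I_n -> vfield R (n + k)) (x : 'rV[R]_n)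
    : ambient :=
  n%:R^-1 *: \sum_i second_form phi (E i) (E i) x.

Definition full_frame (E : 'I_n -> vfield R (n + k))
    (N : 'I_k -> vfield R (n + k)) (a : 'I_n + 'I_k) : vfield R (n + k) :=
  match a with inl i => E i | inr l => N l end.

(* phi parametrizes M near p = phi x0; the ambient neighborhood O of p *)
(* carries the extended frame and the extended field v.                *)
Record local_setting M (p : ambient) O U phi (x0 : 'rV[R]_n)
    (E : 'I_n -> vfield R (n + k)) (N : 'I_k -> vfield R (n + k))
    (v : vfield R (n + k)) : Prop := LocalSetting {
  ls_submanifold : embedded_submanifold M;
  ls_point : M p;
  ls_chart : chart M U phi;
  ls_base : U x0 /\ phi x0 = p;
  ls_nbhd : open O /\ phi @` U `<=` O;
  ls_frame_smooth : forall a, smooth O (full_frame E N a);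
  ls_orthonormal : forall q, O q -> forall a b,
    ip (euclid (n := n + k)) q (full_frame E N a q) (full_frame E N b q)
    = (a == b)%:R;
  ls_tangent : forall i x, U x -> (E i (phi x) <= tangent phi x)%MS;
  ls_normal : forall l x, U x -> (N l (phi x) <= normal phi x)%MS;
  ls_field_smooth : smooth O v;
  ls_field_tangent : forall x, U x -> (v (phi x) <= tangent phi x)%MS
}.

End Submanifold.

(* Main.v *)
Require Import Defs.
From mathcomp Require Import all_boot all_order all_algebra.
From mathcomp Require Import all_classical all_reals all_analysis.
From mathcomp Require Import perm ring lra.
Set Implicit Arguments.
Unset Strict Implicit.
Unset Printing Implicit Defensive.
Import Order.TTheory GRing.Theory Num.Theory.
Import numFieldNormedType.Exports.
Local Open Scope classical_set_scope.
Local Open Scope ring_scope.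

(** Fix a chart phi : U -> M with jacobian J, so that a tangent vector a at x is
    pushed forward to a J, the induced metric is g = J J^T, and the orthogonal
    projection onto the tangent space is J^T g^-1 J.  A field of the ambient
    space is only ever differentiated either in directions tangent to M, where by
    the chain rule it can be replaced by its composite with phi, or in normal
    directions, where nothing has to be computed.

    The connection of M.  The tangential part of the Euclidean derivative of a
    pushed forward field is torsion free and metric, and the difference of two
    such connections is a tensor that is symmetric in two slots and
    antisymmetric in two others, hence zero.  So every Levi-Civita connection of
    g is this one ([lc_unique]), and D_X Y = nabla_X Y + II(X, Y)
    ([gauss_formula]).  Differentiating once more and using the symmetry of
    second derivatives gives the Gauss equation ([gauss_equation]).

    The identities.  Each side is tangent, so it suffices to compare inner
    products with an arbitrary tangent vector z.  Applied twice along a frame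
    e_i, the Gauss formula turns the tangential part of the Euclidean Bochner
    Laplacian into that of M, plus sum_i <II(e_i, v), II(e_i, z)>, plus the
    derivative of v along sum_i II(e_i, e_i) = n H.  Expanding in the normal
    frame, the second term is the inner product of z with sum_l W_l W_l v, which
    gives [bochner_identity].  The trace of the Gauss equation reads
    Ric v = n W_H v - sum_l W_l W_l v ([ricci_identity]), and
    W_H v = - (D_v H)^T turns the first identity into the one with Ric and the
    bracket [H, v].  The one with the Hodge Laplacian follows from the
    Weitzenboeck formula, and the one with the divergences from the chain rule
    and from splitting the ambient divergence along the adapted frame.

    The Weitzenboeck formula.  Only adjointness with respect to the iterated
    integral is known about d^*.  Testing against compactly supported functions
    and integrating by parts ([integral_rV_by_parts]) identifies both adjoints:
    with r = sqrt (det g), they are - (1/r) d_j (r V^j) for 1-forms and, in each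
    upper index, the same expression for 2-forms ([adjoint_divergence]); bump
    functions are what makes the test conclusive ([test_functions_separate]).
    By the formula of Jacobi for the derivative of a determinant that expression
    is minus the divergence of V ([divergence_formula]), so that both adjoints
    become covariant objects.  The component of index m of d^* d u is then minus
    the divergence of the contraction of d u with Z = grad x_m, and it is
    computed in the orthonormal frame; since the covariant derivative of Z is
    symmetric and that of the frame antisymmetric, all terms in which one of them
    occurs cancel ([divergence_contracted_d], [hodge_component]).

    A hypersurface is the case k = 1, with the mean curvature field H N: as N has
    length one on a neighborhood, its derivatives are orthogonal to it, and the
    tangential projection kills the terms in which H is differentiated. *)

(** * Derivatives of maps between normed spaces *)

Section Derivatives.
Variable R : realType.
Implicit Types V W : normedModType R.

Lemma derive_near (V W : normedModType R) (A : set V) (f g : V -> W) x w :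
  open A -> A x -> (forall y, A y -> f y = g y) -> 'D_w f x = 'D_w g x.
Proof.
move=> oA Ax fg; apply: near_eq_derive.
by apply: filterS fg _; exact: open_nbhs_nbhs.
Qed.

(** The difference of the two maps vanishes near the point, so its Frechet
    differential is zero. *)
Lemma differentiable_near (V W : normedModType R) (A : set V) (f g : V -> W) x :
  open A -> A x -> (forall y, A y -> f y = g y) ->
  differentiable f x -> differentiable g x.
Proof.
move=> oA Ax fg df.
have nA : nbhs x A by exact: open_nbhs_nbhs.
(* The expansion that characterizes the differential of g - f at x as zero. *)
have h0 : (g - f) \o shift x = cst ((g - f) x) + (0 : V -> W) +o_ 0 id.
  have gf y : A y -> (g - f) y = 0.
    by move=> Ay; rewrite -[(g - f) y]/(g y - f y) fg // subrr.
  apply/eqaddoP => _/posnumP[e]; near=> y.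
  have Ayx : A (y + x).
    near: y; move: nA; rewrite -[nbhs x A]/(\forall z \near x, A z) (near_shift 0 x) subr0.
    exact: id.
  rewrite [X in `|X|](_ : _ = 0) ?normr0 ?mulr_ge0 //.
  rewrite -[LHS]/((g - f) (y + x) - ((g - f) x + 0)) (gf _ Ayx) (gf _ Ax).
  by rewrite addr0 subrr.
have d0 : 'd (g - f) x = (0 : V -> W) :> (V -> W).
  by apply: diff_unique h0; have [] := dcst (0 : W) x.
have dgf : differentiable (g - f) x.
  by apply/diff_locallyP; rewrite d0; split => //; have [] := dcst (0 : W) x.
by have := differentiableD dgf df; rewrite subrK.
Unshelve. all: by end_near.
Qed.

Lemma differentiable_mx (V : normedModType R) m n (f : V -> 'M[R]_(m, n)) x :
  differentiable f x <-> forall i j, differentiable (fun y => f y i j) x.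
Proof.
split=> [df i j|df].
  exact: (differentiable_comp df (differentiable_coord (f x) i j)).
have -> : f = \sum_i (\sum_j (fun y => f y i j *: delta_mx i j)).
  apply/funext => y; rewrite fct_sumE [LHS]matrix_sum_delta; apply: eq_bigr => i _.
  by rewrite fct_sumE.
apply: differentiable_sum => i; apply: differentiable_sum => j.
exact: differentiableZl.
Qed.

Lemma derive_entry (V : normedModType R) m n (f : V -> 'M[R]_(m, n)) x w i j :
  differentiable f x -> ('D_w f x) i j = 'D_w (fun y => f y i j) x.
Proof. by move=> df; rewrite derive_mx ?mxE//; exact: diff_derivable. Qed.

Lemma derive_linD (V W : normedModType R) (f : V -> W) x u w :
  differentiable f x -> 'D_(u + w) f x = 'D_u f x + 'D_w f x.
Proof. by move=> df; rewrite !deriveE // linearD. Qed.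

Lemma derive_linZ (V W : normedModType R) (f : V -> W) x a w :
  differentiable f x -> 'D_(a *: w) f x = a *: 'D_w f x.
Proof. by move=> df; rewrite !deriveE // linearZ. Qed.

Lemma derive_add (V W : normedModType R) (f g : V -> W) x w :
  differentiable f x -> differentiable g x ->
  'D_w (fun y => f y + g y) x = 'D_w f x + 'D_w g x.
Proof. by move=> df dg; apply: deriveD; exact: diff_derivable. Qed.

Lemma derive_opp (V W : normedModType R) (f : V -> W) x w :
  differentiable f x -> 'D_w (fun y => - f y) x = - 'D_w f x.
Proof. by move=> df; apply: deriveN; exact: diff_derivable. Qed.

Lemma derive_mul (V : normedModType R) (f g : V -> R) x w :
  differentiable f x -> differentiable g x ->
  'D_w (fun y => f y * g y) x = 'D_w f x * g x + f x * 'D_w g x.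
Proof.
move=> df dg; have := @deriveM R V f g x w (diff_derivable df) (diff_derivable dg).
by rewrite /GRing.scale /= => ->; rewrite addrC mulrC.
Qed.

Lemma derive_bigsum (V W : normedModType R) (I : finType) (f : I -> V -> W) x w :
  (forall i, differentiable (f i) x) ->
  'D_w (fun y => \sum_i f i y) x = \sum_i 'D_w (f i) x.
Proof.
move=> df; rewrite -[fun y => _](fct_sumE).
suff [] : differentiable (\sum_i f i) x /\ 'D_w (\sum_i f i) x = \sum_i 'D_w (f i) x.
  by [].
elim/big_rec2: _ => [|i h1 h2 _ [d1 e1]].
  by split; [exact: differentiable_cst|exact: derive_cst].
by split; [exact: differentiableD|rewrite derive_add // e1].
Qed.

Lemma differentiable_bigsum (V W : normedModType R) (I : finType) (f : I -> V -> W) x :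
  (forall i, differentiable (f i) x) -> differentiable (fun y => \sum_i f i y) x.
Proof.
move=> df; rewrite -[fun y => _](fct_sumE).
by elim/big_ind: _ => [|g h dg dh|i _];
  [exact: differentiable_cst|exact: differentiableD|exact: df].
Qed.

Lemma differentiable_mulmx (V : normedModType R) m n q (f : V -> 'M[R]_(m, n))
    (g : V -> 'M[R]_(n, q)) x :
  differentiable f x -> differentiable g x -> differentiable (fun y => f y *m g y) x.
Proof.
move=> /differentiable_mx df /differentiable_mx dg; apply/differentiable_mx => i j.
under eq_fun do rewrite mxE.
by apply: differentiable_bigsum => k; apply: differentiableM.
Qed.

Lemma derive_mulmx (V : normedModType R) m n q (f : V -> 'M[R]_(m, n))
    (g : V -> 'M[R]_(n, q)) x w :
  differentiable f x -> differentiable g x ->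
  'D_w (fun y => f y *m g y) x = 'D_w f x *m g x + f x *m 'D_w g x.
Proof.
move=> df dg; apply/matrixP => i j.
rewrite derive_entry; last exact: differentiable_mulmx.
under eq_fun do rewrite mxE.
have dfi := (differentiable_mx f x).1 df; have dgi := (differentiable_mx g x).1 dg.
rewrite derive_bigsum => [|k]; last exact: differentiableM.
rewrite !mxE -big_split; apply: eq_bigr => k _ /=.
by rewrite derive_mul // !derive_entry.
Qed.

Lemma derive_scale (V : normedModType R) m n (k : V -> R) (f : V -> 'M[R]_(m, n)) x w :
  differentiable k x -> differentiable f x ->
  'D_w (fun y => k y *: f y) x = 'D_w k x *: f x + k x *: 'D_w f x.
Proof.
move=> dk df; have dfi := (differentiable_mx f x).1 df.
have E i j : (fun y => (k y *: f y) i j) = (fun y => k y * f y i j).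
  by apply/funext => y; rewrite mxE.
apply/matrixP => i j; rewrite derive_entry; last first.
  by apply/differentiable_mx => a b; rewrite E; exact: differentiableM.
by rewrite E (derive_mul _ dk (dfi i j)) !mxE (derive_entry _ i j df).
Qed.

Lemma derive_comp (U V W : normedModType R) (f : U -> V) (g : V -> W) x w :
  differentiable f x -> differentiable g (f x) ->
  'D_w (fun y => g (f y)) x = 'D_('D_w f x) g (f x).
Proof.
move=> df dg.
have := diff_comp df dg => /(congr1 (fun h => h w)) /= h.
by rewrite (deriveE _ dg) (deriveE _ df) -h -deriveE //; exact: (differentiable_comp df dg).
Qed.

Lemma derive_scalar (f : R -> R) (x a : R) : differentiable f x ->
  'D_a f x = a * 'D_1 f x.
Proof.
move=> df; have := derive_linZ a (1 : R) df.
by rewrite {1}/GRing.scale /= mulr1.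
Qed.

End Derivatives.

(** * Smooth maps *)

Section SmoothUpTo.
Variable R : realType.

(** Smoothness to a finite order.  Closure properties are proved at each order by
    induction, because the derivative of a product, inverse or composite again
    contains the original maps, at one order less. *)
Fixpoint smooth_upto (m : nat) (V W : normedModType R) (A : set V) (f : V -> W) : Prop :=
  if m is m'.+1 then
    (forall x, A x -> differentiable f x) /\ forall w, smooth_upto m' A ('D_w f)
  else True.

Lemma smoothP (V W : normedModType R) (A : set V) (f : V -> W) :
  smooth A f <-> forall m, smooth_upto m A f.
Proof.
split=> [sf m|sf s].
  elim: m f sf => // m IH f sf; split=> [x Ax|w]; first exact: (sf [::] x Ax).
  apply: IH => s x Ax.
  by have := sf (rcons s w) x Ax; rewrite -cats1 foldr_cat.
elim/last_ind: s f sf => [|s w IH] f sf x Ax /=; first by have [+ _] := sf 1%N; apply.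
rewrite -cats1 foldr_cat; apply: IH => // m.
by have [_] := sf m.+1; apply.
Qed.

Variables (V : normedModType R) (A : set V).
Hypothesis oA : open A.

Lemma smooth_upto_ext (W : normedModType R) m (f g : V -> W) :
  (forall x, A x -> f x = g x) -> smooth_upto m A f -> smooth_upto m A g.
Proof.
elim: m f g => //= m IH f g fg [df Df]; split=> [x Ax|w].
  exact: (differentiable_near oA Ax fg (df x Ax)).
by apply: IH (Df w) => x Ax; exact: derive_near oA Ax fg.
Qed.

Lemma smooth_uptoW (W : normedModType R) m (f : V -> W) :
  smooth_upto m.+1 A f -> smooth_upto m A f.
Proof.
by elim: m f => // m IH f [df Df]; split => // w; exact: IH (Df w).
Qed.

Lemma smooth_upto_cst (W : normedModType R) m (c : W) : smooth_upto m A (fun _ => c).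
Proof.
elim: m c => //= m IH c; split=> [x _|w]; first exact: differentiable_cst.
by apply: (smooth_upto_ext _ (IH 0)) => x _; rewrite derive_cst.
Qed.

Lemma smooth_uptoD (W : normedModType R) m (f g : V -> W) :
  smooth_upto m A f -> smooth_upto m A g -> smooth_upto m A (fun x => f x + g x).
Proof.
elim: m f g => //= m IH f g [df Df] [dg Dg]; split=> [x Ax|w].
  by apply: differentiableD; [exact: df|exact: dg].
apply: smooth_upto_ext (IH _ _ (Df w) (Dg w)) => x Ax.
by rewrite derive_add //; [exact: df|exact: dg].
Qed.

Lemma smooth_uptoN (W : normedModType R) m (f : V -> W) :
  smooth_upto m A f -> smooth_upto m A (fun x => - f x).
Proof.
elim: m f => //= m IH f [df Df]; split=> [x Ax|w].
  by apply: differentiableN; exact: df.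
apply: smooth_upto_ext (IH _ (Df w)) => x Ax.
by rewrite derive_opp //; exact: df.
Qed.

Lemma smooth_uptoM m (f g : V -> R) :
  smooth_upto m A f -> smooth_upto m A g -> smooth_upto m A (fun x => f x * g x).
Proof.
elim: m f g => // m IH f g sf sg.
have sf' := smooth_uptoW sf; have sg' := smooth_uptoW sg.
case: sf sg => df Df [dg Dg]; split=> [x Ax|w].
  by apply: differentiableM; [exact: df|exact: dg].
apply: smooth_upto_ext (smooth_uptoD (IH _ _ (Df w) sg') (IH _ _ sf' (Dg w))) => x Ax.
by rewrite derive_mul //; [exact: df|exact: dg].
Qed.

Lemma smooth_upto_sum (W : normedModType R) m (I : finType) (f : I -> V -> W) :
  (forall i, smooth_upto m A (f i)) -> smooth_upto m A (fun x => \sum_i f i x).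
Proof.
move=> sf; rewrite -[fun y => _](fct_sumE).
by elim/big_ind: _ => [|g h sg sh|i _];
  [exact: smooth_upto_cst|exact: smooth_uptoD|exact: sf].
Qed.

Lemma smooth_upto_mx m p q (f : V -> 'M[R]_(p, q)) :
  smooth_upto m A f <-> forall i j, smooth_upto m A (fun x => f x i j).
Proof.
elim: m f => //= m IH f; split=> [[df Df] i j|sf].
  have dfij x : A x -> differentiable (fun x => f x i j) x.
    by move=> Ax; exact: ((differentiable_mx _ _).1 (df x Ax)).
  split=> // w.
  apply: smooth_upto_ext ((IH _).1 (Df w) i j) => x Ax.
  by rewrite derive_entry //; exact: df.
have df x : A x -> differentiable f x.
  by move=> Ax; apply/differentiable_mx => i j; have [+ _] := sf i j; apply.
split=> // w; apply/IH => i j.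
have [_ /(_ w)] := sf i j; apply: smooth_upto_ext => x Ax.
by rewrite derive_entry //; exact: df.
Qed.

(** The derivative - f' / f^2 only involves f' and the inverse itself, to which the
    induction hypothesis applies. *)
Lemma smooth_upto_inv m (f : V -> R) : (forall x, A x -> f x != 0) ->
  smooth_upto m A f -> smooth_upto m A (fun x => (f x)^-1).
Proof.
move=> f0; elim: m => // m IH sf.
have sV := IH (smooth_uptoW sf); case: sf => df Df; split=> [x Ax|w].
  by apply: differentiableV; [exact: df|exact: f0].
have sD := smooth_uptoN (smooth_uptoM (smooth_uptoM sV sV) (Df w)).
apply: (smooth_upto_ext _ sD) => x Ax.
rewrite deriveV ?f0 //; last by apply: diff_derivable; exact: df.
by rewrite /GRing.scale /= mulNr -expr2 exprVn.
Qed.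

(** The derivative f' / (2 sqrt f) only involves f' and the square root itself. *)
Lemma smooth_upto_sqrt m (f : V -> R) : (forall x, A x -> 0 < f x) ->
  smooth_upto m A f -> smooth_upto m A (fun x => Num.sqrt (f x)).
Proof.
move=> f0; elim: m => // m IH sf.
have sS := IH (smooth_uptoW sf); case: sf => df Df.
have dsq x : A x -> differentiable (@Num.sqrt R) (f x).
  by move=> Ax; apply/derivable1_diffP; apply: ex_derive; exact: is_derive1_sqrt (f0 x Ax).
split=> [x Ax|w].
  by apply: (differentiable_comp (df x Ax) (dsq x Ax)).
have nz x : A x -> 2 * Num.sqrt (f x) != 0.
  by move=> Ax; rewrite mulf_neq0 // ?pnatr_eq0 // gt_eqF // sqrtr_gt0 f0.
have sD := smooth_uptoM (Df w)
   (smooth_upto_inv nz (smooth_uptoM (smooth_upto_cst _ (2 : R)) sS)).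
apply: (smooth_upto_ext _ sD) => x Ax.
rewrite (@derive_comp R _ _ _ f (@Num.sqrt R)) //; [|exact: df|exact: dsq].
by rewrite derive_scalar ?derive_sqrt ?f0 //; exact: dsq.
Qed.

End SmoothUpTo.

Section SmoothClosure.
Variables (R : realType) (V : normedModType R) (A : set V).
Hypothesis oA : open A.

Lemma smooth_ext (W : normedModType R) (f g : V -> W) :
  (forall x, A x -> f x = g x) -> smooth A f -> smooth A g.
Proof. by move=> fg /smoothP sf; apply/smoothP => m; apply: smooth_upto_ext (sf m). Qed.

Lemma smooth_differentiable (W : normedModType R) (f : V -> W) x :
  smooth A f -> A x -> differentiable f x.
Proof. by move=> sf; exact: (sf [::]). Qed.

Lemma smooth_continuous (W : normedModType R) (f : V -> W) x :
  smooth A f -> A x -> {for x, continuous f}.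
Proof. by move=> sf Ax; apply: differentiable_continuous; exact: smooth_differentiable. Qed.

Lemma smooth_derive (W : normedModType R) (f : V -> W) w :
  smooth A f -> smooth A ('D_w f).
Proof. by move=> /smoothP sf; apply/smoothP => m; have [_] := sf m.+1; apply. Qed.

Lemma smooth_cst (W : normedModType R) (c : W) : smooth A (fun _ => c).
Proof. by apply/smoothP => m; exact: smooth_upto_cst. Qed.

Lemma smoothD (W : normedModType R) (f g : V -> W) :
  smooth A f -> smooth A g -> smooth A (fun x => f x + g x).
Proof. by move=> /smoothP sf /smoothP sg; apply/smoothP => m; exact: smooth_uptoD. Qed.

Lemma smoothN (W : normedModType R) (f : V -> W) :
  smooth A f -> smooth A (fun x => - f x).
Proof. by move=> /smoothP sf; apply/smoothP => m; exact: smooth_uptoN. Qed.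

Lemma smoothB (W : normedModType R) (f g : V -> W) :
  smooth A f -> smooth A g -> smooth A (fun x => f x - g x).
Proof. by move=> sf sg; apply: smoothD => //; exact: smoothN. Qed.

Lemma smoothM (f g : V -> R) :
  smooth A f -> smooth A g -> smooth A (fun x => f x * g x).
Proof. by move=> /smoothP sf /smoothP sg; apply/smoothP => m; exact: smooth_uptoM. Qed.

Lemma smooth_sum (W : normedModType R) (I : finType) (f : I -> V -> W) :
  (forall i, smooth A (f i)) -> smooth A (fun x => \sum_i f i x).
Proof.
by move=> sf; apply/smoothP => m; apply: smooth_upto_sum => // i; move: m; apply/smoothP.
Qed.

Lemma smooth_prod (I : finType) (f : I -> V -> R) :
  (forall i, smooth A (f i)) -> smooth A (fun x => \prod_i f i x).
Proof.
move=> sf; have -> : (fun x => \prod_i f i x) = \prod_i f i.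
  by rewrite fct_prodE.
by elim/big_ind: _ => [|g h sg sh|i _]; [exact: smooth_cst|exact: smoothM|exact: sf].
Qed.

Lemma smooth_mx p q (f : V -> 'M[R]_(p, q)) :
  smooth A f <-> forall i j, smooth A (fun x => f x i j).
Proof.
split=> [/smoothP sf i j|sf]; apply/smoothP => m.
  exact: ((smooth_upto_mx oA m f).1 (sf m)).
by apply/smooth_upto_mx => // i j; move: m; apply/smoothP.
Qed.

Lemma smoothV (f : V -> R) : (forall x, A x -> f x != 0) ->
  smooth A f -> smooth A (fun x => (f x)^-1).
Proof. by move=> f0 /smoothP sf; apply/smoothP => m; exact: smooth_upto_inv. Qed.

Lemma smooth_sqrt (f : V -> R) : (forall x, A x -> 0 < f x) ->
  smooth A f -> smooth A (fun x => Num.sqrt (f x)).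
Proof. by move=> f0 /smoothP sf; apply/smoothP => m; exact: smooth_upto_sqrt. Qed.

Lemma smoothZ p q (k : V -> R) (f : V -> 'M[R]_(p, q)) :
  smooth A k -> smooth A f -> smooth A (fun x => k x *: f x).
Proof.
move=> sk /smooth_mx sf; apply/smooth_mx => i j.
by under eq_fun do rewrite mxE; exact: smoothM.
Qed.

Lemma smooth_mulmx p q r (f : V -> 'M[R]_(p, q)) (g : V -> 'M[R]_(q, r)) :
  smooth A f -> smooth A g -> smooth A (fun x => f x *m g x).
Proof.
move=> /smooth_mx sf /smooth_mx sg; apply/smooth_mx => i j.
under eq_fun do rewrite mxE; apply: smooth_sum => k; exact: smoothM.
Qed.

Lemma smooth_tr p q (f : V -> 'M[R]_(p, q)) :
  smooth A f -> smooth A (fun x => (f x)^T).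
Proof.
by move=> /smooth_mx sf; apply/smooth_mx => i j; under eq_fun do rewrite mxE; exact: sf.
Qed.

Lemma smooth_det p (f : V -> 'M[R]_p) : smooth A f -> smooth A (fun x => \det (f x)).
Proof.
move=> /smooth_mx sf; rewrite /determinant; apply: smooth_sum => s.
apply: smoothM; first exact: smooth_cst.
by apply: (@smooth_prod _ (fun i x => f x i ((s : {perm 'I_p}) i))).
Qed.

(** Cramer's rule: the entries are cofactors divided by the determinant. *)
Lemma smooth_invmx p (f : V -> 'M[R]_p) : (forall x, A x -> f x \in unitmx) ->
  smooth A f -> smooth A (fun x => invmx (f x)).
Proof.
move=> fu sf; apply: (@smooth_ext _ (fun x => (\det (f x))^-1 *: \adj (f x))) => [x Ax|].
  by rewrite /invmx fu.
apply: smoothZ; first apply: smoothV; last 2 first.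
- exact: smooth_det.
- apply/smooth_mx => i j; under eq_fun do rewrite mxE /cofactor.
  apply: smoothM; first exact: smooth_cst.
  apply: smooth_det; apply/smooth_mx => k l; under eq_fun do rewrite !mxE.
  exact: ((smooth_mx _).1 sf).
- by move=> x Ax; rewrite -unitfE -unitmxE fu.
Qed.

End SmoothClosure.

Lemma smooth_comp_scalar (R : realType) (V : normedModType R) (A : set V) (B : set R) (f : V -> R) (g : R -> R) :
  open A -> open B ->
  (forall x, A x -> B (f x)) -> smooth A f -> smooth B g -> smooth A (fun x => g (f x)).
Proof.
move=> oA oB AB sf sg; apply/smoothP => m.
elim: m g sg => // m IH g sg; have dg := smooth_differentiable sg.
have df := smooth_differentiable sf; split=> [x Ax|w].
  by apply: (differentiable_comp (df x Ax)); apply: dg; exact: AB.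
have sD := smooth_uptoM oA (IH _ (smooth_derive (1 : R) sg)) ((smoothP _ _).1 (smooth_derive w sf) m).
apply: (smooth_upto_ext oA _ sD) => x Ax.
have [dfx dgx] := (df x Ax, dg _ (AB x Ax)).
by rewrite (derive_comp _ dfx dgx) (derive_scalar ('D_w f x) dgx) mulrC.
Qed.

Lemma rV_delta (R : realType) n (u : 'rV[R]_n) : u = \sum_i u 0 i *: delta_mx 0 i.
Proof. by rewrite {1}[u]matrix_sum_delta big_ord1. Qed.

(** A Frechet differential is linear, so a directional derivative is a combination
    of the partial ones; this is how fields of directions are reduced to constant
    ones. *)
Lemma derive_delta (R : realType) n (W : normedModType R) (g : 'rV[R]_n -> W) x u :
  differentiable g x -> 'D_u g x = \sum_i u 0 i *: 'D_(delta_mx 0 i) g x.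
Proof.
move=> dg; rewrite {1}(rV_delta u) deriveE // linear_sum; apply: eq_bigr => i _.
by rewrite linearZ deriveE.
Qed.

Section SmoothComposition.
Variables (R : realType) (V : normedModType R) (A : set V) (n : nat) (B : set 'rV[R]_n).
Hypotheses (oA : open A) (oB : open B).

(** By the chain rule the derivative is a combination of the partial derivatives of
    the outer map, composed with the same inner map, so that the induction on the
    order runs over all outer maps at once. *)
Lemma smooth_comp (f : V -> 'rV[R]_n) p q (g : 'rV[R]_n -> 'M[R]_(p, q)) :
  (forall x, A x -> B (f x)) -> smooth A f -> smooth B g -> smooth A (fun x => g (f x)).
Proof.
move=> AB sf /(smooth_mx oB) sg; apply/(smooth_mx oA) => i j; move: (sg i j).
have [h hE] : exists h : 'rV[R]_n -> R, h = fun x => g x i j by eexists.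
rewrite -[fun x => g (f x) i j]/(fun x => (fun y => g y i j) (f x)) -hE.
move=> {g i j hE sg}sg; apply/smoothP => m.
elim: m h sg => // m IH g sg; have dg := smooth_differentiable sg.
have df := smooth_differentiable sf; split=> [x Ax|w].
  by apply: (differentiable_comp (df x Ax)); apply: dg; exact: AB.
have sfw := (smooth_mx oA _).1 (smooth_derive w sf) 0.
have sD i := smooth_uptoM oA ((smoothP _ _).1 (sfw i) m) (IH _ (smooth_derive (delta_mx 0 i) sg)).
apply: (smooth_upto_ext oA _ (smooth_upto_sum oA sD)) => x Ax.
have [dfx dgx] := (df x Ax, dg _ (AB x Ax)).
by rewrite (derive_comp _ dfx dgx) (derive_delta _ dgx).
Qed.

End SmoothComposition.

Section SmoothDirectional.
Variables (R : realType) (n : nat) (A : set 'rV[R]_n).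
Hypothesis oA : open A.

Lemma smooth_ddir p q X (f : 'rV[R]_n -> 'M[R]_(p, q)) :
  smooth A X -> smooth A f -> smooth A (ddir X f).
Proof.
move=> sX sf.
apply: (@smooth_ext _ _ _ oA _ (fun x => \sum_i X x 0 i *: 'D_(delta_mx 0 i) f x)).
  by move=> x Ax; rewrite /ddir derive_delta //; exact: smooth_differentiable sf Ax.
apply: smooth_sum => // i; apply: smoothZ => //; first exact: ((smooth_mx oA _).1 sX).
exact: smooth_derive.
Qed.

Lemma smooth_bracket (X Y : vfield R n) :
  smooth A X -> smooth A Y -> smooth A (bracket X Y).
Proof. by move=> sX sY; apply: smoothB => //; exact: smooth_ddir. Qed.

Lemma jacobian_entry m (f : 'rV[R]_n -> 'rV[R]_m) x i j : differentiable f x ->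
  jacobian f x i j = ('D_(delta_mx 0 i) f x) 0 j.
Proof. by move=> df; rewrite deriveEjacobian // -rowE [RHS]mxE. Qed.

Lemma smooth_jacobian m (f : 'rV[R]_n -> 'rV[R]_m) :
  smooth A f -> smooth A (jacobian f).
Proof.
move=> sf; apply/smooth_mx => // i j.
apply: (@smooth_ext _ _ _ oA _ (fun x => ('D_(delta_mx 0 i) f x) 0 j)) => [x Ax|].
  by rewrite jacobian_entry //; exact: smooth_differentiable sf Ax.
by have /(smooth_mx oA) := smooth_derive (delta_mx 0 i) sf; apply.
Qed.

Lemma smooth_coord (j : 'I_n) : smooth A (fun x : 'rV[R]_n => x 0 j).
Proof.
apply/smoothP => -[|m] //; split=> [x Ax|w]; first by apply: differentiable_coord.
apply: (smooth_upto_ext oA _ (smooth_upto_cst oA m (w 0 j))) => x Ax.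
rewrite -(@derive_entry _ _ _ _ id) ?derive_id //.
Qed.

End SmoothDirectional.

(** * Symmetry of second derivatives *)

Lemma subr_swap (R : zmodType) (a b c d : R) : a - b - (c - d) = a - c - (b - d).
Proof. by rewrite !opprB addrACA [RHS]addrACA [- b - c]addrC. Qed.

Section Schwarz.
Variables (R : realType) (V : normedModType R).

Lemma is_derive_line (W : normedModType R) (f : V -> W) (x u : V) (s : R) :
  differentiable f (x + s *: u) ->
  is_derive s 1 (fun t : R => f (x + t *: u)) ('D_u f (x + s *: u)).
Proof.
move=> df.
have dl : differentiable (fun t : R => x + t *: u) s.
  by apply: differentiableD; [exact: differentiable_cst|apply: differentiableZl].
have dfl : differentiable (fun t : R => f (x + t *: u)) s.
  exact: (differentiable_comp dl df).
apply: DeriveDef; first exact: diff_derivable.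
rewrite (derive_comp _ dl df); congr ('D_ _ f _).
rewrite derive_add; [|exact: differentiable_cst|exact: differentiableZl].
rewrite derive_cst add0r deriveE; last exact: differentiableZl.
by rewrite diffZl // -deriveE // derive_id scale1r.
Qed.

Lemma mvt_line (f : V -> R) (x u : V) (h : R) : 0 <= h ->
  (forall s, 0 <= s <= h -> differentiable f (x + s *: u)) ->
  exists2 s, 0 <= s <= h & f (x + h *: u) - f x = h * 'D_u f (x + s *: u).
Proof.
move=> h0 df.
have dl s : 0 <= s <= h -> is_derive s 1 (fun t : R => f (x + t *: u)) ('D_u f (x + s *: u)).
  by move=> sh; apply: is_derive_line; exact: df.
have d1 s : s \in `]0, h[ -> is_derive s 1 (fun t : R => f (x + t *: u)) ('D_u f (x + s *: u)).
  by rewrite in_itv /= => /andP[s0 sh]; apply: dl; rewrite !ltW.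
have c1 : {within `[0, h], continuous (fun t : R => f (x + t *: u))}.
  apply: derivable_within_continuous => s; rewrite in_itv /= => sh.
  by have [] := dl s sh.
have [s] := MVT_segment h0 d1 c1.
by rewrite in_itv /= scale0r addr0 subr0 mulrC => sh E; exists s.
Qed.

Variables (A : set V).
Hypothesis oA : open A.

(** Second differences are second derivatives: the mean value theorem is applied to
    the increment of f in the direction w, then to 'D_u f in that direction.  The
    expression on the left is symmetric in u and w. *)
Lemma mvt_square (f : V -> R) (x u w : V) (h : R) : smooth A f -> 0 < h ->
  (forall s t, 0 <= s <= h -> 0 <= t <= h -> A (x + s *: u + t *: w)) ->
  exists s t, [/\ 0 <= s <= h, 0 <= t <= h &
    f (x + h *: u + h *: w) - f (x + h *: u) - (f (x + h *: w) - f x)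
    = h * (h * 'D_w ('D_u f) (x + s *: u + t *: w))].
Proof.
move=> sf h0 AA; have h0' := ltW h0.
have hh : 0 <= h <= h by apply/andP.
have zh : (0 : R) <= 0 <= h by apply/andP.
have df y : A y -> differentiable f y by exact: smooth_differentiable.
have AA0 s : 0 <= s <= h -> A (x + s *: u).
  by move=> sh; have := AA s 0 sh zh; rewrite scale0r addr0.
have dc y : A (h *: w + y) -> differentiable (fun y => f (h *: w + y)) y.
  move=> Ay; apply: (@differentiable_comp _ _ _ _ (fun y => h *: w + y) f); last exact: df.
  by apply: differentiableD; [exact: differentiable_cst|].
(* The increment of f in the direction w; its derivative along u is an increment of
   'D_u f. *)
pose phi y := f (h *: w + y) - f y.
have dphi s : 0 <= s <= h -> differentiable phi (x + s *: u).
  move=> sh; apply: differentiableB; first by apply: dc; rewrite addrC; exact: AA.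
  by apply: df; exact: AA0.
have [s sh E] := mvt_line h0' dphi.
have E2 : 'D_u phi (x + s *: u) = 'D_u f (x + s *: u + h *: w) - 'D_u f (x + s *: u).
  have Ah : A (h *: w + (x + s *: u)) by rewrite addrC; exact: AA.
  rewrite /phi derive_add; last 2 first.
  - exact: dc.
  - by apply: differentiableN; apply: df; exact: AA0.
  rewrite derive_opp; last by apply: df; exact: AA0.
  congr (_ - _).
  have dt : differentiable (fun y => h *: w + y) (x + s *: u).
    by apply: differentiableD; [exact: differentiable_cst|].
  rewrite (derive_comp _ dt (df _ Ah)) [h *: w + _]addrC; congr ('D_ _ f _).
  rewrite derive_add; [|exact: differentiable_cst|by []].
  by rewrite derive_cst add0r (@derive_id _ _ (x + s *: u) u).
have [|t th E3] := @mvt_line ('D_u f) (x + s *: u) w h h0'.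
  by move=> t th; apply: smooth_differentiable (smooth_derive u sf) _; exact: AA.
exists s, t; split => //; rewrite -E3 -E2 -E /phi.
rewrite ![h *: w + _]addrC [x + h *: w]addrC; ring.
Qed.

(** Both mixed derivatives, at points as close to x as desired, are the same second
    difference divided by h^2; they are continuous. *)
Lemma derive_comm_scalar (f : V -> R) x u w : smooth A f -> A x ->
  'D_w ('D_u f) x = 'D_u ('D_w f) x.
Proof.
move=> sf Ax; apply/eqP; rewrite -subr_eq0 -normr_le0; apply/ler_addgt0Pl => e e0.
rewrite addr0.
have near_c v v' : \forall y \near x, `|'D_v ('D_v' f) x - 'D_v ('D_v' f) y| < e / 2.
  have /cvgrPdist_lt : {for x, continuous ('D_v ('D_v' f))}.
    by apply: smooth_continuous Ax; do 2!apply: smooth_derive.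
  by apply; rewrite divr_gt0.
have /nbhs_ballP[d /= d0 dB] : nbhs x (A `&`
   ([set y | `|'D_w ('D_u f) x - 'D_w ('D_u f) y| < e / 2] `&`
    [set y | `|'D_u ('D_w f) x - 'D_u ('D_w f) y| < e / 2])).
  apply: filterI; first exact: open_nbhs_nbhs.
  by apply: filterI; exact: near_c.
(* The squares spanned by h u and h w must fit into the ball; adding 1 avoids a
   division by zero when both vectors vanish. *)
pose h := d / (2 * (`|u| + `|w| + 1)).
have q0 : 0 < `|u| + `|w| + 1 by rewrite ltr_wpDl // addr_ge0.
have h0 : 0 < h by rewrite divr_gt0 // mulr_gt0.
have inB s t : 0 <= s <= h -> 0 <= t <= h -> ball x d (x + s *: u + t *: w).
  move=> /andP[s0 sh] /andP[t0 th]; rewrite -ball_normE /ball_ /= -addrA opprD addNKr normrN.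
  apply: (@le_lt_trans _ _ (h * (`|u| + `|w|))).
    rewrite mulrDr; apply: (le_trans (ler_normD _ _)).
    by rewrite !normrZ lerD // ler_wpM2r // ger0_norm.
  apply: (@lt_le_trans _ _ (h * (2 * (`|u| + `|w| + 1)))); last first.
    by rewrite /h mulfVK // gt_eqF // mulr_gt0.
  by rewrite ltr_pM2l // mulrDr mulr1 ltr_pwDr // mulr_natl mulr2n lerDl addr_ge0.
have [s [t [sh th E1]]] : exists s t, [/\ 0 <= s <= h, 0 <= t <= h &
    f (x + h *: u + h *: w) - f (x + h *: u) - (f (x + h *: w) - f x)
    = h * (h * 'D_w ('D_u f) (x + s *: u + t *: w))].
  by apply: mvt_square => // s t sh th; exact: (dB _ (inB s t sh th)).1.
have [s' [t' [sh' th' E2]]] : exists s t, [/\ 0 <= s <= h, 0 <= t <= h &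
    f (x + h *: w + h *: u) - f (x + h *: w) - (f (x + h *: u) - f x)
    = h * (h * 'D_u ('D_w f) (x + s *: w + t *: u))].
  apply: mvt_square => // s' t' sh' th'; rewrite addrAC.
  exact: (dB _ (inB t' s' th' sh')).1.
have EE : 'D_w ('D_u f) (x + s *: u + t *: w) = 'D_u ('D_w f) (x + s' *: w + t' *: u).
  apply: (mulfI (lt0r_neq0 h0)); apply: (mulfI (lt0r_neq0 h0)).
  by rewrite -E1 subr_swap [x + h *: u + h *: w]addrAC; exact: E2.
have [_ [/= c1 _]] := dB _ (inB s t sh th).
have [_ [/= _ c2]] := dB _ (inB t' s' th' sh').
rewrite EE in c1; rewrite addrAC in c2.
have -> : 'D_w ('D_u f) x - 'D_u ('D_w f) x
   = ('D_w ('D_u f) x - 'D_u ('D_w f) (x + s' *: w + t' *: u)) -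
     ('D_u ('D_w f) x - 'D_u ('D_w f) (x + s' *: w + t' *: u)).
  by rewrite opprB addrA subrK.
apply: (le_trans (ler_normB _ _)); rewrite (splitr e); apply: ltW.
exact: (ltrD c1 c2).
Qed.

Lemma derive_comm p q (f : V -> 'M[R]_(p, q)) x u w : smooth A f -> A x ->
  'D_w ('D_u f) x = 'D_u ('D_w f) x.
Proof.
move=> sf Ax; apply/matrixP => i j.
have E a b : ('D_a ('D_b f) x) i j = 'D_a ('D_b (fun y => f y i j)) x.
  rewrite derive_entry; last by apply: smooth_differentiable Ax; exact: smooth_derive.
  apply: (derive_near _ oA Ax) => y Ay; rewrite derive_entry //.
  exact: smooth_differentiable sf Ay.
apply: (etrans (E w u)); apply: (etrans _ (esym (E u w))).
apply: derive_comm_scalar Ax.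
by have /(smooth_mx oA) := sf; apply.
Qed.

End Schwarz.

(** * Iterated integrals of compactly supported Lipschitz functions *)

Section OneVariable.
Variable R : realType.
Local Notation mu := (@lebesgue_measure R).

(** Lipschitz maps rather than continuous ones: partial integration preserves a
    Lipschitz bound with an explicit constant, without any uniform continuity. *)
Definition lipschitz_supported1 (B : R) (g : R -> R) : Prop :=
  (exists M : R, forall s t, `|g s - g t| <= M * `|s - t|) /\
  (forall t, g t != 0 -> `|t| <= B).

Lemma lipschitz_continuous B (g : R -> R) : lipschitz_supported1 B g -> continuous g.
Proof.
move=> [[M gM] _] t; apply/cvgrPdist_lt => e e0.
pose k := `|M| + 1.
have k0 : 0 < k by rewrite ltr_wpDl.
near=> s; apply: (le_lt_trans (gM _ _)).
apply: (@le_lt_trans _ _ (k * `|t - s|)).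
  by rewrite ler_wpM2r // /k (le_trans (ler_norm M)) // lerDl.
rewrite mulrC -ltr_pdivlMr //; near: s.
by apply: (@cvgr_dist_lt _ _ _ (nbhs t) _ id t) => //; rewrite divr_gt0.
Unshelve. all: by end_near.
Qed.

Lemma Rintegral_segment B (g : R -> R) : lipschitz_supported1 B g ->
  Rintegral mu setT g = Rintegral mu `[- B, B] g.
Proof.
move=> [_ gB]; rewrite Rintegral_mkcond [RHS]Rintegral_mkcond.
congr Rintegral; apply/funext => t; rewrite !patchE in_setT.
case: ifPn => // /negP h; apply/eqP/contraT => /gB tB; exfalso; apply: h.
by rewrite inE /= in_itv /= -ler_norml.
Qed.

Lemma continuous_integrable a b (g : R -> R) : continuous g ->
  mu.-integrable `[a, b] (EFin \o g).
Proof.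
move=> cg; apply: continuous_compact_integrable; first exact: segment_compact.
exact: continuous_subspaceT.
Qed.

Lemma Rintegral_bound B C (g : R -> R) : 0 <= B -> lipschitz_supported1 B g ->
  (forall t, `|g t| <= C) -> `|Rintegral mu setT g| <= 2 * B * C.
Proof.
move=> B0 lg gC; rewrite (Rintegral_segment lg).
have cg := lipschitz_continuous lg.
apply: (le_trans (le_normr_Rintegral _ (continuous_integrable _ _ cg))) => //.
apply: (@le_trans _ _ (Rintegral mu `[- B, B] (fun _ => C))).
  apply: le_Rintegral => //.
  - apply: (@continuous_integrable _ _ (fun t => `|g t|)) => t.
    by apply: continuous_comp (cg t) _; exact: norm_continuous.
  - by apply: continuous_integrable => t; exact: cst_continuous.
rewrite Rintegral_cst // mulrC /= lebesgue_measure_itv /= lte_fin.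
have [|] := ltP (- B) B; last first.
  move=> BB /=; rewrite mul0r mulr_ge0 ?mulr_ge0 //.
  exact: le_trans (gC 0).
by move=> _; rewrite -EFinB /= opprK (mulr_natl B) mulr2n.
Qed.

(** The function is at least half its value at t0 on a whole segment around t0. *)
Lemma Rintegral_gt0 B (g : R -> R) t0 : lipschitz_supported1 B g ->
  (forall t, 0 <= g t) -> 0 < g t0 -> 0 < Rintegral mu setT g.
Proof.
move=> lg g0 gt0.
have lgL : lipschitz_supported1 (`|B| + `|t0| + 1) g.
  case: lg => gM gB; split=> // t /gB tB.
  by rewrite (le_trans tB) // -addrA (le_trans (ler_norm B)) // lerDl addr_ge0.
have cg := lipschitz_continuous lg.
have /cvgrPdist_lt /(_ _ (divr_gt0 gt0 (ltr0Sn R 1))) /nbhs_ballP[e /= e0 ge] := cg t0.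
(* The radius is also at most 1, so that the segment lies in the one to which the
   support has been enlarged. *)
pose d := Num.min e 1 / 2.
have m0 : 0 < Num.min e 1 by rewrite lt_min e0 ltr01.
have d0 : 0 < d by rewrite divr_gt0.
have me : Num.min e 1 <= e by rewrite ge_min lexx.
have m1 : Num.min e 1 <= 1 by rewrite ge_min lexx orbT.
have de : d < e by rewrite (lt_le_trans _ me) // ltr_pdivrMr // mulr2n mulrDr mulr1 ltrDl.
have d1 : d <= 1.
  by rewrite ler_pdivrMr // mul1r (le_trans m1) // ler1n.
rewrite (Rintegral_segment lgL) /Rintegral; set L := _ + 1.
have iL := continuous_integrable (- L) L cg.
pose I : set R := `[t0 - d, t0 + d]%classic.
apply: (@lt_le_trans _ _ (fine (\int[mu]_(x in I) (g t0 / 2)%:E)%E)).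
  rewrite integral_cst /I //= lebesgue_measure_itv /= lte_fin.
  have -> : (t0 - d < t0 + d)%R by rewrite ltrD2l gtrN.
  rewrite -EFinB -EFinM /= mulr_gt0 ?divr_gt0 //.
  by rewrite opprB addrCA [t0 + d]addrC addrK addr_gt0.
apply: fine_le.
- apply: integrable_fin_num => //; first exact: measurable_itv.
  apply: (@continuous_integrable (t0 - d) (t0 + d) (fun=> g t0 / 2)) => t.
  exact: cst_continuous.
- exact: integrable_fin_num.
apply: (@le_trans _ _ (\int[mu]_(x in I) (g x)%:E)%E).
  apply: ge0_le_integral.
  - exact: measurable_itv.
  - by move=> t _; rewrite lee_fin divr_ge0 // ltW.
  - exact: measurable_cst.
  - by case/integrableP: (continuous_integrable (t0 - d) (t0 + d) cg).
  - move=> t; rewrite /I /= in_itv /= lee_fin => tI.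
    have bt : ball t0 e t.
      rewrite -ball_normE /ball_ /= distrC (le_lt_trans _ de) // ler_distl.
      by rewrite tI.
    have := ge _ bt => /= /(le_lt_trans (ler_norm _)) /ltW.
    by rewrite lerBlDr -lerBlDl {1}[g t0]splitr addrK.
apply: ge0_subset_integral.
- exact: measurable_itv.
- exact: measurable_itv.
- by case/integrableP: iL.
- by move=> t _; rewrite lee_fin.
- move=> t; rewrite /I /= !in_itv /= -ler_norml => /andP[t1 t2].
  have : `|t - t0| <= d by rewrite ler_distl t1 t2.
  move=> td; rewrite -[t](subrK t0) (le_trans (ler_normD _ _)) // addrC /L.
  by rewrite lerD ?(le_trans td) // lerDr.
Qed.

(** A quadratic bound on the remainder of the first order expansion passes to
    integrals over further variables, which a mere limit does not do directly. *)
Lemma is_derive_quadratic (g : R -> R) (t a K : R) :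
  (forall h, `|g (t + h) - g t - h * a| <= K * h ^+ 2) -> is_derive t (1 : R) g a.
Proof.
move=> gK.
have cv : (h^-1 *: ((g \o shift t) (h *: (1 : R)) - g t)) @[h --> 0^'] --> a.
  apply/cvgrPdist_lt => e e0; near=> h.
  have hn : h != 0 by near: h; exact: nbhs_dnbhs_neq.
  have hn0 : 0 < `|h| by rewrite normr_gt0.
  have -> : a - h^-1 *: ((g \o shift t) (h *: (1 : R)) - g t)
     = - (h^-1 * (g (t + h) - g t - h * a)).
    rewrite /= /GRing.scale /= mulr1 [h + t]addrC [in RHS]mulrBr mulKf //.
    by rewrite opprB.
  rewrite normrN normrM normfV -ltr_pdivlMl ?invr_gt0 // invrK.
  apply: (le_lt_trans (gK h)); rewrite -[h ^+ 2]real_normK ?num_real // expr2.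
  rewrite mulrA [K * _]mulrC -mulrA ltr_pM2l //.
  apply: (@le_lt_trans _ _ ((`|K| + 1) * `|h|)).
    by rewrite ler_wpM2r // (le_trans (ler_norm K)) // lerDl.
  rewrite mulrC -ltr_pdivlMr ?ltr_wpDl //.
  by near: h; apply: dnbhs0_lt; rewrite divr_gt0 // ltr_wpDl.
apply: DeriveDef; last exact: cvg_lim cv.
by apply/cvg_ex; exists a.
Unshelve. all: by end_near.
Qed.

(** The fundamental theorem of calculus on a segment at whose ends g vanishes. *)
Lemma Rintegral_derivative B (g g' : R -> R) K : lipschitz_supported1 B g ->
  lipschitz_supported1 B g' ->
  (forall t h, `|g (t + h) - g t - h * g' t| <= K * h ^+ 2) ->
  Rintegral mu setT g' = 0.
Proof.
move=> lg lg' gK.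
(* At the ends of the segment from - L to L the function vanishes, also if B is
   negative. *)
pose L := `|B| + 1.
have lgL : lipschitz_supported1 L g'.
  case: lg' => gM gB; split=> // t /gB tB.
  by rewrite (le_trans tB) // (le_trans (ler_norm B)) // lerDl.
have L0 : 0 < L by rewrite ltr_wpDl.
have BL : B < L by rewrite (le_lt_trans (ler_norm B)) // ltrDl.
have vanish t : L <= `|t| -> g t = 0.
  move=> Lt; apply/eqP/contraT => /(lg.2); rewrite leNgt => /negP; case.
  exact: lt_le_trans Lt.
have D (t : R) : is_derive t (1 : R) g (g' t) by apply: is_derive_quadratic.
rewrite (Rintegral_segment lgL) /Rintegral.
have cg := lipschitz_continuous lg; have cg' := lipschitz_continuous lg'.
rewrite (@continuous_FTC2 _ g' g).
- rewrite !vanish ?normrN ?subee //; exact: ler_norm.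
- by rewrite gtrN.
- exact: continuous_subspaceT.
- split; first by move=> t _; have [] := D t.
  + by apply: cvg_at_right_filter; exact: cg.
  + by apply: cvg_at_left_filter; exact: cg.
- by move=> t _; rewrite derive1E; have [_] := D t.
Qed.

End OneVariable.

Section RowNorm.
Variables (R : realType).

Lemma rV_norm_entry n (x : 'rV[R]_n) i : `|x 0 i| <= `|x|.
Proof.
rewrite [leRHS]/Num.Def.normr/= mx_normrE.
by apply: le_trans (le_bigmax _ _ (0, i)).
Qed.

Lemma rV_norm_le n (x : 'rV[R]_n) c : 0 <= c -> (forall i, `|x 0 i| <= c) -> `|x| <= c.
Proof.
move=> c0 xc; rewrite /Num.Def.normr/= mx_normrE (bigmax_le _ c0)//= => -[i j] _ /=.
by rewrite (ord1 i).
Qed.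

Lemma norm_row_mx n (t : R) (y : 'rV[R]_n) :
  `|row_mx (t%:M : 'M[R]_1) y : 'rV[R]_(1 + n)| <= `|t| + `|y|.
Proof.
apply: rV_norm_le => [|i]; first exact: addr_ge0.
case: (split_ordP i) => j ->; rewrite ?row_mxEl ?row_mxEr.
  by rewrite (ord1 j) mxE eqxx mulr1n lerDl.
by rewrite (le_trans (rV_norm_entry y j)) // lerDr.
Qed.

Lemma row_mxB n (t s : R) (y z : 'rV[R]_n) :
  row_mx (t%:M : 'M[R]_1) y - row_mx (s%:M : 'M[R]_1) z = row_mx ((t - s)%:M : 'M[R]_1) (y - z).
Proof. by rewrite opp_row_mx add_row_mx raddfB. Qed.

Lemma row_mx_step_r n (t h : R) (y : 'rV[R]_n) i :
  row_mx (t%:M : 'M[R]_1) (y + h *: delta_mx 0 i)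
  = row_mx (t%:M : 'M[R]_1) y + h *: delta_mx 0 (rshift 1 i).
Proof.
apply/rowP => k; rewrite [RHS]mxE.
case: (split_ordP k) => k' ->; rewrite ?row_mxEl ?row_mxEr !mxE /=.
  by rewrite eq_lrshift mulr0 addr0.
by rewrite eq_rshift.
Qed.

Lemma row_mx_step_l n (t h : R) (y : 'rV[R]_n) i :
  row_mx ((t + h)%:M : 'M[R]_1) y
  = row_mx (t%:M : 'M[R]_1) y + h *: delta_mx 0 (lshift n i).
Proof.
apply/rowP => k; rewrite [RHS]mxE.
case: (split_ordP k) => k' ->; rewrite ?row_mxEl ?row_mxEr !mxE /=.
  by rewrite (ord1 k') (ord1 i) !eqxx mulr1n mulr1.
by rewrite eq_rlshift mulr0 addr0.
Qed.

End RowNorm.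

Section IteratedIntegral.
Variable R : realType.
Local Notation slice t := (fun y => row_mx (t%:M : 'M[R]_1) y).

Definition lipschitz_supported n (B : R) (F : 'rV[R]_n -> R) : Prop :=
  (exists M : R, forall x y, `|F x - F y| <= M * `|x - y|) /\
  (forall x, F x != 0 -> forall i, `|x 0 i| <= B).

Lemma lipD n (B : R) (F G : 'rV[R]_n -> R) :
  lipschitz_supported B F -> lipschitz_supported B G ->
  lipschitz_supported B (fun x => F x + G x).
Proof.
move=> [[M FM] FB] [[N GN] GB]; split.
  exists (M + N) => x y; rewrite opprD addrACA mulrDl.
  by apply: (le_trans (ler_normD _ _)); apply: lerD.
move=> x; have [->|/FB //] := eqVneq (F x) 0.
by rewrite add0r => /GB.
Qed.

Lemma lipZ n (B c : R) (F : 'rV[R]_n -> R) :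
  lipschitz_supported B F -> lipschitz_supported B (fun x => c * F x).
Proof.
move=> [[M FM] FB]; split.
  by exists (`|c| * M) => x y; rewrite -mulrBr normrM -mulrA ler_wpM2l.
by move=> x; rewrite mulf_eq0 negb_or => /andP[_ /FB].
Qed.

Lemma lip_slice n (B : R) (F : 'rV[R]_n.+1 -> R) t :
  lipschitz_supported B F -> lipschitz_supported B (fun y => F (slice t y)).
Proof.
move=> [[M FM] FB]; split.
  exists `|M| => x y; apply: (le_trans (FM _ _)).
  apply: (@le_trans _ _ (`|M| * `|slice t x - slice t y|)).
    by rewrite ler_wpM2r // ler_norm.
  rewrite ler_wpM2l // row_mxB subrr.
  by apply: (le_trans (norm_row_mx _ _)); rewrite normr0 add0r.
move=> y /FB h i; rewrite -(row_mxEr (t%:M : 'M[R]_1) y 0 i).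
exact: (h (rshift 1 i)).
Qed.

(** The three properties needed of the inner integral to show that the outer one is
    over a Lipschitz function; they are therefore proved together, by induction on
    the dimension. *)
Definition additive_bounded n := forall B : R, 0 <= B ->
  [/\ forall F G : 'rV[R]_n -> R, lipschitz_supported B F -> lipschitz_supported B G ->
        integral_rV (fun x => F x + G x) = integral_rV F + integral_rV G,
      forall (c : R) (F : 'rV[R]_n -> R), lipschitz_supported B F ->
        integral_rV (fun x => c * F x) = c * integral_rV F &
      forall (C : R) (F : 'rV[R]_n -> R), lipschitz_supported B F ->
        (forall x, `|F x| <= C) -> `|integral_rV F| <= (2 * B) ^+ n * C].

Lemma integral_rVS n (F : 'rV[R]_n.+1 -> R) :
  integral_rV F = Rintegral (@lebesgue_measure R) setT
    (fun t => integral_rV (fun y => F (slice t y))).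
Proof. by []. Qed.

(** The difference of two slices is bounded by the distance of the slices, and the
    integral is linear and bounded on such functions. *)
Lemma lip_outer n (B : R) (F : 'rV[R]_n.+1 -> R) : additive_bounded n -> 0 <= B ->
  lipschitz_supported B F ->
  lipschitz_supported1 B (fun t => integral_rV (fun y => F (slice t y))).
Proof.
move=> /(_ B) ab B0 lF; have {ab}[addI scaleI boundI] := ab B0.
have lS t := lip_slice t lF; case: (lF) => -[M FM] FB; split.
  exists ((2 * B) ^+ n * `|M|) => s t.
  have -> : integral_rV (fun y => F (slice s y)) - integral_rV (fun y => F (slice t y)) =
    integral_rV (fun y => F (slice s y) + -1 * F (slice t y)).
    by rewrite addI ?scaleI ?mulN1r //; exact: lipZ.
  rewrite -mulrA; apply: boundI; first by apply: lipD => //; exact: lipZ.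
  move=> y; rewrite mulN1r; apply: (le_trans (FM _ _)).
  apply: (@le_trans _ _ (`|M| * `|slice s y - slice t y|)).
    by rewrite ler_wpM2r // ler_norm.
  rewrite ler_wpM2l // row_mxB subrr.
  by apply: (le_trans (norm_row_mx _ _)); rewrite normr0 addr0.
move=> t; apply: contraNT; rewrite -ltNge => Bt.
have z y : F (slice t y) = 0.
  apply/eqP/contraT => /FB /(_ (lshift n (0 : 'I_1))) h.
  have e : row_mx (t%:M : 'M[R]_1) y 0 (lshift n (0 : 'I_1)) = t.
    by rewrite row_mxEl mxE eqxx mulr1n.
  by move: Bt; rewrite -e ltNge => /negP; case.
have -> : (fun y => F (slice t y)) = (fun y => 0 * F (slice t y)).
  by apply/funext => y; rewrite mul0r z.
by rewrite scaleI // mul0r.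
Qed.

Lemma Rintegral_lipZ (B : R) (g : R -> R) (lg : lipschitz_supported1 B g) (c : R) :
  Rintegral (@lebesgue_measure R) setT (fun t => c * g t) =
  c * Rintegral (@lebesgue_measure R) setT g.
Proof.
have lc : lipschitz_supported1 B (fun t => c * g t).
  case: lg => -[M gM] gB; split.
    by exists (`|c| * M) => x y; rewrite -mulrBr normrM -mulrA ler_wpM2l.
  by move=> x; rewrite mulf_eq0 negb_or => /andP[_ /gB].
rewrite (Rintegral_segment lc) (Rintegral_segment lg) RintegralZl //.
exact: continuous_integrable (lipschitz_continuous lg).
Qed.

Lemma Rintegral_lipD (B : R) (g h : R -> R) : lipschitz_supported1 B g -> lipschitz_supported1 B h ->
  Rintegral (@lebesgue_measure R) setT (fun t => g t + h t) =
  Rintegral (@lebesgue_measure R) setT g + Rintegral (@lebesgue_measure R) setT h.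
Proof.
move=> lg lh.
have ls : lipschitz_supported1 B (fun t => g t + h t).
  case: (lg) (lh) => -[M gM] gB [[N hN] hB]; split.
    exists (M + N) => x y; rewrite opprD addrACA mulrDl.
    by apply: (le_trans (ler_normD _ _)); apply: lerD.
  by move=> x; have [->|/gB //] := eqVneq (g x) 0; rewrite add0r => /hB.
rewrite (Rintegral_segment lg) (Rintegral_segment lh) (Rintegral_segment ls) RintegralD //;
  [exact: continuous_integrable (lipschitz_continuous lg)|exact: continuous_integrable (lipschitz_continuous lh)].
Qed.

Lemma integral_rV_additive_bounded n : additive_bounded n.
Proof.
elim: n => [|n IH] B B0.
  by split=> [F G _ _|c F _|C F _ FC] //; rewrite expr0 mul1r; exact: FC.
have [addI scaleI boundI] := IH B B0.
have lO F := @lip_outer n B F IH B0.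
split=> [F G lF lG|c F lF|C F lF FC]; rewrite !integral_rVS.
- rewrite -(Rintegral_lipD (lO _ lF) (lO _ lG)); congr Rintegral; apply/funext => t.
  by rewrite addI //; exact: lip_slice.
- rewrite -(Rintegral_lipZ (lO _ lF)); congr Rintegral; apply/funext => t.
  by rewrite scaleI //; exact: lip_slice.
- rewrite exprS -mulrA; apply: (Rintegral_bound B0 (lO _ lF)) => t.
  by apply: boundI => //; exact: lip_slice.
Qed.

Lemma integral_rVD n (B : R) (F G : 'rV[R]_n -> R) : 0 <= B ->
  lipschitz_supported B F -> lipschitz_supported B G ->
  integral_rV (fun x => F x + G x) = integral_rV F + integral_rV G.
Proof. by move=> B0; have [+ _ _] := integral_rV_additive_bounded n B0; apply. Qed.

Lemma integral_rVZ n (B c : R) (F : 'rV[R]_n -> R) : 0 <= B -> lipschitz_supported B F ->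
  integral_rV (fun x => c * F x) = c * integral_rV F.
Proof. by move=> B0; have [_ + _] := integral_rV_additive_bounded n B0; apply. Qed.

Lemma integral_rV_bound n (B C : R) (F : 'rV[R]_n -> R) : 0 <= B -> lipschitz_supported B F ->
  (forall x, `|F x| <= C) -> `|integral_rV F| <= (2 * B) ^+ n * C.
Proof. by move=> B0; have [_ _ +] := integral_rV_additive_bounded n B0; apply. Qed.

Lemma integral_rV0 n : integral_rV (fun _ : 'rV[R]_n => 0) = 0.
Proof.
have l0 : lipschitz_supported 0 (fun _ : 'rV[R]_n => 0).
  by split=> [|x]; rewrite ?eqxx //; exists 0 => x y; rewrite subrr normr0 mul0r.
by rewrite -[RHS](mul0r (integral_rV (fun _ : 'rV[R]_n => 0))) -(integral_rVZ _ (lexx 0) l0) mul0r.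
Qed.

Lemma integral_rV_ge0 n (F : 'rV[R]_n -> R) : (forall x, 0 <= F x) -> 0 <= integral_rV F.
Proof.
elim: n F => [|n IH] F F0; first exact: F0.
by rewrite integral_rVS; apply: Rintegral_ge0 => t _; exact: IH.
Qed.

Lemma integral_rV_gt0 n (B : R) (F : 'rV[R]_n -> R) x0 : 0 <= B -> lipschitz_supported B F ->
  (forall x, 0 <= F x) -> 0 < F x0 -> 0 < integral_rV F.
Proof.
move=> B0; elim: n F x0 => [|n IH] F x0 lF F0 Fx0.
  by move: Fx0; rewrite (_ : x0 = 0) //; apply/rowP => -[].
rewrite integral_rVS.
have lo := lip_outer (@integral_rV_additive_bounded n) B0 lF.
apply: (@Rintegral_gt0 _ _ _ ((x0 : 'rV[R]_(1 + n)) 0 0) lo) => [t|].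
  exact: integral_rV_ge0.
apply: (IH _ (rsubmx (x0 : 'rV[R]_(1 + n))) (lip_slice _ lF)) => //.
rewrite (_ : slice _ _ = x0) // -[RHS](hsubmxK (x0 : 'rV[R]_(1 + n))); congr row_mx.
by apply/rowP => i; rewrite (ord1 i) !mxE eqxx mulr1n; congr (_ _ _); apply/val_inj.
Qed.

(** For an inner variable this is the induction hypothesis on each slice.  For the
    outer variable the quadratic bound on the remainder integrates to one for the
    integral over the slice, which is thus differentiable with the integral of F' as
    its derivative. *)
Lemma integral_rV_derivative n (B K : R) (F F' : 'rV[R]_n -> R) (j : 'I_n) : 0 <= B ->
  lipschitz_supported B F -> lipschitz_supported B F' ->
  (forall x h, `|F (x + h *: delta_mx 0 j) - F x - h * F' x| <= K * h ^+ 2) ->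
  integral_rV F' = 0.
Proof.
move=> B0; elim: n F F' j => [F F' []|n IH F F' j] // lF lF' FK.
rewrite integral_rVS.
case: (split_ordP (j : 'I_(1 + n))) => i ji; last first.
  rewrite [X in Rintegral _ _ X](_ : _ = fun t => 0 * 0); last first.
    apply/funext => t; rewrite mul0r.
    apply: (IH (fun y => F (slice t y)) _ i) => [||y h]; try exact: lip_slice.
    by have := FK (slice t y) h; rewrite ji -row_mx_step_r.
  rewrite (_ : (fun _ => _) = (fun t => 0 * (fun t => 0) t)) //.
  rewrite (@Rintegral_lipZ 0 (fun _ => 0)) ?mul0r //.
  by split=> [|x]; rewrite ?eqxx //; exists 0 => x y; rewrite subrr normr0 mul0r.
have ab := @integral_rV_additive_bounded n.
apply: (Rintegral_derivative (K := (2 * B) ^+ n * K) (lip_outer ab B0 lF) (lip_outer ab B0 lF')).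
move=> t h; have lS s := lip_slice s lF; have lS' := lip_slice t lF'.
have -> : integral_rV (fun y => F (slice (t + h) y)) - integral_rV (fun y => F (slice t y))
   - h * integral_rV (fun y => F' (slice t y)) =
   integral_rV (fun y => F (slice (t + h) y) + -1 * F (slice t y) + - h * F' (slice t y)).
  rewrite (integral_rVD B0) ?(integral_rVD B0) ?(integral_rVZ _ B0) //;
    try exact: lipZ; last by apply: lipD => //; exact: lipZ.
  by rewrite mulN1r mulNr.
rewrite -mulrA; apply: (integral_rV_bound B0).
  by apply: lipD; [apply: lipD => //|]; exact: lipZ.
move=> y; rewrite mulN1r mulNr; have := FK (slice t y) h.
by rewrite ji -row_mx_step_l.
Qed.

End IteratedIntegral.

(** * Test functions and integration by parts *)

Section TestFunctions.
Variables (R : realType) (n : nat).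
Implicit Types (K U : set 'rV[R]_n) (F : 'rV[R]_n -> R).

Definition smooth_supported K F : Prop :=
  [/\ smooth setT F, compact K & forall x, ~ K x -> F x = 0].

Lemma smooth_supported_derive K F w :
  smooth_supported K F -> smooth_supported K ('D_w F).
Proof.
move=> [sF cK FK]; split=> //; first exact: smooth_derive.
move=> x Kx; have oK : open (~` K).
  by rewrite openC; apply: compact_closed cK; exact: norm_hausdorff.
by rewrite (derive_near _ oK Kx FK) derive_cst.
Qed.

Lemma smooth_supported_bounded K F : smooth_supported K F ->
  exists C : R, forall x, `|F x| <= C.
Proof.
move=> [sF cK FK].
have cF : {within K, continuous (fun x => `|F x| : R)}.
  apply: continuous_subspaceT => x; apply: continuous_comp; last exact: norm_continuous.
  exact: smooth_continuous sF _.
have [[x0 Kx0]|K0] := pselect (K !=set0); last first.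
  by exists 0 => x; rewrite FK ?normr0 // => Kx; apply: K0; exists x.
have [c Kc FC] : exists2 c, K c & forall t, K t -> `|F t| <= `|F c|.
  have [c ] := @EVT_max_rV R n _ K (ex_intro _ x0 Kx0) cK cF.
  rewrite inE => Kc h; exists c => // t Kt; apply: h; rewrite inE; exact: Kt.
exists `|F c| => x; have [/FC //|/FK ->] := pselect (K x).
by rewrite normr0.
Qed.

Lemma mvt_points F x y : smooth setT F ->
  exists z, F y - F x = 'D_(y - x) F z.
Proof.
move=> sF; have [s _|s _ E] := @mvt_line R _ F x (y - x) 1 ler01.
  exact: smooth_differentiable sF _.
exists (x + s *: (y - x)).
by move: E; rewrite scale1r mul1r [x + (y - x)]addrC subrK.
Qed.

(** The partial derivatives are bounded, as continuous functions that vanish off a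
    compact set. *)
Lemma smooth_supported_lipschitz K F : smooth_supported K F ->
  exists2 M : R, 0 <= M & forall x y, `|F x - F y| <= M * `|x - y|.
Proof.
move=> sF; have bd i := smooth_supported_bounded (smooth_supported_derive (delta_mx 0 i) sF).
pose C i := sval (cid (bd i)).
have CF i x : `|'D_(delta_mx 0 i) F x| <= C i by rewrite /C; case: cid.
exists (\sum_i C i) => [|x y].
  by apply: sumr_ge0 => i _; exact: le_trans (CF i 0).
case: (sF) => s1 _ _; have [z ->] := mvt_points y x s1.
rewrite derive_delta; last exact: smooth_differentiable s1 _.
rewrite mulr_suml (le_trans (ler_norm_sum _ _ _)) //; apply: ler_sum => i _.
by rewrite normrZ mulrC ler_pM // rV_norm_entry.
Qed.

Lemma smooth_supported_box K : compact K ->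
  exists2 B : R, 0 <= B & forall x : 'rV[R]_n, K x -> forall i, `|x 0 i| <= B.
Proof.
move=> /compact_bounded [M [Mr MK]]; exists (`|M| + 1); first exact: addr_ge0.
move=> x Kx i; apply: (le_trans (rV_norm_entry x i)); apply: (MK _ _ x Kx).
by rewrite (le_lt_trans (ler_norm M)) // ltrDl.
Qed.

Lemma integral_rV_partial K F j : smooth_supported K F ->
  integral_rV ('D_(delta_mx 0 j) F) = 0.
Proof.
move=> sF; have sF' := smooth_supported_derive (delta_mx 0 j) sF.
case: (sF) => s1 cK FK; have [B B0 KB] := smooth_supported_box cK.
have lip G : smooth_supported K G -> lipschitz_supported B G.
  move=> sG; have [M _ GM] := smooth_supported_lipschitz sG.
  split; first by exists M.
  move=> x Gx i; apply: KB; case: sG => _ _ GK; apply: contrapT => /GK Gx0.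
  by rewrite Gx0 eqxx in Gx.
have [M M0 FM] := smooth_supported_lipschitz sF'.
apply: (integral_rV_derivative (K := M) (j := j) B0 (lip _ sF) (lip _ sF')) => x h.
have [s _|s /andP[s0 s1'] E] := @mvt_line R _ F x (h *: delta_mx 0 j) 1 ler01.
  exact: smooth_differentiable s1 _.
have Eh z : 'D_(h *: delta_mx 0 j) F z = h * 'D_(delta_mx 0 j) F z.
  by apply: derive_linZ; exact: smooth_differentiable s1 _.
move: E; rewrite scale1r mul1r Eh => ->; rewrite -mulrBr normrM.
apply: (@le_trans _ _ (`|h| * (M * `|h|))); last first.
  by rewrite mulrCA -normrM -expr2 ger0_norm ?sqr_ge0.
rewrite ler_wpM2l //; apply: (le_trans (FM _ _)); rewrite ler_wpM2l //.
rewrite addrC addKr; apply: rV_norm_le => // i; rewrite !mxE eqxx /= normrM ger0_norm //.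
have : `|h * (i == j)%:R| <= `|h|.
  by case: eqP; rewrite ?mulr1 ?mulr0 ?normr0.
by apply: le_trans; apply: ler_piMl.
Qed.

End TestFunctions.

Section FlatFunction.
Variable R : realType.

(** The functions exp (- 1 / s) / s^k, extended by zero to the left of the origin:
    the family is closed under differentiation up to linear combinations, which is
    what the induction for smoothness needs. *)
Definition flat_exp (k : nat) (s : R) : R :=
  if 0 < s then s^-1 ^+ k * expR (- s^-1) else 0.

Lemma flat_exp_le0 k s : s <= 0 -> flat_exp k s = 0.
Proof. by rewrite /flat_exp leNgt => /negbTE ->. Qed.

Lemma flat_exp_gt0 s : 0 < s -> 0 < flat_exp 0 s.
Proof. by rewrite /flat_exp => s0; rewrite s0 expr0 mul1r expR_gt0. Qed.

Lemma flat_exp_ge0 k s : 0 <= flat_exp k s.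
Proof.
rewrite /flat_exp; case: ifP => // s0.
by rewrite mulr_ge0 ?expR_ge0 // exprn_ge0 // invr_ge0 ltW.
Qed.

(** The exponential of 1 / s dominates the term of degree k + 2 of its series.  This
    bound gives the differentiability at the origin. *)
Lemma flat_exp_quadratic k s : flat_exp k s <= (k.+2)`!%:R * s ^+ 2.
Proof.
rewrite /flat_exp; case: ifP => s0; last by rewrite mulr_ge0 ?ler0n // sqr_ge0.
have i0 : 0 < s^-1 by rewrite invr_gt0.
have h : s^-1 ^+ k.+2 / (k.+2)`!%:R <= expR s^-1.
  by apply: le_trans (expR_ge1Dxn k.+1 (ltW i0)); rewrite lerDr.
have f0 : 0 < (k.+2)`!%:R :> R by rewrite ltr0n fact_gt0.
rewrite expRN ler_pdivrMr ?expR_gt0 //.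
move: h; rewrite ler_pdivrMr // => h.
rewrite -(ler_pM2r (exprn_gt0 2 i0)) -exprD addn2 (le_trans h) //.
by rewrite -mulrA [_ * s^-1 ^+ 2]mulrC mulrA -[_ * s ^+ 2 * _]mulrA -exprMn mulfV ?gt_eqF // expr1n mulr1 mulrC.
Qed.

Lemma is_derive_flat_exp k (s : R) :
  is_derive s (1 : R) (flat_exp k) (flat_exp k.+2 s - k%:R * flat_exp k.+1 s).
Proof.
have [s0|s0|->] := ltgtP s 0.
- rewrite !flat_exp_le0 ?ltW // mulr0 subr0.
  apply: near_eq_is_derive (is_derive_cst 0 s 1).
  near=> t; rewrite flat_exp_le0 //; apply: ltW.
  by near: t; apply: lt_nbhsl.
- have sn : s != 0 by rewrite gt_eqF.
  have dV : is_derive s (1 : R) (fun t : R => t^-1) (- s ^- 2).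
    have := @is_deriveV R id s 1 1 sn (is_derive_id _ _).
    by rewrite /GRing.scale /= mulr1.
  have dE : is_derive s (1 : R) (fun t : R => expR (- t^-1)) (expR (- s^-1) * s ^- 2).
    rewrite -[s ^- 2]opprK; exact: is_derive1_comp.
  have dP : is_derive s (1 : R) (fun t : R => t^-1 ^+ k) (k%:R * s^-1 ^+ k.-1 * (- s ^- 2)).
    by have := is_deriveX k dV; rewrite exprfctE.
  have dM := is_deriveM dP dE.
  rewrite [X in is_derive _ _ _ X](_ : _ = s^-1 ^+ k *: (expR (- s^-1) * s ^- 2) +
      expR (- s^-1) *: (k%:R * s^-1 ^+ k.-1 * (- s ^- 2))); last first.
    rewrite /flat_exp s0 /GRing.scale /= -exprVn.
    move: (s^-1) (expR _) => y E; case: k {dP dM} => [|k] /=; first by ring.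
    by rewrite !exprS; ring.
  apply: near_eq_is_derive dM; near=> t.
  rewrite /flat_exp; have -> // : 0 < t.
  by near: t; apply: lt_nbhsr.
- rewrite !flat_exp_le0 // mulr0 subr0.
  apply: (@is_derive_quadratic _ _ _ _ ((k.+2)`!%:R)) => h.
  rewrite add0r mulr0 subr0 [flat_exp k 0]flat_exp_le0 // subr0 ger0_norm ?flat_exp_ge0 //.
  exact: flat_exp_quadratic.
Unshelve. all: by end_near.
Qed.

Lemma smooth_flat_exp : smooth setT (flat_exp 0).
Proof.
apply/smoothP => m; move: 0%N; elim: m => // m IH k.
have df s : differentiable (flat_exp k) s.
  by apply/derivable1_diffP; have [] := is_derive_flat_exp k s.
split=> [s _|w]; first exact: df.
have sD := smooth_uptoM openT (smooth_upto_cst openT m (w : R)) (smooth_uptoD openT (IH k.+2)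
   (smooth_uptoM openT (smooth_upto_cst openT m (- k%:R : R)) (IH k.+1))).
apply: (smooth_upto_ext openT _ sD) => s _.
rewrite (derive_scalar w (df s)); congr (_ * _).
by have [_ ->] := is_derive_flat_exp k s; rewrite mulNr.
Qed.

End FlatFunction.

Section Bump.
Variables (R : realType) (n : nat).

(** A product over the coordinates, positive exactly on the open box of radius e
    around a. *)
Definition bump_fun (a : 'rV[R]_n) (e : R) (x : 'rV[R]_n) : R :=
  \prod_i flat_exp 0 (e ^+ 2 - (x 0 i - a 0 i) ^+ 2).

Lemma bump_ge0 a e x : 0 <= bump_fun a e x.
Proof. by apply: prodr_ge0 => i _; exact: flat_exp_ge0. Qed.

Lemma bump_center a e : 0 < e -> 0 < bump_fun a e a.
Proof.
move=> e0; apply: prodr_gt0 => i _.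
by rewrite subrr expr0n subr0; apply: flat_exp_gt0; exact: exprn_gt0.
Qed.

Lemma smooth_bump a e : smooth setT (bump_fun a e).
Proof.
apply: (smooth_prod openT) => i.
apply: (smooth_comp_scalar openT openT _ _ (@smooth_flat_exp R)) => //.
have sx : smooth setT (fun x : 'rV[R]_n => x 0 i - a 0 i).
  by apply: (smoothB openT); [exact: smooth_coord openT i|apply: smooth_cst; exact: openT].
apply: (smoothB openT); first by apply: smooth_cst; exact: openT.
under eq_fun do rewrite expr2; exact: (smoothM openT).
Qed.

Lemma bump_support (U : set 'rV[R]_n) a : open U -> U a -> exists e K,
  [/\ 0 < e, K `<=` U & smooth_supported K (bump_fun a e)].
Proof.
move=> oU Ua; have /nbhs_ballP[d /= d0 dU] : nbhs a U by exact: open_nbhs_nbhs.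
pose e := d / 2; have e0 : 0 < e by rewrite divr_gt0.
(* The closed ball of the supremum norm of radius e, half that of a ball inside U.
   *)
exists e, [set x | forall i, `[a 0 i - e, a 0 i + e]%classic (x 0 i)]; split=> //.
- move=> x xK; apply: dU; rewrite -ball_normE /ball_ /=.
  apply: (@le_lt_trans _ _ e); last by rewrite ltr_pdivrMr // mulr_natr mulr2n ltrDl.
  apply: rV_norm_le => [|i]; first exact: ltW.
  by have := xK i; rewrite !mxE /= in_itv /= distrC ler_distl.
- split; first exact: smooth_bump.
    have cI i : compact (`[a 0 i - e, a 0 i + e]%classic : set R) by exact: segment_compact.
    exact: rV_compact cI.
  move=> x /existsNP[i xi]; rewrite /bump_fun (bigD1 i) //= flat_exp_le0 ?mul0r //.
  rewrite subr_le0 -[(x 0 i - _) ^+ 2]real_normK ?num_real // lerXn2r ?nnegrE ?(ltW e0) //.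
  by apply: ltW; rewrite ltNge; apply/negP => h; apply: xi; rewrite /= in_itv /= -ler_distl.
Qed.

End Bump.

Section Fundamental.
Variables (R : realType) (n : nat) (U : set 'rV[R]_n).
Hypothesis oU : open U.
Implicit Types (K : set 'rV[R]_n) (f h : 'rV[R]_n -> R).

Lemma compact_open_compl K : compact K -> open (~` K).
Proof. by move=> cK; rewrite openC; apply: compact_closed cK; exact: norm_hausdorff. Qed.

(** The factor h is arbitrary outside U.  Smoothness is a condition at each point,
    and the space is the union of U, where both factors are smooth, and of the open
    complement of K, where the product is zero. *)
Lemma smooth_supported_mul K f h : K `<=` U -> smooth_supported K f -> smooth U h ->
  smooth_supported K (fun x => f x * h x).
Proof.
move=> KU [sf cK fK] sh; split=> // [s x _|x /fK ->]; last by rewrite mul0r.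
have [Ux|nUx] := pselect (U x).
  have sfU : smooth U f by move=> s' y _; exact: sf.
  exact: (smoothM oU sfU sh) s x Ux.
have nK : (~` K) x by move=> /KU.
have s0 : smooth (~` K) (fun x => f x * h x).
  apply: (smooth_ext (compact_open_compl cK) _ (smooth_cst (compact_open_compl cK) (0 : R))).
  by move=> y /fK ->; rewrite mul0r.
exact: s0.
Qed.

Lemma smooth_supported_lip K f : smooth_supported K f ->
  forall B, (forall x, K x -> forall i, `|x 0 i| <= B) -> lipschitz_supported B f.
Proof.
move=> sf B KB; have [M _ fM] := smooth_supported_lipschitz sf.
split; first by exists M.
move=> x fx i; apply: KB; case: sf => _ _ fK; apply: contrapT => /fK fx0.
by rewrite fx0 eqxx in fx.
Qed.

Lemma integral_rV_smoothD K f h : smooth_supported K f -> smooth_supported K h ->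
  integral_rV (fun x => f x + h x) = integral_rV f + integral_rV h.
Proof.
move=> sf sh; have [_ cK _] := sf; have [B B0 KB] := smooth_supported_box cK.
by apply: (integral_rVD B0); apply: smooth_supported_lip KB.
Qed.

Lemma integral_rV_smooth_sum K (I : finType) (f : I -> 'rV[R]_n -> R) : compact K ->
  (forall i, smooth_supported K (f i)) ->
  integral_rV (fun x => \sum_i f i x) = \sum_i integral_rV (f i).
Proof.
move=> cK sf; rewrite -[fun x => _](fct_sumE).
suff [] : smooth_supported K (\sum_i f i) /\
  integral_rV (\sum_i f i) = \sum_i integral_rV (f i) by [].
elim/big_rec2: _ => [|i x y _ [sy <-]].
  split; last exact: integral_rV0.
  by split=> //; exact: (smooth_cst openT (0 : R)).
split; last exact: integral_rV_smoothD.
case: (sf i) sy => s1 _ z1 [s2 _ z2]; split=> //; first exact: smoothD openT _ _ _ s1 s2.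
by move=> t Kt; rewrite -[LHS]/(f i t + y t) z1 // z2 // addr0.
Qed.

(** The sum of the two integrands is a partial derivative of the product, whose
    integral is zero. *)
Lemma integral_rV_by_parts K f h j : K `<=` U -> smooth_supported K f -> smooth U h ->
  integral_rV (fun x => 'D_(delta_mx 0 j) f x * h x) =
  - integral_rV (fun x => f x * 'D_(delta_mx 0 j) h x).
Proof.
move=> KU sf sh; have sfh := smooth_supported_mul KU sf sh.
have s1 := smooth_supported_mul KU (smooth_supported_derive (delta_mx 0 j) sf) sh.
have s2 := smooth_supported_mul KU sf (smooth_derive (delta_mx 0 j) sh).
apply/eqP; rewrite -addr_eq0 -(integral_rV_smoothD s1 s2); apply/eqP.
rewrite -[RHS](integral_rV_partial j sfh); congr integral_rV; apply/funext => x.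
have [Kx|nKx] := pselect (K x).
  rewrite derive_mul //; last exact: smooth_differentiable sh (KU _ Kx).
  by case: sf => + _ _; move=> /smooth_differentiable; apply.
have [_ _ z] := smooth_supported_derive (delta_mx 0 j) sfh.
rewrite z //; have [_ _ ->] := s1; last by [].
by have [_ _ ->] := s2; rewrite ?addr0.
Qed.

(** Testing against h times a bump function centered at x gives the integral of a
    nonnegative function that is positive at x if h x is not zero. *)
Lemma test_functions_separate h x : smooth U h ->
  (forall f, test_function U f -> integral_rV (fun y => f y * h y) = 0) ->
  U x -> h x = 0.
Proof.
move=> sh ih Ux; apply/eqP/contraT => hx.
have [e [K [e0 KU sb]]] := bump_support oU Ux.
have sbh := smooth_supported_mul KU sb sh.
have sbhh := smooth_supported_mul KU sbh sh.
have tbh : test_function U (fun y => bump_fun x e y * h y).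
  by case: sbh => s1 cK z; split=> //; exists K.
have [_ cK _] := sb; have [B B0 KB] := smooth_supported_box cK.
have := @integral_rV_gt0 R n B _ x B0 (smooth_supported_lip sbhh KB).
rewrite (ih _ tbh) ltxx => -> //.
- by move=> y; rewrite -mulrA mulr_ge0 ?bump_ge0 // -expr2 sqr_ge0.
- by rewrite -mulrA mulr_gt0 ?bump_center // -expr2 exprn_even_gt0.
Qed.

End Fundamental.

(** * Linear algebra of the tangent space *)

Section Gram.
Variable R : realType.

Definition dot m (u w : 'rV[R]_m) : R := (u *m w^T) 0 0.

Lemma dotE m (u w : 'rV[R]_m) : dot u w = \sum_i u 0 i * w 0 i.
Proof. by rewrite /dot mxE; apply: eq_bigr => i _; rewrite mxE. Qed.

Lemma dotC m (u w : 'rV[R]_m) : dot u w = dot w u.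
Proof. by rewrite !dotE; apply: eq_bigr => i _; rewrite mulrC. Qed.

Lemma dotDl m (u v w : 'rV[R]_m) : dot (u + v) w = dot u w + dot v w.
Proof. by rewrite /dot mulmxDl mxE. Qed.
Lemma dotZl m a (u w : 'rV[R]_m) : dot (a *: u) w = a * dot u w.
Proof. by rewrite /dot -scalemxAl mxE. Qed.
Lemma dotNl m (u w : 'rV[R]_m) : dot (- u) w = - dot u w.
Proof. by rewrite /dot mulNmx mxE. Qed.
Lemma dotBl m (u v w : 'rV[R]_m) : dot (u - v) w = dot u w - dot v w.
Proof. by rewrite dotDl dotNl. Qed.
Lemma dotDr m (u v w : 'rV[R]_m) : dot w (u + v) = dot w u + dot w v.
Proof. by rewrite dotC dotDl ![dot _ w]dotC. Qed.
Lemma dotZr m a (u w : 'rV[R]_m) : dot w (a *: u) = a * dot w u.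
Proof. by rewrite dotC dotZl dotC. Qed.
Lemma dot0l m (w : 'rV[R]_m) : dot 0 w = 0.
Proof. by rewrite /dot mul0mx mxE. Qed.
Lemma dot0r m (w : 'rV[R]_m) : dot w 0 = 0.
Proof. by rewrite dotC dot0l. Qed.
Lemma dot_suml m (I : finType) (u : I -> 'rV[R]_m) w :
  dot (\sum_i u i) w = \sum_i dot (u i) w.
Proof. by rewrite /dot mulmx_suml summxE. Qed.
Lemma dot_sumr m (I : finType) (u : I -> 'rV[R]_m) w :
  dot w (\sum_i u i) = \sum_i dot w (u i).
Proof. by rewrite dotC dot_suml; apply: eq_bigr => i _; rewrite dotC. Qed.
Lemma dot_mulmx m p (u : 'rV[R]_m) (A : 'M[R]_(m, p)) w : dot (u *m A) w = dot u (w *m A^T).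
Proof. by rewrite /dot trmx_mul trmxK mulmxA. Qed.

Lemma dot_eq0 m (u : 'rV[R]_m) : dot u u = 0 -> u = 0.
Proof.
rewrite dotE => /eqP; rewrite psumr_eq0 => [|i _]; last by rewrite -expr2 sqr_ge0.
move=> /allP h; apply/rowP => i; have := h i (mem_index_enum i).
by rewrite /= mulf_eq0 orbb mxE => /eqP.
Qed.

Lemma dot_nondeg m (u w : 'rV[R]_m) : (forall z, dot u z = dot w z) -> u = w.
Proof.
move=> h; apply/eqP; rewrite -subr_eq0; apply/eqP; apply: dot_eq0.
by rewrite dotBl h subrr.
Qed.

Lemma euclid_ip m q (u w : 'rV[R]_m) : ip (euclid (n := m)) q u w = dot u w.
Proof. by rewrite /ip /euclid mulmx1. Qed.

Variables (n k : nat) (J : 'M[R]_(n, n + k)).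
Hypothesis fJ : row_free J.
Local Notation G := (J *m J^T).
Local Notation L := (J^T *m invmx G).
Local Notation Pi := (J^T *m invmx G *m J).

(** A vector of the kernel of J J^T has a push forward of length zero. *)
Lemma gram_unit : G \in unitmx.
Proof.
rewrite -row_free_unit -kermx_eq0; apply/eqP/row_matrixP => i; rewrite row0.
set u := row i _; have uG : u *m G = 0 by rewrite -row_mul mulmx_ker row0.
apply: (row_free_inj fJ); rewrite mul0mx; apply: dot_eq0.
by rewrite /dot trmx_mul mulmxA -[u *m _ *m _]mulmxA uG mul0mx mxE.
Qed.

Lemma push_left_inverse : J *m L = 1%:M.
Proof. by rewrite mulmxA mulmxV // gram_unit. Qed.

Lemma push_tproj : J *m Pi = J.
Proof. by rewrite mulmxA push_left_inverse mul1mx. Qed.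

Lemma gram_sym : G^T = G. Proof. by rewrite trmx_mul trmxK. Qed.

Lemma gram_inv_sym : (invmx G)^T = invmx G.
Proof. by rewrite trmx_inv gram_sym. Qed.

Lemma Pi_sym : Pi^T = Pi.
Proof. by rewrite !trmx_mul trmxK gram_inv_sym mulmxA. Qed.

Lemma Pi_tr : Pi *m J^T = J^T.
Proof. by rewrite -mulmxA mulmxKV // gram_unit. Qed.

Lemma Pi_idem : Pi *m Pi = Pi.
Proof. by rewrite -[Pi *m Pi]mulmxA push_tproj. Qed.

Lemma tangent_Pi (w : 'rV[R]_(n + k)) : (w <= J)%MS -> w *m Pi = w.
Proof. by move=> /submxP[u ->]; rewrite -[u *m J *m _]mulmxA push_tproj. Qed.

Lemma Pi_tangent (w : 'rV[R]_(n + k)) : (w *m Pi <= J)%MS.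
Proof. by rewrite mulmxA submxMl. Qed.

Lemma pinv_tangent (w : 'rV[R]_(n + k)) : (w <= J)%MS -> w *m pinvmx J = w *m L.
Proof.
move=> wJ; apply: (row_free_inj fJ).
by rewrite mulmxKpV // -[RHS]mulmxA tangent_Pi.
Qed.

Lemma tangent_normal_disjoint : (<<J>> :&: kermx J^T = 0)%MS.
Proof.
apply/eqP; rewrite -submx0; apply/rV_subP => w; rewrite sub_capmx genmxE => /andP[wJ].
move=> /sub_kermxP wK; rewrite submx0; apply/eqP.
by rewrite -(tangent_Pi wJ) !mulmxA wK !mul0mx.
Qed.

Lemma normal_Pi (w : 'rV[R]_(n + k)) : (w <= kermx J^T)%MS = (w *m Pi == 0).
Proof.
apply/sub_kermxP/eqP => [wK|wP]; first by rewrite !mulmxA wK !mul0mx.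
by rewrite -Pi_tr mulmxA wP mul0mx.
Qed.

Lemma compl_normal (w : 'rV[R]_(n + k)) : (w - w *m Pi <= kermx J^T)%MS.
Proof. by rewrite normal_Pi mulmxBl -[w *m Pi *m Pi]mulmxA Pi_idem subrr. Qed.

(** The matrix J^T (J J^T)^-1 J fixes the rows of J and kills the orthogonal
    complement. *)
Lemma proj_tangentE (w : 'rV[R]_(n + k)) : w *m proj_mx <<J>>%MS (kermx J^T) = w *m Pi.
Proof.
rewrite -{1}[w](subrK (w *m Pi)) mulmxDl.
rewrite (proj_mx_0 tangent_normal_disjoint (compl_normal w)) add0r.
by rewrite (proj_mx_id tangent_normal_disjoint) // genmxE Pi_tangent.
Qed.

Lemma proj_normalE (w : 'rV[R]_(n + k)) : w *m proj_mx (kermx J^T) <<J>>%MS = w - w *m Pi.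
Proof.
have dis : (kermx J^T :&: <<J>> = 0)%MS by rewrite capmxC tangent_normal_disjoint.
rewrite -{1}[w](subrK (w *m Pi)) mulmxDl.
rewrite (proj_mx_id dis (compl_normal w)).
by rewrite (proj_mx_0 dis) ?addr0 // genmxE Pi_tangent.
Qed.

End Gram.

(** * The Levi-Civita connection of the induced metric *)

Section Tensoriality.
Variables (R : realType) (n : nat) (U : set 'rV[R]_n).
Hypothesis oU : open U.

Lemma smooth_coord_field i : smooth U (@coord_field R n i).
Proof. by apply: smooth_cst. Qed.

Lemma smooth_entry (X : vfield R n) i : smooth U X -> smooth U (fun y => X y 0 i).
Proof. by move=> /(smooth_mx oU); apply. Qed.

(** Additivity and linearity over functions determine the value at a point from the
    values on the constant coordinate fields. *)
Lemma tensor_expand (S : vfield R n -> 'rV[R]_n) (x : 'rV[R]_n) :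
  (forall X Y, smooth U X -> smooth U Y -> S (fun y => X y + Y y) = S X + S Y) ->
  (forall (f : 'rV[R]_n -> R) X, smooth U f -> smooth U X ->
     S (fun y => f y *: X y) = f x *: S X) ->
  forall X, smooth U X -> S X = \sum_i X x 0 i *: S (coord_field i).
Proof.
move=> SD SZ X sX.
have {1}-> : X = fun y => \sum_i X y 0 i *: coord_field i y.
  by apply/funext => y; exact: rV_delta.
have sXc i : smooth U (fun y => X y 0 i *: coord_field i y).
  by apply: smoothZ => //; [exact: smooth_entry|exact: smooth_coord_field].
have s0 : smooth U (fun _ : 'rV[R]_n => 0 : 'rV[R]_n) by apply: smooth_cst.
have S0 : S (fun _ => 0) = 0.
  have sR : smooth U (fun _ : 'rV[R]_n => 0 : R) by apply: smooth_cst.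
  by have := SZ _ _ sR s0; rewrite !scale0r.
suff [] : smooth U (fun y => \sum_i X y 0 i *: coord_field i y) /\
    S (fun y => \sum_i X y 0 i *: coord_field i y) = \sum_i X x 0 i *: S (coord_field i).
  by [].
elim: (index_enum _) => [|i r [sr IH]].
  have E0 : (fun y => \sum_(i <- [::]) X y 0 i *: coord_field i y) = (fun _ => 0).
    by apply/funext => y; rewrite big_nil.
  by rewrite E0 big_nil.
have E1 : (fun y => \sum_(j <- i :: r) X y 0 j *: coord_field j y) =
   (fun y => X y 0 i *: coord_field i y + \sum_(j <- r) X y 0 j *: coord_field j y).
  by apply/funext => y; rewrite big_cons.
rewrite E1; split; first exact: smoothD.
rewrite SD // IH SZ; [by rewrite big_cons|exact: smooth_entry|exact: smooth_coord_field].
Qed.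

End Tensoriality.

Lemma addr_eq_sub (V : zmodType) (p q r s : V) : p + q = r + s -> p - r = - (q - s).
Proof. by move=> e; apply/eqP; rewrite -addr_eq0 addrACA e addrACA !subrr addr0. Qed.

(** Alternating the two symmetries three times gives T = - T. *)
Lemma sym_antisym_eq0 (R : realFieldType) (I : Type) (T : I -> I -> I -> R) :
  (forall a b c, T a b c = T b a c) -> (forall a b c, T a b c = - T a c b) ->
  forall a b c, T a b c = 0.
Proof.
move=> Ts Ta a b c; have h : T a b c = - T a b c.
  by rewrite {1}(Ts a b) (Ta b a) (Ts b c) (Ta c b) opprK (Ts c a) (Ta a c).
have : T a b c *+ 2 == 0 by rewrite mulr2n {1}h addNr.
by rewrite mulrn_eq0 => /eqP.
Qed.

Section InducedConnection.
Variables (R : realType) (n k : nat) (U : set 'rV[R]_n) (phi : 'rV[R]_n -> 'rV[R]_(n + k)).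
Hypotheses (oU : open U) (sphi : smooth U phi).
Hypothesis fJ : forall x, U x -> row_free (jacobian phi x).
Local Notation J := (jacobian phi).
Local Notation g := (induced_metric phi).

(** The left inverse of the push forward whose kernel is the normal space. *)
Definition pull_mx x : 'M[R]_(n + k, n) := (J x)^T *m invmx (g x).
Definition tangent_projector x : 'M[R]_(n + k) := pull_mx x *m J x.

Lemma smooth_chart_jacobian : smooth U J. Proof. exact: smooth_jacobian. Qed.
Lemma smooth_induced_metric : smooth U g.
Proof. by apply: smooth_mulmx => //; [exact: smooth_chart_jacobian|apply: smooth_tr => //; exact: smooth_chart_jacobian]. Qed.
Lemma induced_metric_unit x : U x -> g x \in unitmx. Proof. by move=> /fJ; exact: gram_unit. Qed.
Lemma smooth_induced_metric_inv : smooth U (fun x => invmx (g x)).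
Proof. by apply: smooth_invmx => //; [exact: induced_metric_unit|exact: smooth_induced_metric]. Qed.
Lemma smooth_pull_mx : smooth U pull_mx.
Proof.
by apply: smooth_mulmx => //; [apply: smooth_tr => //; exact: smooth_chart_jacobian|exact: smooth_induced_metric_inv].
Qed.
Lemma smooth_tangent_projector : smooth U tangent_projector.
Proof. by apply: smooth_mulmx => //; [exact: smooth_pull_mx|exact: smooth_chart_jacobian]. Qed.

Lemma J_pull_mx x : U x -> J x *m pull_mx x = 1%:M. Proof. by move=> /fJ; exact: push_left_inverse. Qed.
Lemma J_tang x : U x -> J x *m tangent_projector x = J x. Proof. by move=> /fJ; exact: push_tproj. Qed.
Lemma tang_sym x : (tangent_projector x)^T = tangent_projector x. Proof. exact: Pi_sym. Qed.
Lemma tang_idem x : U x -> tangent_projector x *m tangent_projector x = tangent_projector x. Proof. by move=> /fJ; exact: Pi_idem. Qed.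

Lemma smooth_push X : smooth U X -> smooth U (fun y => push phi y (X y)).
Proof. by move=> sX; apply: smooth_mulmx => //; exact: smooth_chart_jacobian. Qed.

Lemma ip_g x (u w : 'rV[R]_n) : ip g x u w = dot (u *m J x) (w *m J x).
Proof. by rewrite /ip /dot /induced_metric trmx_mul !mulmxA. Qed.

Lemma derive_dot m (A B : 'rV[R]_n -> 'rV[R]_m) x w : differentiable A x -> differentiable B x ->
  'D_w (fun y => dot (A y) (B y)) x = dot ('D_w A x) (B x) + dot (A x) ('D_w B x).
Proof.
move=> dA dB.
have dAi i := (differentiable_mx A x).1 dA 0 i; have dBi i := (differentiable_mx B x).1 dB 0 i.
have -> : (fun y => dot (A y) (B y)) = (fun y => \sum_i A y 0 i * B y 0 i).
  by apply/funext => y; rewrite dotE.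
rewrite derive_bigsum => [|i]; last exact: differentiableM.
rewrite !dotE -big_split; apply: eq_bigr => i _ /=.
by rewrite (derive_mul _ (dAi i) (dBi i)) (derive_entry w 0 i dA) (derive_entry w 0 i dB).
Qed.

Lemma smooth_dot m (A B : 'rV[R]_n -> 'rV[R]_m) : smooth U A -> smooth U B ->
  smooth U (fun y => dot (A y) (B y)).
Proof.
move=> sA sB; have := smooth_mulmx oU sA (smooth_tr oU sB).
by move=> /(smooth_mx oU) /(_ 0 0).
Qed.

Definition induced_conn (X Y : vfield R n) : vfield R n :=
  fun x => ddir X (fun y => push phi y (Y y)) x *m pull_mx x.

(** Both sides are second derivatives of phi. *)
Lemma hessian_sym (a b : 'rV[R]_n) x : U x -> b *m 'D_a J x = a *m 'D_b J x.
Proof.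
move=> Ux; have dJ := smooth_differentiable smooth_chart_jacobian Ux.
have E c d : d *m 'D_c J x = 'D_c ('D_d phi) x.
  have -> : d *m 'D_c J x = 'D_c (fun y => d *m J y) x.
    rewrite (derive_mulmx _ (differentiable_cst d x) dJ).
    by rewrite (derive_cst d) mul0mx add0r.
  apply: (derive_near _ oU Ux) => y Uy; rewrite deriveEjacobian //.
  exact: smooth_differentiable sphi Uy.
apply: (etrans (E _ _)); apply: (etrans _ (esym (E _ _))).
exact: derive_comm sphi Ux.
Qed.

(** The terms in which the jacobian is differentiated cancel by the symmetry of the
    second derivatives of phi. *)
Lemma induced_conn_torsion_free X Y x : smooth U X -> smooth U Y -> U x ->
  induced_conn X Y x - induced_conn Y X x = bracket X Y x.
Proof.
move=> sX sY Ux; rewrite /induced_conn /ddir /push -mulmxBl.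
have dJ := smooth_differentiable smooth_chart_jacobian Ux.
have [dX dY] := (smooth_differentiable sX Ux, smooth_differentiable sY Ux).
rewrite (derive_mulmx _ dX dJ) (derive_mulmx _ dY dJ).
have comm := hessian_sym (X x) (Y x) Ux.
rewrite /bracket /ddir; move: ('D_(X x) J x) ('D_(Y x) J x) comm => P Q comm.
move: ('D_(X x) Y x) ('D_(Y x) X x) => p q.
by rewrite comm opprD addrACA subrr addr0 -mulmxBl -mulmxA J_pull_mx // mulmx1.
Qed.

(** The inner product of g is the Euclidean one of the push forwards, and only the
    tangential part of a derivative contributes to the inner product with a tangent
    vector. *)
Lemma induced_conn_metric X Y Z x : smooth U X -> smooth U Y -> smooth U Z -> U x ->
  ddir X (fun y => ip g y (Y y) (Z y)) x
  = ip g x (induced_conn X Y x) (Z x) + ip g x (Y x) (induced_conn X Z x).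
Proof.
move=> sX sY sZ Ux.
have E A B w : ip g x (induced_conn A B x) w
    = dot (ddir A (fun y => push phi y (B y)) x) (w *m J x).
  rewrite ip_g /induced_conn -[_ *m pull_mx x *m J x]mulmxA -[pull_mx x *m J x]/(tangent_projector x).
  by rewrite dot_mulmx tang_sym -[w *m J x *m _]mulmxA J_tang.
have ipC w z : ip g x w z = ip g x z w by rewrite !ip_g dotC.
rewrite [ip g x (Y x) _]ipC !E [X in _ + X]dotC /ddir.
have -> : (fun y => ip g y (Y y) (Z y)) = fun y => dot (push phi y (Y y)) (push phi y (Z y)).
  by apply/funext => y; rewrite ip_g.
by apply: derive_dot; apply: smooth_differentiable Ux; exact: smooth_push.
Qed.

Variable D : connection R n.
Hypothesis lc : levi_civita U g D.

Lemma induced_metric_nondeg x (u : 'rV[R]_n) : U x -> (forall w, ip g x u w = 0) -> u = 0.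
Proof.
move=> Ux h; apply: (row_free_inj (fJ Ux)); rewrite mul0mx; apply: dot_eq0.
by rewrite -ip_g.
Qed.

Let S x X Y := D X Y x - induced_conn X Y x.

(** The derivatives of the coefficients of Y produced by the Leibniz rules of the
    two connections cancel. *)
Lemma diff_tensorial x X Y : U x -> smooth U X -> smooth U Y ->
  S x X Y = \sum_i \sum_j (X x 0 i * Y x 0 j) *: S x (coord_field i) (coord_field j).
Proof.
move=> Ux sX sY.
have step1 Y' : smooth U Y' -> S x X Y' = \sum_i X x 0 i *: S x (coord_field i) Y'.
  move=> sY'; apply: (tensor_expand oU (S := fun X => S x X Y') (x := x)) => //.
    move=> A B sA sB; rewrite /S (lc_addl lc) // /induced_conn /ddir derive_linD.
      by rewrite mulmxDl opprD addrACA.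
    exact: smooth_differentiable (smooth_push sY') Ux.
  move=> f A sf sA; rewrite /S (lc_scalel lc) // /induced_conn /ddir derive_linZ.
    by rewrite -scalemxAl scalerBr.
  exact: smooth_differentiable (smooth_push sY') Ux.
rewrite step1 //; apply: eq_bigr => i _.
have si := smooth_coord_field oU i.
rewrite (tensor_expand oU (S := fun Y => S x (coord_field i) Y) (x := x)) //.
- by rewrite scaler_sumr; apply: eq_bigr => j _; rewrite scalerA.
- move=> A B sA sB; rewrite /S (lc_addr lc) // /induced_conn /ddir.
  have -> : (fun y => push phi y (A y + B y)) = (fun y => push phi y (A y) + push phi y (B y)).
    by apply/funext => y; rewrite /push mulmxDl.
  rewrite derive_add; [|exact: smooth_differentiable (smooth_push sA) Ux|exact: smooth_differentiable (smooth_push sB) Ux].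
  by rewrite mulmxDl opprD addrACA.
- move=> f A sf sA; rewrite /S (lc_leibniz lc) // /induced_conn /ddir.
  have -> : (fun y => push phi y (f y *: A y)) = (fun y => f y *: push phi y (A y)).
    by apply/funext => y; rewrite /push scalemxAl.
  have dA := smooth_differentiable (smooth_push sA) Ux.
  rewrite (derive_scale _ (smooth_differentiable sf Ux) dA).
  rewrite mulmxDl -!scalemxAl /push -[_ *m pull_mx x]mulmxA J_pull_mx // mulmx1.
  by rewrite opprD addrACA subrr add0r scalerBr.
Qed.

(** The difference of the two connections is tensorial; torsion freeness makes it
    symmetric in X and Y, and compatibility with the metric antisymmetric in Y and
    the test vector. *)
Lemma lc_unique X Y x : smooth U X -> smooth U Y -> U x -> D X Y x = induced_conn X Y x.
Proof.
move=> sX sY Ux; apply/eqP; rewrite -subr_eq0 -[_ - _]/(S x X Y); apply/eqP.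
have ipC w z : ip g x w z = ip g x z w by rewrite !ip_g dotC.
have ipBl a b w : ip g x (a - b) w = ip g x a w - ip g x b w.
  by rewrite !ip_g mulmxBl dotBl.
suff z i j : S x (coord_field i) (coord_field j) = 0.
  by rewrite diff_tensorial // big1 // => i _; rewrite big1 // => j _; rewrite z scaler0.
have sc := smooth_coord_field oU.
pose T i j l := ip g x (S x (coord_field i) (coord_field j)) (coord_field l x).
have Tsym a b c : T a b c = T b a c.
  suff e : S x (coord_field a) (coord_field b) = S x (coord_field b) (coord_field a).
    by rewrite /T e.
  apply/eqP; rewrite -subr_eq0 /S subr_swap.
  by rewrite (lc_torsion_free lc) // induced_conn_torsion_free // subrr.
have TE a b c : T a b c = ip g x (D (coord_field a) (coord_field b) x) (coord_field c x)
    - ip g x (induced_conn (coord_field a) (coord_field b) x) (coord_field c x).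
  exact: ipBl.
have Tanti a b c : T a b c = - T a c b.
  have m1 := lc_metric lc (sc a) (sc b) (sc c) Ux.
  have m2 := induced_conn_metric (sc a) (sc b) (sc c) Ux.
  rewrite (TE a b c) (TE a c b); apply: addr_eq_sub.
  rewrite (ipC (D _ _ _) (coord_field b x)) (ipC (induced_conn _ _ _) (coord_field b x)).
  exact: etrans (esym m1) m2.
have T0 := sym_antisym_eq0 Tsym Tanti.
apply: (induced_metric_nondeg Ux) => w; rewrite [w]rV_delta ip_g mulmx_suml dot_sumr big1 // => l _.
by rewrite -scalemxAl dotZr -ip_g [ip _ _ _ _](T0 i j l) mulr0.
Qed.

End InducedConnection.

(** * The second fundamental form and the Gauss equation *)

Section SecondForm.
Variables (R : realType) (n k : nat) (U : set 'rV[R]_n) (phi : 'rV[R]_n -> 'rV[R]_(n + k)).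
Hypotheses (oU : open U) (sphi : smooth U phi).
Hypothesis fJ : forall x, U x -> row_free (jacobian phi x).
Local Notation J := (jacobian phi).
Local Notation g := (induced_metric phi).
Local Notation tang := (tangent_projector phi).
Local Notation push := (push phi).

(** The normal part of the second derivative of phi.  In this form it is visibly a
    pointwise bilinear form in the components of tangent vectors. *)
Definition second_ff x (a b : 'rV[R]_n) : 'rV[R]_(n + k) := b *m 'D_a J x *m (1%:M - tang x).

Lemma differentiable_jacobian x : U x -> differentiable J x.
Proof. exact: smooth_differentiable (smooth_chart_jacobian oU sphi). Qed.

Lemma sff_addl x a b c : U x -> second_ff x (a + b) c = second_ff x a c + second_ff x b c.
Proof.
move=> Ux; rewrite /second_ff (derive_linD a b (differentiable_jacobian Ux)).
by move: ('D_a J x) ('D_b J x) (1%:M - tang x) => P Q S; rewrite mulmxDr mulmxDl.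
Qed.
Lemma sff_scalel x r a c : U x -> second_ff x (r *: a) c = r *: second_ff x a c.
Proof.
move=> Ux; rewrite /second_ff (derive_linZ r a (differentiable_jacobian Ux)).
by move: ('D_a J x) (1%:M - tang x) => P S; rewrite -scalemxAr -scalemxAl.
Qed.
Lemma sff_sym x a b : U x -> second_ff x a b = second_ff x b a.
Proof.
by move=> Ux; rewrite /second_ff (hessian_sym oU sphi a b Ux).
Qed.
Lemma sff_suml x (I : finType) (a : I -> 'rV[R]_n) c : U x ->
  second_ff x (\sum_i a i) c = \sum_i second_ff x (a i) c.
Proof.
move=> Ux; elim/big_ind2: _ => //; first by rewrite -(scale0r 0) sff_scalel // scale0r.
by move=> a1 b1 a2 b2 <- <-; rewrite sff_addl.
Qed.
Lemma sff_normal x a b : U x -> second_ff x a b *m tang x = 0.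
Proof. by move=> Ux; rewrite -mulmxA mulmxBl mul1mx (tang_idem fJ Ux) subrr mulmx0. Qed.
Lemma dot_tang x (a b : 'rV[R]_(n + k)) : dot (a *m tang x) b = dot a (b *m tang x).
Proof. by rewrite dot_mulmx tang_sym. Qed.
Lemma push_tang x w : U x -> push x w *m tang x = push x w.
Proof. by move=> Ux; rewrite /Defs.push -mulmxA (J_tang fJ Ux). Qed.
Lemma dot_normal_push x (a : 'rV[R]_(n + k)) w : U x -> a *m tang x = 0 ->
  dot a (push x w) = 0.
Proof. by move=> Ux a0; rewrite -(push_tang w Ux) -dot_tang a0 dot0l. Qed.
Lemma dot_sff_push x a b w : U x -> dot (second_ff x a b) (push x w) = 0.
Proof. by move=> Ux; apply: dot_normal_push => //; exact: sff_normal. Qed.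
Lemma smooth_sff X Y : smooth U X -> smooth U Y -> smooth U (fun y => second_ff y (X y) (Y y)).
Proof.
move=> sX sY; apply: smooth_mulmx => //.
  apply: smooth_mulmx => //; apply: smooth_ddir => //; exact: smooth_chart_jacobian.
apply: smoothB => //; first by apply: smooth_cst.
exact: smooth_tangent_projector.
Qed.

Lemma push_induced_conn X Y x : U x ->
  push x (induced_conn phi X Y x) = ddir X (fun y => push y (Y y)) x *m tang x.
Proof. by move=> Ux; rewrite /Defs.push /induced_conn -mulmxA. Qed.

(** Differentiating the coefficients of Y gives a tangent vector, so the normal part
    comes from the derivative of the jacobian alone. *)
Lemma gauss_formula X Y x : U x -> smooth U Y ->
  ddir X (fun y => push y (Y y)) x = push x (induced_conn phi X Y x) + second_ff x (X x) (Y x).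
Proof.
move=> Ux sY; rewrite push_induced_conn // /second_ff /ddir /Defs.push.
have dY : differentiable Y x by exact: smooth_differentiable sY Ux.
rewrite (derive_mulmx _ dY (differentiable_jacobian Ux)); move: ('D_(X x) Y x) ('D_(X x) J x) => p Q.
rewrite mulmxDl mulmxBr mulmx1 -[_ *m J x *m tang x]mulmxA (J_tang fJ Ux) -addrA.
by congr (_ + _); rewrite [RHS]addrC subrK.
Qed.

(** Differentiate the orthogonality of eta and a push forward with constant
    components. *)
Lemma dot_derive_normal (eta : 'rV[R]_n -> 'rV[R]_(n + k)) x w z : U x ->
  differentiable eta x -> (forall y, U y -> eta y *m tang y = 0) ->
  dot ('D_w eta x) (push x z) = - dot (eta x) (second_ff x w z).
Proof.
move=> Ux deta neta.
have dz : differentiable (fun y => push y z) x.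
  by apply: differentiable_mulmx; [exact: differentiable_cst|exact: differentiable_jacobian].
have perp y c : U y -> dot (eta y) (push y c) = 0.
  by move=> Uy; apply: dot_normal_push => //; exact: neta.
have := derive_dot w deta dz.
rewrite (derive_near w oU Ux (fun y Uy => perp y z Uy)) derive_cst.
move=> /esym/eqP; rewrite addr_eq0 => /eqP ->; congr (- _).
have scz : smooth U (fun _ : 'rV[R]_n => z) by apply: smooth_cst.
have E := @gauss_formula (fun _ => w) (fun _ => z) x Ux scz.
by rewrite [X in dot _ X]E dotDr perp // add0r.
Qed.

End SecondForm.

Lemma sub_cancel (V : zmodType) (a b c d : V) : a + c - (b + d) - (a - b) = c - d.
Proof. by rewrite (opprD b d) [a + c + _]addrACA [_ + (c - d)]addrC addrK. Qed.

Section GaussEquation.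
Variables (R : realType) (n k : nat) (U : set 'rV[R]_n) (phi : 'rV[R]_n -> 'rV[R]_(n + k)).
Hypotheses (oU : open U) (sphi : smooth U phi).
Hypothesis fJ : forall x, U x -> row_free (jacobian phi x).
Variable D : connection R n.
Local Notation g := (induced_metric phi).
Hypothesis lc : levi_civita U g D.
Local Notation tang := (tangent_projector phi).
Local Notation push := (push phi).
Local Notation sff := (second_ff phi).

(** Flatness of the ambient space: the terms with a second derivative of A cancel.
    *)
Lemma ddir_bracket (A : 'rV[R]_n -> 'rV[R]_(n + k)) (X Y : vfield R n) x :
  smooth U A -> smooth U X -> smooth U Y -> U x ->
  ddir X (ddir Y A) x - ddir Y (ddir X A) x = ddir (bracket X Y) A x.
Proof.
move=> sA sX sY Ux.
have dA y : U y -> differentiable A y by exact: smooth_differentiable.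
have sJA := smooth_jacobian oU sA; have dJA := smooth_differentiable sJA Ux.
have E (V W : vfield R n) : smooth U W ->
    ddir V (ddir W A) x = 'D_(V x) W x *m jacobian A x + W x *m 'D_(V x) (jacobian A) x.
  move=> sW; rewrite -(derive_mulmx _ (smooth_differentiable sW Ux) dJA).
  by apply: (derive_near _ oU Ux) => y Uy; rewrite /ddir deriveEjacobian //; exact: dA.
rewrite (E X Y sY) (E Y X sX) (hessian_sym oU sA (X x) (Y x) Ux).
rewrite [RHS](deriveEjacobian _ (dA x Ux)) /bracket /ddir.
move: ('D_(X x) Y x) ('D_(Y x) X x) (jacobian A x) (X x *m _) => p q Q S.
by rewrite opprD addrACA subrr addr0 mulmxBl.
Qed.

Lemma push_conn X Y x : smooth U X -> smooth U Y -> U x ->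
  push x (D X Y x) = ddir X (fun y => push y (Y y)) x - sff x (X x) (Y x).
Proof.
move=> sX sY Ux; rewrite (lc_unique oU sphi fJ lc sX sY Ux).
by rewrite (gauss_formula oU sphi fJ X Ux sY) addrK.
Qed.

Lemma ip_conn X Y x z : smooth U X -> smooth U Y -> U x ->
  ip g x (D X Y x) z = dot (ddir X (fun y => push y (Y y)) x) (push x z).
Proof.
move=> sX sY Ux; rewrite ip_g -[_ *m _]/(push x (D X Y x)) push_conn // dotBl.
by rewrite [X in _ - X](dot_sff_push fJ) // subr0.
Qed.

(** The derivative of the normal part II(X, Y) in the direction W meets tangent
    vectors only through the second fundamental form. *)
Lemma ip_conn2 W X Y x z : smooth U W -> smooth U X -> smooth U Y -> U x ->
  ip g x (D W (D X Y) x) z =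
  dot (ddir W (ddir X (fun y => push y (Y y))) x) (push x z)
  + dot (sff x (X x) (Y x)) (sff x (W x) z).
Proof.
move=> sW sX sY Ux; have sDXY := lc_smooth lc sX sY.
have sII := smooth_sff oU sphi fJ sX sY.
have sdd := smooth_ddir oU sX (smooth_push oU sphi sY).
rewrite (ip_conn z sW sDXY Ux).
have -> : ddir W (fun y => push y (D X Y y)) x =
   ddir W (ddir X (fun y => push y (Y y))) x - 'D_(W x) (fun y => sff y (X y) (Y y)) x.
  have dII := smooth_differentiable sII Ux.
  rewrite -(derive_opp _ dII) -[X in X + _]/('D_(W x) (ddir X (fun y => push y (Y y))) x).
  rewrite -derive_add; [|exact: smooth_differentiable sdd Ux|exact: differentiableN].
  by apply: (derive_near _ oU Ux) => y Uy; rewrite push_conn.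
rewrite dotBl (dot_derive_normal oU sphi fJ) ?opprK //.
- exact: smooth_differentiable sII Ux.
- by move=> y Uy; rewrite (sff_normal fJ).
Qed.

(** The Euclidean second derivatives cancel against the bracket term, which leaves
    the two corrections of [ip_conn2]. *)
Lemma gauss_equation W X Y Z x :
  smooth U W -> smooth U X -> smooth U Y -> U x ->
  riemann D g W X Y Z x =
  dot (sff x (X x) (Y x)) (sff x (W x) (Z x)) - dot (sff x (W x) (Y x)) (sff x (X x) (Z x)).
Proof.
move=> sW sX sY Ux; rewrite /riemann.
have ipB a b c : ip g x (a - b) c = ip g x a c - ip g x b c.
  by rewrite !ip_g mulmxBl dotBl.
have sb := smooth_bracket oU sW sX.
apply: (etrans (ipB _ _ _)); rewrite (ip_conn (Z x) sb sY Ux).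
rewrite -(ddir_bracket (smooth_push oU sphi sY) sW sX Ux) dotBl.
apply: (etrans (congr1 (fun t => t - _) (ipB _ _ _))).
rewrite (ip_conn2 (Z x) sW sX sY Ux) (ip_conn2 (Z x) sX sW sY Ux).
exact: sub_cancel.
Qed.

End GaussEquation.

(** * The divergence in coordinates *)

Section Jacobi.
Variables (R : realType) (V : normedModType R).

Lemma derive_prod (I : eqType) (r : seq I) (f : I -> V -> R) x w :
  uniq r -> (forall i, differentiable (f i) x) ->
  'D_w (fun y => \prod_(i <- r) f i y) x =
  \sum_(i <- r) 'D_w (f i) x * \prod_(j <- r | j != i) f j x.
Proof.
move=> ur df; elim: r ur => [_|a r IH /= /andP[ar ur]].
  have -> : (fun y => \prod_(i <- [::]) f i y) = fun _ => 1.
    by apply/funext => y; rewrite big_nil.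
  by rewrite derive_cst big_nil.
have -> : (fun y => \prod_(i <- a :: r) f i y) = fun y => f a y * \prod_(i <- r) f i y.
  by apply/funext => y; rewrite big_cons.
have dp : differentiable (fun y => \prod_(i <- r) f i y) x.
  rewrite -[fun y => _](fct_prodE); elim/big_ind: _ => [|g h dg dh|i _].
  - exact: differentiable_cst.
  - exact: differentiableM.
  - exact: df.
rewrite derive_mul // IH // big_cons big_cons eqxx /=; congr (_ * _ + _).
  rewrite [RHS]big_seq_cond [LHS]big_seq; apply: eq_bigl => i.
  by case: (i \in r) / idP => //= ir; apply/esym; apply: contraNneq ar => <-.
rewrite mulr_sumr; rewrite [LHS]big_seq [RHS]big_seq; apply: eq_bigr => i ir.
rewrite big_cons; have -> : a != i by apply: contraNneq ar => ->.
by rewrite mulrCA.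
Qed.

(** The derivative of the Leibniz expansion is the sum over i of the determinants
    with row i differentiated; expanding each along that row produces the adjugate.
    *)
Lemma derive_det n (A : V -> 'M[R]_n) x w : differentiable A x ->
  'D_w (fun y => \det (A y)) x = \tr ('D_w A x *m \adj (A x)).
Proof.
move=> dA; have dAij := (differentiable_mx A x).1 dA.
pose B i : 'M[R]_n := \matrix_(k, l) if k == i then ('D_w A x) k l else A x k l.
transitivity (\sum_i \det (B i)); last first.
  rewrite /mxtrace; apply: eq_bigr => i _.
  rewrite (expand_det_row (B i) i) mxE; apply: eq_bigr => j _.
  rewrite !mxE eqxx; congr (_ * _); rewrite /cofactor; congr (_ * \det _).
  by apply/matrixP => a b; rewrite !mxE eq_sym (negbTE (neq_lift i a)).
rewrite /determinant exchange_big /=.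
have dP (s : {perm 'I_n}) : differentiable (fun y => \prod_i A y i (s i)) x.
  rewrite -[fun y => _](fct_prodE); elim/big_ind: _ => [|g h dg dh|i _].
  - exact: differentiable_cst.
  - exact: differentiableM.
  - exact: dAij.
rewrite (@derive_bigsum _ _ _ _ (fun (s : {perm 'I_n}) y => (-1) ^+ s * \prod_i A y i (s i))); last first.
  by move=> s; apply: differentiableM; [exact: differentiable_cst|exact: dP].
apply: eq_bigr => s _.
rewrite derive_mul; [|exact: differentiable_cst|exact: dP].
rewrite derive_cst mul0r add0r (@derive_prod _ _ (fun i y => A y i (s i))) ?index_enum_uniq //.
rewrite mulr_sumr; apply: eq_bigr => i _; congr (_ * _).
rewrite [RHS](bigD1 i) //= mxE eqxx derive_entry //; congr (_ * _).
by apply: eq_bigr => j ji; rewrite mxE (negbTE ji).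
Qed.

End Jacobi.

Lemma half_square_eq (R : realFieldType) (v p t : R) : 0 < v ->
  p * v + v * p = v ^+ 2 * (t + t) -> p = v * t.
Proof. by move=> v0 h; apply: (mulfI (lt0r_neq0 v0)); lra. Qed.

Section Frame.
Variables (R : realType) (n : nat) (U : set 'rV[R]_n) (g : metric R n).
Variables (D : connection R n) (e : 'I_n -> vfield R n).
Hypotheses (oU : open U) (sg : smooth U g).
Hypothesis gsym : forall x, U x -> (g x)^T = g x.
Hypothesis lc : levi_civita U g D.
Hypothesis se : forall a, smooth U (e a).
Hypothesis eon : forall x, U x -> forall a b, ip g x (e a x) (e b x) = (a == b)%:R.

Local Notation c := (@coord_field R n).

Lemma ipDl x a b w : ip g x (a + b) w = ip g x a w + ip g x b w.
Proof. by rewrite /ip !mulmxDl mxE. Qed.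
Lemma ipZl x r a w : ip g x (r *: a) w = r * ip g x a w.
Proof. by rewrite /ip -!scalemxAl mxE. Qed.
Lemma ipNl x a w : ip g x (- a) w = - ip g x a w.
Proof. by rewrite /ip !mulNmx mxE. Qed.
Lemma ipBl x a b w : ip g x (a - b) w = ip g x a w - ip g x b w.
Proof. by rewrite ipDl ipNl. Qed.
Lemma ip_suml x (I : finType) (a : I -> 'rV[R]_n) w :
  ip g x (\sum_i a i) w = \sum_i ip g x (a i) w.
Proof. by rewrite /ip !mulmx_suml summxE. Qed.
Lemma ipC x a b : U x -> ip g x a b = ip g x b a.
Proof.
by move=> Ux; rewrite -[LHS]/(dot (a *m g x) b) dot_mulmx gsym // dotC.
Qed.
Lemma ipZr x r a w : ip g x w (r *: a) = r * ip g x w a.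
Proof. by rewrite /ip linearZ /= -scalemxAr mxE. Qed.
Lemma ip_sumr x (I : finType) (a : I -> 'rV[R]_n) w :
  ip g x w (\sum_i a i) = \sum_i ip g x w (a i).
Proof. by rewrite /ip raddf_sum /= mulmx_sumr summxE. Qed.
Lemma ip_delta x a j : ip g x a (delta_mx 0 j) = (a *m g x) 0 j.
Proof. by rewrite /ip trmx_delta -colE mxE. Qed.

Definition frame_mx x : 'M[R]_n := \matrix_a e a x.

Lemma frame_gram x : U x -> frame_mx x *m g x *m (frame_mx x)^T = 1%:M.
Proof.
move=> Ux; apply/matrixP => a b; rewrite [RHS]mxE -(eon Ux a b) /ip.
transitivity ((row a (frame_mx x *m g x) *m (row b (frame_mx x))^T) 0 0).
  by rewrite !mxE; apply: eq_bigr => j _; rewrite !mxE.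
by rewrite row_mul !rowK.
Qed.

Lemma metric_unit x : U x -> g x \in unitmx.
Proof.
move=> Ux; have /mulmx1_unit[] := frame_gram Ux; rewrite unitmx_mul.
by case/andP.
Qed.

(** The matrix of an orthonormal frame transforms g into the identity, so det g is
    the inverse of a square. *)
Lemma det_metric_gt0 x : U x -> 0 < \det (g x).
Proof.
move=> Ux; have := congr1 determinant (frame_gram Ux).
rewrite !det_mulmx det_tr det1 mulrAC -expr2 => h.
have := @ltr01 R; rewrite -h.
have := sqr_ge0 (\det (frame_mx x)); rewrite le_eqVlt => /orP[/eqP z|z].
  by rewrite -z mul0r ltxx.
by rewrite pmulr_rgt0.
Qed.

Lemma frame_inv x : U x -> (frame_mx x)^T *m frame_mx x = invmx (g x).
Proof.
move=> Ux; have := frame_gram Ux; rewrite -mulmxA => /mulmx1C h.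
apply: (can_inj (mulKmx (metric_unit Ux))).
by rewrite mulmxA h mulmxV // metric_unit.
Qed.

(** The matrix F of the frame satisfies F g F^T = 1, hence also F^T F = g^-1. *)
Lemma frame_expand x w : U x -> w = \sum_a ip g x w (e a x) *: e a x.
Proof.
move=> Ux; transitivity (w *m g x *m ((frame_mx x)^T *m frame_mx x)).
  by rewrite frame_inv // mulmxK // metric_unit.
rewrite mulmxA mulmx_sum_row; apply: eq_bigr => a _; rewrite rowK; congr (_ *: _).
rewrite /ip !mxE; apply: eq_bigr => j _; rewrite !mxE; congr (_ * _).
Qed.

Lemma frame_trace x (A : 'M[R]_n) : U x -> \sum_a ip g x (e a x *m A) (e a x) = \tr A.
Proof.
move=> Ux; transitivity (\tr (frame_mx x *m A *m g x *m (frame_mx x)^T)).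
  apply: eq_bigr => a _; rewrite /ip -[e a x](rowK (fun a => e a x)) -/(frame_mx x).
  by rewrite -!row_mul !mxE; apply: eq_bigr => j _; rewrite !mxE.
rewrite mxtrace_mulC !mulmxA frame_inv // mxtrace_mulC.
by rewrite mulmxA mulmxV ?mul1mx // metric_unit.
Qed.

Let sc i : smooth U (c i) := smooth_coord_field oU i.

Lemma conn_tensor X Y x : smooth U X -> smooth U Y -> U x ->
  D X Y x = \sum_i X x 0 i *: D (c i) Y x.
Proof.
move=> sX sY Ux; apply: (tensor_expand oU (S := fun X => D X Y x)) => //.
- by move=> A B sA sB; rewrite (lc_addl lc).
- by move=> f A sf sA; rewrite (lc_scalel lc).
Qed.

(** The matrix of the endomorphism X |-> nabla_X Y, acting on row vectors. *)
Definition nabla (Y : vfield R n) x : 'M[R]_n := \matrix_i D (c i) Y x.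

Lemma conn_nabla X Y x : smooth U X -> smooth U Y -> U x -> D X Y x = X x *m nabla Y x.
Proof.
move=> sX sY Ux; rewrite (conn_tensor sX sY Ux) mulmx_sum_row.
by apply: eq_bigr => i _; rewrite rowK.
Qed.

Lemma divergence_nabla V x : smooth U V -> U x -> divergence D g e V x = \tr (nabla V x).
Proof.
move=> sV Ux; rewrite -(frame_trace _ Ux); apply: eq_bigr => a _.
by rewrite (conn_nabla (se a) sV Ux).
Qed.

Lemma coord_bracket i j x : bracket (c i) (c j) x = 0.
Proof. by rewrite /bracket /ddir !(derive_cst) subrr. Qed.

Lemma christoffel_sym i j x : U x -> D (c i) (c j) x = D (c j) (c i) x.
Proof.
move=> Ux; apply/eqP; rewrite -subr_eq0; apply/eqP.
by rewrite (lc_torsion_free lc (sc i) (sc j) Ux) coord_bracket.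
Qed.

Lemma conn_leibniz_coord i V x : smooth U V -> U x ->
  D (c i) V x = 'D_(delta_mx 0 i) V x + \sum_j V x 0 j *: D (c i) (c j) x.
Proof.
move=> sV Ux; have dV := smooth_differentiable sV Ux.
pose S Y := D (c i) Y x - 'D_(delta_mx 0 i) Y x.
suff : S V = \sum_j V x 0 j *: S (c j).
  rewrite /S => /eqP; rewrite subr_eq addrC => /eqP ->; congr (_ + _).
  by apply: eq_bigr => j _; rewrite derive_cst subr0.
apply: (tensor_expand oU (S := S)) => //.
- move=> A B sA sB; rewrite /S (lc_addr lc (sc i) sA sB Ux).
  rewrite (derive_add _ (smooth_differentiable sA Ux) (smooth_differentiable sB Ux)).
  by rewrite opprD; exact: addrACA.
- move=> f A sf sA; rewrite /S (lc_leibniz lc sf (sc i) sA Ux) /ddir.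
  have df := smooth_differentiable sf Ux; have dA := smooth_differentiable sA Ux.
  rewrite (derive_scale _ df dA).
  move: ('D_(c i x) f x) ('D_(delta_mx 0 i) A x) (D (c i) A x) => p q r.
  by rewrite opprD addrACA subrr add0r scalerBr.
Qed.

Lemma trace_nabla (V : vfield R n) x : smooth U V -> U x ->
  \tr (nabla V x) = \sum_j ('D_(delta_mx 0 j) (fun y => V y 0 j) x + V x 0 j * \tr (nabla (c j) x)).
Proof.
move=> sV Ux; have dV := smooth_differentiable sV Ux.
have E i : nabla V x i i = 'D_(delta_mx 0 i) (fun y => V y 0 i) x
    + \sum_j V x 0 j * nabla (c j) x i i.
  rewrite [LHS]mxE (conn_leibniz_coord i sV Ux) [LHS]mxE (derive_entry _ 0 i dV) summxE.
  by congr (_ + _); apply: eq_bigr => j _; rewrite [LHS]mxE [in RHS]mxE.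
rewrite big_split /= /mxtrace (eq_bigr _ (fun i _ => E i)) big_split /=; congr (_ + _).
rewrite exchange_big /=; apply: eq_bigr => j _.
by rewrite mulr_sumr.
Qed.

(** Metric compatibility on the coordinate fields; by the absence of torsion the
    derivative in the direction j is expressed by the matrix of the covariant
    derivative of the field j. *)
Lemma derive_metric j x : U x ->
  'D_(delta_mx 0 j) g x = nabla (c j) x *m g x + (nabla (c j) x *m g x)^T.
Proof.
move=> Ux; have dg := smooth_differentiable sg Ux.
apply/matrixP => i l; rewrite (derive_entry _ i l dg) [RHS]mxE [X in _ = _ + X]mxE.
have -> : (fun y => g y i l) = fun y => ip g y (c i y) (c l y).
  by apply/funext => y; rewrite ip_delta -rowE mxE.
apply: (etrans (lc_metric lc (sc j) (sc i) (sc l) Ux)).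
have E a b : ip g x (D (c j) (c a) x) (c b x) = (nabla (c j) x *m g x) a b.
  rewrite ip_delta -(christoffel_sym a j Ux) -[D _ _ x](rowK (fun i => D (c i) (c j) x)).
  by rewrite -row_mul mxE.
by rewrite E [X in _ + X](ipC _ _ Ux) E.
Qed.

Definition vol_density x := Num.sqrt (\det (g x)).

Lemma smooth_vol_density : smooth U vol_density.
Proof. by apply: smooth_sqrt => //; [exact: det_metric_gt0|exact: smooth_det]. Qed.

Lemma vol_density_gt0 x : U x -> 0 < vol_density x.
Proof. by move=> Ux; rewrite sqrtr_gt0 det_metric_gt0. Qed.

(** By the formula of Jacobi the derivative of det g is det g times the trace of
    g^-1 dg, and the two terms of [derive_metric] have the same trace. *)
Lemma derive_vol_density j x : U x -> 'D_(delta_mx 0 j) vol_density x = vol_density x * \tr (nabla (c j) x).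
Proof.
move=> Ux; have dv := smooth_differentiable smooth_vol_density Ux.
have h : 'D_(delta_mx 0 j) (fun y => vol_density y * vol_density y) x = 'D_(delta_mx 0 j) (fun y => \det (g y)) x.
  by apply: (derive_near _ oU Ux) => y Uy; rewrite -expr2 sqr_sqrtr // ltW // det_metric_gt0.
move: h; rewrite (derive_mul _ dv dv) (derive_det _ (smooth_differentiable sg Ux)).
have -> : \adj (g x) = \det (g x) *: invmx (g x).
  by rewrite /invmx metric_unit // scalerA mulfV ?scale1r // gt_eqF // det_metric_gt0.
rewrite derive_metric // -scalemxAr mxtraceZ mulmxDl mxtraceD.
rewrite mulmxK ?metric_unit // trmx_mul gsym // mxtrace_mulC mulmxA mulVmx ?metric_unit //.
rewrite mul1mx mxtrace_tr -[\det _](sqr_sqrtr (ltW (det_metric_gt0 Ux))) -/(vol_density x).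
exact: half_square_eq (vol_density_gt0 Ux).
Qed.

(** The divergence is the trace of nabla V in any orthonormal frame; the trace of
    the Christoffel symbols is the logarithmic derivative of the volume density. *)
Lemma divergence_formula (V : vfield R n) x : smooth U V -> U x ->
  \sum_j 'D_(delta_mx 0 j) (fun y => vol_density y * V y 0 j) x = vol_density x * divergence D g e V x.
Proof.
move=> sV Ux; rewrite (divergence_nabla sV Ux) (trace_nabla sV Ux) mulr_sumr.
have dv := smooth_differentiable smooth_vol_density Ux.
apply: eq_bigr => j _.
have dVj := (differentiable_mx V x).1 (smooth_differentiable sV Ux) 0 j.
rewrite (derive_mul _ dv dVj) (derive_vol_density j Ux) mulrDr addrC; congr (_ + _).
by rewrite mulrAC mulrA.
Qed.

End Frame.

(** * Codifferentials as formal adjoints *)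

Section AdjointDivergence.
Variables (R : realType) (n : nat) (U : set 'rV[R]_n).
Hypothesis oU : open U.

(** Integrating by parts moves the derivatives to xi, and test functions separate
    points. *)
Lemma adjoint_divergence (xi : 'I_n -> 'rV[R]_n -> R) (kappa : 'rV[R]_n -> R) x :
  (forall j, smooth U (xi j)) -> smooth U kappa ->
  (forall f : _ -> R, test_function U f ->
     integral_rV (fun y => \sum_j 'D_(delta_mx 0 j) f y * xi j y)
     = integral_rV (fun y => f y * kappa y)) ->
  U x -> kappa x = - \sum_j 'D_(delta_mx 0 j) (xi j) x.
Proof.
move=> sxi sk H Ux; apply/eqP; rewrite -addr_eq0; apply/eqP.
have sD j : smooth U ('D_(delta_mx 0 j) (xi j)) by exact: smooth_derive.
(* The difference of the two sides. *)
pose h y := kappa y + \sum_j 'D_(delta_mx 0 j) (xi j) y.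
have sh : smooth U h by apply: smoothD => //; exact: smooth_sum.
apply: (test_functions_separate oU sh _ Ux) => f tf.
have [sf [K [cK KU fK]]] := tf.
have ssf : smooth_supported K f by split.
have ssk := smooth_supported_mul oU KU ssf sk.
have ssD j := smooth_supported_mul oU KU ssf (sD j).
have ssxi j := smooth_supported_mul oU KU (smooth_supported_derive (delta_mx 0 j) ssf) (sxi j).
have -> : (fun y => f y * h y) = fun y => f y * kappa y + \sum_j f y * 'D_(delta_mx 0 j) (xi j) y.
  by apply/funext => y; rewrite /h mulrDr mulr_sumr.
have ssS : smooth_supported K (fun y => \sum_j f y * 'D_(delta_mx 0 j) (xi j) y).
  split=> // [|y nK]; last by rewrite big1 // => j _; rewrite fK // mul0r.
  by apply: (smooth_sum openT) => j; have [] := ssD j.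
rewrite (integral_rV_smoothD ssk ssS) -(H _ tf).
rewrite (integral_rV_smooth_sum cK ssD) (integral_rV_smooth_sum cK ssxi) -big_split.
rewrite big1 // => j _ /=.
by rewrite (integral_rV_by_parts oU j KU ssf (sxi j)) addNr.
Qed.

End AdjointDivergence.

Section Codifferential.
Variables (R : realType) (n : nat) (U : set 'rV[R]_n) (g : metric R n).
Variables (D : connection R n) (e : 'I_n -> vfield R n).
Hypotheses (oU : open U) (sg : smooth U g).
Hypothesis gsym : forall x, U x -> (g x)^T = g x.
Hypothesis lc : levi_civita U g D.
Hypothesis se : forall a, smooth U (e a).
Hypothesis eon : forall x, U x -> forall a b, ip g x (e a x) (e b x) = (a == b)%:R.
Local Notation gu := (metric_unit eon).
Local Notation vol := (vol_density g).

Lemma metric_inv_sym x : U x -> (invmx (g x))^T = invmx (g x).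
Proof. by move=> Ux; rewrite trmx_inv gsym. Qed.

Lemma smooth_metric_inv : smooth U (fun x => invmx (g x)).
Proof. by apply: smooth_invmx => // x Ux; exact: gu Ux. Qed.

Lemma smooth_flat V : smooth U V -> smooth U (flat g V).
Proof. by move=> sV; exact: smooth_mulmx. Qed.

Lemma d0_outside (f : 'rV[R]_n -> R) K x : smooth_supported K f -> ~ K x -> d0 f x = 0.
Proof.
move=> sf nK; apply/rowP => j; rewrite !mxE.
by have [_ _ ->] := smooth_supported_derive (delta_mx 0 j) sf.
Qed.

Let sv : smooth U vol := smooth_vol_density oU sg eon.

(** The pairing of d f with the 1-form dual to V is the derivative of f along V; the
    density turns its adjoint into the divergence. *)
Lemma codiff_flat ds V x : formal_adjoint_d0 U g ds -> smooth U V -> U x ->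
  ds (flat g V) x = - divergence D g e V x.
Proof.
move=> ads sV Ux; have [sds H] := ads _ (smooth_flat sV).
have sVj j := smooth_entry oU j sV.
have := @adjoint_divergence _ _ _ oU (fun j y => vol y * V y 0 j)
   (fun y => ds (flat g V) y * vol y) x _ _ _ Ux.
rewrite (divergence_formula oU sg gsym lc se eon sV Ux) -mulrN mulrC => h.
apply: (mulfI (lt0r_neq0 (vol_density_gt0 eon Ux))); apply: h.
- by move=> j; exact: smoothM.
- exact: smoothM.
move=> f tf; have := H f tf; rewrite /vol_integral => h.
have [sf [K [cK KU fK]]] := tf; have ssf : smooth_supported K f by split.
transitivity (integral_rV (fun y => ip_form1 g y (d0 f y) (flat g V y) * Num.sqrt (\det (g y)))).
  congr integral_rV; apply/funext => y; have [Ky|nKy] := pselect (K y); last first.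
    rewrite (d0_outside ssf nKy) /ip_form1 !mul0mx mxE mul0r big1 // => j _.
    by have [_ _ ->] := smooth_supported_derive (delta_mx 0 j) ssf; rewrite ?mul0r.
  have Uy := KU _ Ky.
  rewrite /ip_form1 /flat trmx_mul gsym // mulmxA mulmxKV ?gu // mxE mulr_suml.
  by apply: eq_bigr => j _; rewrite !mxE -mulrA [V y 0 j * _]mulrC.
by rewrite h; congr integral_rV; apply/funext => y; rewrite mulrA.
Qed.

(** The components of a 2-form with both indices raised. *)
Definition raise2 (b : form2 R n) y : 'M[R]_n := invmx (g y) *m b y *m invmx (g y).

Lemma ip_form2E x (A B : 'M[R]_n) : U x ->
  ip_form2 g x A B = 2%:R^-1 * \sum_i \sum_j A i j * (invmx (g x) *m B *m invmx (g x)) i j.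
Proof.
move=> Ux; rewrite /ip_form2; congr (_ * _); apply: eq_bigr => i _; apply: eq_bigr => j _.
rewrite mxE mulr_sumr exchange_big /=; apply: eq_bigr => l _.
rewrite mxE mulr_suml mulr_sumr; apply: eq_bigr => k _.
have -> : invmx (g x) j l = invmx (g x) l j by rewrite -{1}(metric_inv_sym Ux) mxE.
by ring.
Qed.

Lemma raise2_antisym b y : U y -> (b y)^T = - b y -> (raise2 b y)^T = - raise2 b y.
Proof.
by move=> Uy by_; rewrite /raise2 !trmx_mul metric_inv_sym // by_ mulmxA !(mulmxN, mulNmx).
Qed.

(** Tested against f dx_m, the factor 1/2 in the inner product of 2-forms is
    compensated by the two orders of the indices, and what remains is the pairing of
    d f with column m of the 2-form with raised indices. *)
Lemma codiff2 ds b m x : formal_adjoint_d1 U g ds -> smooth U b ->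
  (forall y, U y -> (b y)^T = - b y) -> U x ->
  (ds b x *m invmx (g x)) 0 m = - divergence D g e (fun y => (col m (raise2 b y))^T) x.
Proof.
move=> ads sb banti Ux; have [sds H] := ads _ sb banti.
have sgi := smooth_metric_inv.
have sB : smooth U (raise2 b) by apply: smooth_mulmx => //; exact: smooth_mulmx.
pose V y : 'rV[R]_n := (col m (raise2 b y))^T.
have VE y j : V y 0 j = raise2 b y j m by rewrite !mxE.
have sV : smooth U V.
  apply/(smooth_mx oU) => i j; rewrite (ord1 i).
  under eq_fun do rewrite VE; exact: ((smooth_mx oU _).1 sB).
have sVj j := smooth_entry oU j sV.
have sk : smooth U (fun y => (ds b y *m invmx (g y)) 0 m).
  by have /(smooth_mx oU) := smooth_mulmx oU sds sgi; apply.
have := @adjoint_divergence _ _ _ oU (fun j y => vol y * V y 0 j)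
   (fun y => (ds b y *m invmx (g y)) 0 m * vol y) x _ _ _ Ux.
rewrite (divergence_formula oU sg gsym lc se eon sV Ux) -mulrN mulrC => h.
apply: (mulfI (lt0r_neq0 (vol_density_gt0 eon Ux))); apply: h.
- by move=> j; exact: smoothM.
- exact: smoothM.
move=> f tf; have [sf [K [cK KU fK]]] := tf; have ssf : smooth_supported K f by split.
(* The 1-form f dx_m. *)
pose w y : 'rV[R]_n := f y *: delta_mx 0 m.
have tw : test_function U w.
  split; last by exists K; split=> // y nK; rewrite /w fK // scale0r.
  by apply: (smoothZ openT sf); apply: smooth_cst; exact: openT.
have {H} := H w tw; rewrite /vol_integral => h.
have df y : differentiable f y by exact: smooth_differentiable sf _.
have d1w y i j : d1 w y i j = d0 f y 0 i * (j == m)%:R - d0 f y 0 j * (i == m)%:R.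
  have E k l : 'D_(delta_mx 0 k) (fun z => w z 0 l) y = d0 f y 0 k * (l == m)%:R.
    have -> : (fun z => w z 0 l) = fun z => f z * (l == m)%:R.
      by apply/funext => z; rewrite !mxE eqxx.
    rewrite (derive_mul _ (df y) (differentiable_cst _ _)) (derive_cst ((l == m)%:R : R)).
    by rewrite mulr0 addr0 mxE.
  by rewrite mxE !E.
transitivity (integral_rV (fun y => ip_form2 g y (d1 w y) (b y) * Num.sqrt (\det (g y)))).
  congr integral_rV; apply/funext => y; have [Ky|nKy] := pselect (K y); last first.
    have -> : d1 w y = 0.
      by apply/matrixP => i j; rewrite d1w (d0_outside ssf nKy) !mxE !mul0r subrr.
    rewrite /ip_form2 [in RHS]big1 ?mulr0 ?mul0r; last first.
      move=> i _; rewrite big1 // => j _; rewrite big1 // => k _; rewrite big1 // => l _.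
      by rewrite mxE mulr0 mul0r.
    rewrite big1 // => j _.
    by have [_ _ ->] := smooth_supported_derive (delta_mx 0 j) ssf; rewrite ?mul0r.
  have Uy := KU _ Ky; rewrite ip_form2E // -/(raise2 b y).
  have anti i j : raise2 b y i j = - raise2 b y j i.
    by have := raise2_antisym Uy (banti y Uy) => /matrixP /(_ j i); rewrite !mxE.
  (* As d w is the wedge of d f and dx_m, the antisymmetry of the other factor makes
     the two terms equal. *)
  have -> : \sum_i \sum_j d1 w y i j * raise2 b y i j = 2%:R * \sum_i d0 f y 0 i * raise2 b y i m.
    transitivity (\sum_i (d0 f y 0 i * raise2 b y i m) -
        \sum_j d0 f y 0 j * raise2 b y m j).
      under eq_bigr => i _ do under eq_bigr => j _ do rewrite d1w mulrBl.
      under eq_bigr => i _ do rewrite sumrB; rewrite sumrB; congr (_ - _).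
        apply: eq_bigr => i _; rewrite (bigD1 m) //= eqxx mulr1 big1 ?addr0 // => j jm.
        by rewrite (negbTE jm) mulr0 mul0r.
      rewrite exchange_big /=; apply: eq_bigr => i _.
      rewrite (bigD1 m) //= eqxx mulr1 big1 ?addr0 // => j jm.
      by rewrite (negbTE jm) mulr0 mul0r.
    have -> : \sum_j d0 f y 0 j * raise2 b y m j = - \sum_j d0 f y 0 j * raise2 b y j m.
      by rewrite -sumrN; apply: eq_bigr => j _; rewrite anti mulrN.
    by rewrite opprK mulr_natl mulr2n.
  rewrite mulrA mulVf ?pnatr_eq0 // mul1r mulr_suml; apply: eq_bigr => j _.
  by rewrite VE [d0 f y 0 j]mxE -mulrA; congr (_ * _); exact: mulrC.
rewrite h; congr integral_rV; apply/funext => y; rewrite mulrA; congr (_ * _).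
have [Ky|nKy] := pselect (K y); last first.
  by rewrite /ip_form1 /w fK // scale0r !mul0mx mxE mul0r.
have Uy := KU _ Ky; rewrite /ip_form1 /w -!scalemxAl mxE; congr (_ * _).
rewrite -[LHS]/(dot (delta_mx 0 m *m invmx (g y)) (ds b y)) dotC /dot trmx_mul metric_inv_sym //.
by rewrite trmx_delta mulmxA -colE mxE.
Qed.

End Codifferential.

(** * The Weitzenboeck formula for vector fields *)

Lemma solve_divergence_term (R : realFieldType) (p q r s t w : R) :
  q + r - (s + t) = p + (w - t) -> p = q - w + r - s.
Proof. by move=> h; lra. Qed.

Lemma solve_curvature_term (R : realFieldType) (s dd q qN zN : R) :
  s = (s - (dd - q) - (zN - qN)) + dd - (q + qN) + zN.
Proof. by lra. Qed.

Lemma rearrange_contracted_d (R : realFieldType) (p a b c r dd : R) :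
  p + a - (r + dd - c + b) = p + (a - b) + c - r - dd.
Proof. by lra. Qed.

Lemma rearrange_hodge (R : realFieldType) (z bo ri : R) : - z - (- bo - ri - z) = bo + ri.
Proof. by lra. Qed.

Section Weitzenboeck.
Variables (R : realType) (n : nat) (U : set 'rV[R]_n) (g : metric R n).
Variables (D : connection R n) (e : 'I_n -> vfield R n).
Hypotheses (oU : open U) (sg : smooth U g).
Hypothesis gsym : forall x, U x -> (g x)^T = g x.
Hypothesis lc : levi_civita U g D.
Hypothesis se : forall a, smooth U (e a).
Hypothesis eon : forall x, U x -> forall a b, ip g x (e a x) (e b x) = (a == b)%:R.
Local Notation gu := (metric_unit eon).
Local Notation c := (@coord_field R n).
Local Notation nabla := (nabla D).

Lemma smooth_ip (A B : vfield R n) : smooth U A -> smooth U B ->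
  smooth U (fun y => ip g y (A y) (B y)).
Proof.
move=> sA sB; have := smooth_mulmx oU (smooth_mulmx oU sA sg) (smooth_tr oU sB).
by move=> /(smooth_mx oU) /(_ 0 0).
Qed.

Variables (u : vfield R n) (m : 'I_n).
Hypothesis su : smooth U u.

Local Notation b := (d1 (flat g u)).

(** The gradient of the coordinate function x_m: its inner product with a vector is
    the component m, so that it tests one component of a vector identity, and its
    covariant derivative is symmetric. *)
Definition coord_grad y : 'rV[R]_n := delta_mx 0 m *m invmx (g y).
(** The field dual to the contraction of d u with [coord_grad]. *)
Definition contracted_d y : 'rV[R]_n := (col m (raise2 g b y))^T.

Lemma smooth_coord_grad : smooth U coord_grad.
Proof.
apply: (smooth_mulmx oU); last exact: smooth_metric_inv eon.
by apply: smooth_cst.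
Qed.

Lemma ip_coord_grad y w : U y -> ip g y (coord_grad y) w = w 0 m.
Proof. by move=> Uy; rewrite /ip /coord_grad mulmxKV ?gu // -rowE !mxE. Qed.

(** In the exterior derivative the covariant derivatives of the coordinate fields
    cancel, by the absence of torsion. *)
Lemma d1_flat y : U y -> b y = nabla u y *m g y - (nabla u y *m g y)^T.
Proof.
move=> Uy; apply/matrixP => i j.
have E k l : 'D_(delta_mx 0 k) (fun z => flat g u z 0 l) y
    = (nabla u y *m g y) k l + ip g y (u y) (D (c k) (c l) y).
  have -> : (fun z => flat g u z 0 l) = fun z => ip g z (u z) (c l z).
    by apply/funext => z; rewrite ip_delta.
  apply: (etrans (lc_metric lc (smooth_coord_field oU k) su (smooth_coord_field oU l) Uy)); congr (_ + _).
  rewrite ip_delta -[D _ _ y](rowK (fun i => D (c i) u y)).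
  by rewrite -row_mul mxE.
rewrite mxE (E i j) (E j i) (christoffel_sym oU lc i j Uy) opprD addrACA subrr addr0.
by rewrite [RHS]mxE [X in _ = _ + X]mxE [X in _ = _ - X]mxE.
Qed.

Lemma d1_antisym y : (b y)^T = - b y.
Proof. by apply/matrixP => i j; rewrite !mxE opprB. Qed.

Lemma smooth_d1 : smooth U b.
Proof.
have sf : smooth U (flat g u) by exact: smooth_mulmx.
apply/(smooth_mx oU) => i j; under eq_fun do rewrite mxE.
by apply: (smoothB oU); apply: smooth_derive; exact: smooth_entry.
Qed.

Lemma smooth_contracted_d : smooth U contracted_d.
Proof.
have sgi : smooth U (fun y => invmx (g y)) by exact: smooth_metric_inv eon.
have sB : smooth U (raise2 g b).
  by apply: (smooth_mulmx oU) => //; apply: (smooth_mulmx oU) => //; exact: smooth_d1.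
apply/(smooth_mx oU) => i j.
by under eq_fun do rewrite /contracted_d 2!mxE; exact: ((smooth_mx oU _).1 sB).
Qed.

Lemma ip_contracted_d y w : U y ->
  ip g y (contracted_d y) w = ip g y (w *m nabla u y) (coord_grad y) - ip g y (coord_grad y *m nabla u y) w.
Proof.
move=> Uy; have gi := metric_inv_sym gsym Uy.
have -> : contracted_d y = - (coord_grad y *m b y *m invmx (g y)).
  rewrite /contracted_d /raise2 /coord_grad colE trmx_mul !trmx_mul trmx_delta gi d1_antisym.
  by rewrite !(mulNmx, mulmxN) !mulmxA.
rewrite ipNl /ip [X in - X](_ : _ = (coord_grad y *m b y *m w^T) 0 0); last first.
  by rewrite mulmxKV ?gu.
rewrite -[X in - X]/(dot (coord_grad y *m b y) w) d1_flat // mulmxBr dotBl opprB.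
rewrite -[in RHS]/(dot (w *m nabla u y *m g y) (coord_grad y)).
rewrite -[X in _ = _ - X]/(dot (coord_grad y *m nabla u y *m g y) w).
by rewrite [dot (_ *m _^T) _]dot_mulmx trmxK dotC !mulmxA.
Qed.

Variable x : 'rV[R]_n.
Hypothesis Ux : U x.
Let sZ := smooth_coord_grad.
Local Notation Z := coord_grad.
Local Notation N := (nabla u x).
Local Notation B := (nabla Z x).

Let dn X y : smooth U X -> U y -> D X u y = X y *m nabla u y.
Proof. by move=> sX Uy; exact: (conn_nabla oU lc sX su Uy). Qed.

(** The inner product of [coord_grad] with each coordinate field is constant, and
    the Christoffel symbols are symmetric. *)
Lemma coord_grad_sym p q : ip g x (p *m B) q = ip g x (q *m B) p.
Proof.
have S i j : ip g x (D (c i) Z x) (c j x) = ip g x (D (c j) Z x) (c i x).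
  have E k l : 0 = ip g x (D (c k) Z x) (c l x) + (D (c k) (c l) x) 0 m.
    rewrite -(ip_coord_grad _ Ux); apply: (etrans _ (lc_metric lc (smooth_coord_field oU k) sZ (smooth_coord_field oU l) Ux)).
    rewrite -(derive_cst ((delta_mx 0 l : 'rV[R]_n) 0 m : R) x (c k x)).
    by apply: (derive_near _ oU Ux) => y Uy; rewrite ip_coord_grad.
  have := etrans (esym (E i j)) (E j i).
  by rewrite (christoffel_sym oU lc i j Ux) => /addIr.
have sB : (B *m g x)^T = B *m g x.
  apply/matrixP => i j; rewrite mxE.
  have T k l : (B *m g x) k l = ip g x (D (c k) Z x) (c l x).
    by rewrite ip_delta -[D _ _ x](rowK (fun i => D (c i) Z x)) -row_mul [RHS]mxE.
  by rewrite !T S.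
rewrite /ip -[p *m B *m _]mulmxA -[q *m B *m _]mulmxA -[LHS]/(dot _ _) -[RHS]/(dot _ _).
by rewrite dot_mulmx sB dotC.
Qed.

(** The trace of a product does not depend on the order of the factors, and the
    second factor is self-adjoint. *)
Lemma trace_swap : \sum_a ip g x (e a x *m N) (e a x *m B) = \sum_a ip g x (e a x *m B *m N) (e a x).
Proof.
have ex w := frame_expand eon w Ux.
transitivity (\sum_a \sum_i ip g x (e a x *m B) (e i x) * ip g x (e a x *m N) (e i x)).
  by apply: eq_bigr => a _; rewrite {1}(ex (e a x *m B)) ip_sumr; apply: eq_bigr => i _; rewrite ipZr.
rewrite exchange_big /=; apply/esym.
transitivity (\sum_a \sum_i ip g x (e a x *m B) (e i x) * ip g x (e i x *m N) (e a x)).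
  apply: eq_bigr => a _; rewrite {1}(ex (e a x *m B)) mulmx_suml ip_suml.
  by apply: eq_bigr => i _; rewrite -scalemxAl ipZl.
apply: eq_bigr => a _; apply: eq_bigr => i _.
by rewrite coord_grad_sym.
Qed.

(** The covariant derivatives q_a of an orthonormal frame have antisymmetric
    components, which are paired here with symmetric ones. *)
Lemma trace_skew (q : 'I_n -> 'rV[R]_n) :
  (forall a a', ip g x (q a) (e a' x) + ip g x (e a x) (q a') = 0) ->
  \sum_a ip g x (e a x *m N) (q a) + \sum_a ip g x (q a *m N) (e a x) = 0.
Proof.
move=> skew; have ex w := frame_expand eon w Ux.
have -> : \sum_a ip g x (e a x *m N) (q a) =
   \sum_a \sum_i ip g x (q a) (e i x) * ip g x (e a x *m N) (e i x).
  by apply: eq_bigr => a _; rewrite {1}(ex (q a)) ip_sumr; apply: eq_bigr => i _; rewrite ipZr.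
have -> : \sum_a ip g x (q a *m N) (e a x) =
   \sum_a \sum_i ip g x (q a) (e i x) * ip g x (e i x *m N) (e a x).
  apply: eq_bigr => a _; rewrite {1}(ex (q a)) mulmx_suml ip_suml.
  by apply: eq_bigr => i _; rewrite -scalemxAl ipZl.
rewrite [X in _ + X]exchange_big /= -big_split big1 // => a _ /=.
rewrite -big_split big1 // => i _ /=.
by rewrite -mulrDl [X in _ + X](ipC gsym) // skew mul0r.
Qed.

(** Differentiate the inner product of the field with e_a, written by means of
    [ip_contracted_d]; the terms that pair nabla_Z u with nabla_(e_a) e_a cancel. *)
Lemma divergence_term a :
  ip g x (D (e a) contracted_d x) (e a x) =
  ip g x (D (e a) (D (e a) u) x - D (D (e a) (e a)) u x) (Z x)
  + ip g x (e a x *m N) (e a x *m B) - ip g x (D (e a) (D Z u) x) (e a x).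
Proof.
have sDe := lc_smooth lc (se a) su; have sDZ := lc_smooth lc sZ su.
have sDee := lc_smooth lc (se a) (se a).
have m1 := lc_metric lc (se a) smooth_contracted_d (se a) Ux.
have m2 := lc_metric lc (se a) sDe sZ Ux.
have m3 := lc_metric lc (se a) sDZ (se a) Ux.
have s2 := smooth_differentiable (smooth_ip sDe sZ) Ux.
have s3 := smooth_differentiable (smooth_ip sDZ (se a)) Ux.
have E : ddir (e a) (fun y => ip g y (contracted_d y) (e a y)) x =
   ddir (e a) (fun y => ip g y (D (e a) u y) (Z y)) x
   - ddir (e a) (fun y => ip g y (D Z u y) (e a y)) x.
  rewrite {2 3}/ddir -(derive_opp _ s3) -(derive_add _ s2 (differentiableN s3)).
  apply: (derive_near _ oU Ux) => y Uy.
  by rewrite (ip_contracted_d _ Uy) -(dn (se a) Uy) -(dn sZ Uy).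
have V2 := ip_contracted_d (D (e a) (e a) x) Ux.
rewrite -(dn sDee Ux) -(dn sZ Ux) in V2.
have n1 := conn_nabla oU lc (se a) sZ Ux; have n2 := dn (se a) Ux.
rewrite n1 n2 in m2; rewrite V2 in m1.
have b1 := ipBl g x (D (e a) (D (e a) u) x) (D (D (e a) (e a)) u x) (Z x).
rewrite b1; apply: (solve_divergence_term (t := ip g x (D Z u x) (D (e a) (e a) x))).
by rewrite -m2 -m3 -E -m1.
Qed.

(** Commute the two covariant derivatives; the bracket is the difference of nabla Z
    and nabla e_a by torsion freeness. *)
Lemma curvature_term a :
  ip g x (D (e a) (D Z u) x) (e a x) =
  riemann D g (e a) Z u (e a) x
  + ddir Z (fun y => ip g y (D (e a) u y) (e a y)) x
  - (ip g x (e a x *m N) (D Z (e a) x) + ip g x (D Z (e a) x *m N) (e a x))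
  + ip g x (e a x *m B *m N) (e a x).
Proof.
have sDe := lc_smooth lc (se a) su.
have m1 := lc_metric lc sZ sDe (se a) Ux.
have sbr := smooth_bracket oU (se a) sZ.
have n1 := dn sbr Ux; have n2 := dn (se a) Ux.
have n3 := conn_nabla oU lc (se a) sZ Ux.
rewrite -(lc_torsion_free lc (se a) sZ Ux) n3 mulmxBl in n1.
rewrite n2 in m1; have m1' := canRL (addrK _) (esym m1).
have br := ipBl g x (D (e a) (D Z u) x - D Z (D (e a) u) x) (D (bracket (e a) Z) u x) (e a x).
have bs := ipBl g x (D (e a) (D Z u) x) (D Z (D (e a) u) x) (e a x).
have bn := ipBl g x (e a x *m B *m N) (D Z (e a) x *m N) (e a x).
by rewrite /riemann br bs m1' n1 bn; exact: solve_curvature_term.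
Qed.

Hypothesis Hric : ricci D g e Z u x = \sum_j Z x 0 j * ricci D g e u (c j) x.

(** Sum the two preceding formulas over the frame: [trace_swap] removes the terms
    with the derivative of Z and [trace_skew] those with the derivatives of the
    frame. *)
Lemma divergence_contracted_d :
  divergence D g e contracted_d x =
  - ip g x (bochner D e u x) (Z x) - ricci D g e Z u x - ddir Z (divergence D g e u) x.
Proof.
have sdiv a := smooth_differentiable (smooth_ip (lc_smooth lc (se a) su) (se a)) Ux.
have E a : ip g x (D (e a) contracted_d x) (e a x) =
  ip g x (D (e a) (D (e a) u) x - D (D (e a) (e a)) u x) (Z x)
  + (ip g x (e a x *m N) (e a x *m B) - ip g x (e a x *m B *m N) (e a x))
  + (ip g x (e a x *m N) (D Z (e a) x) + ip g x (D Z (e a) x *m N) (e a x))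
  - riemann D g (e a) Z u (e a) x
  - ddir Z (fun y => ip g y (D (e a) u y) (e a y)) x.
  rewrite divergence_term curvature_term; exact: rearrange_contracted_d.
rewrite {1}/divergence (eq_bigr _ (fun a _ => E a)) !big_split /= !sumrN.
have -> : ddir Z (divergence D g e u) x = \sum_a ddir Z (fun y => ip g y (D (e a) u y) (e a y)) x.
  exact: derive_bigsum.
congr (_ - _); congr (_ - _); rewrite trace_swap subrr addr0 trace_skew; last first.
  (* The inner products of the frame are constant, so their derivatives along Z
     vanish. *)
  move=> a a'; rewrite -(lc_metric lc sZ (se a) (se a') Ux).
  rewrite -(derive_cst ((a == a')%:R : R) x (Z x)).
  by apply: (derive_near _ oU Ux) => y Uy; exact: eon.
by rewrite addr0 /bochner ipNl ip_suml opprK.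
Qed.

Lemma ip_coord_grad_r w : ip g x w (Z x) = w 0 m.
Proof. by rewrite (ipC gsym) // ip_coord_grad. Qed.

Variables (ds1 : form1 R n -> form0 R n) (ds2 : form2 R n -> form1 R n).
Hypotheses (ads1 : formal_adjoint_d0 U g ds1) (ads2 : formal_adjoint_d1 U g ds2).

(** The derivative of the divergence of u along [coord_grad] occurs in d d^* u and,
    with the opposite sign, in d^* d u. *)
Lemma hodge_component :
  hodge g ds1 ds2 u x 0 m = (bochner D e u x + Ric D g e u x) 0 m.
Proof.
have gZ w : (w *m invmx (g x)) 0 m = \sum_j w 0 j * Z x 0 j.
  rewrite mxE; apply: eq_bigr => j _; congr (_ * _).
  by rewrite /coord_grad -rowE mxE -{1}(metric_inv_sym gsym Ux) mxE.
rewrite /hodge /sharp mulmxDl mxE [RHS]mxE.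
rewrite (codiff2 oU sg gsym lc se eon m ads2 smooth_d1 (fun y _ => d1_antisym y) Ux).
have dd : differentiable (divergence D g e u) x.
  by apply: differentiable_bigsum => a; exact: smooth_differentiable (smooth_ip (lc_smooth lc (se a) su) (se a)) Ux.
have -> : (d0 (ds1 (flat g u)) x *m invmx (g x)) 0 m = - ddir Z (divergence D g e u) x.
  rewrite gZ /ddir (derive_delta _ dd) -sumrN; apply: eq_bigr => j _.
  rewrite mxE -[_ *: _]/(_ * _) mulrC -mulrN; congr (_ * _).
  rewrite -(derive_opp _ dd); apply: (derive_near _ oU Ux) => y Uy.
  exact: (codiff_flat oU sg gsym lc se eon ads1 su Uy).
have -> : Ric D g e u x 0 m = ricci D g e Z u x.
  by rewrite /Ric /sharp gZ Hric; apply: eq_bigr => j _; rewrite mxE mulrC.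
rewrite -[X in _ + - X]/(divergence D g e contracted_d x) divergence_contracted_d ip_coord_grad_r.
exact: rearrange_hodge.
Qed.

End Weitzenboeck.

(** * Fields along a chart of a submanifold *)

Section LocalSetting.
Variables (R : realType) (n k : nat).
Variables (M : set 'rV[R]_(n + k)) (p : 'rV[R]_(n + k)) (O : set 'rV[R]_(n + k)).
Variables (U : set 'rV[R]_n) (phi : 'rV[R]_n -> 'rV[R]_(n + k)) (x0 : 'rV[R]_n).
Variables (E : 'I_n -> vfield R (n + k)) (N : 'I_k -> vfield R (n + k)) (v : vfield R (n + k)).
Hypothesis ls : local_setting M p O U phi x0 E N v.
Local Notation g := (induced_metric phi).
Local Notation J := (jacobian phi).
Local Notation tang := (tangent_projector phi).
Local Notation push := (push phi).
Local Notation sff := (second_ff phi).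
Local Notation e := (fun i => pull phi (E i)).
Local Notation u := (pull phi v).
Local Notation F := (full_frame E N).

Let oU : open U. Proof. by have [] := ls_chart ls. Qed.
Let sphi : smooth U phi. Proof. by have [] := ls_chart ls. Qed.
Let fJ x : U x -> row_free (J x). Proof. by have [_ _ + _] := ls_chart ls; apply. Qed.
Let Ux0 : U x0. Proof. by have [] := ls_base ls. Qed.
Let phi0 : phi x0 = p. Proof. by have [] := ls_base ls. Qed.
Let oO : open O. Proof. by have [] := ls_nbhd ls. Qed.
Let UO x : U x -> O (phi x).
Proof. by move=> Ux; have [_] := ls_nbhd ls; apply; exists x. Qed.
Let Op : O p. Proof. by rewrite -phi0; exact: UO. Qed.

Lemma ls_smooth_E i : smooth O (E i). Proof. exact: (ls_frame_smooth ls (inl i)). Qed.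
Lemma ls_smooth_N l : smooth O (N l). Proof. exact: (ls_frame_smooth ls (inr l)). Qed.

Lemma smooth_along (A : vfield R (n + k)) : smooth O A -> smooth U (fun x => A (phi x)).
Proof. by move=> sA; apply: (smooth_comp oU oO UO sphi sA). Qed.

Lemma push_pull X x : U x -> (X (phi x) <= tangent phi x)%MS -> push x (pull phi X x) = X (phi x).
Proof. by move=> Ux; rewrite genmxE => XJ; rewrite /Defs.push /pull mulmxKpV. Qed.

Lemma smooth_pull X : smooth O X -> (forall x, U x -> (X (phi x) <= tangent phi x)%MS) ->
  smooth U (pull phi X).
Proof.
move=> sX tX; apply: (@smooth_ext _ _ _ oU _ (fun x => X (phi x) *m pull_mx phi x)) => [x Ux|].
  by have := tX x Ux; rewrite genmxE => h; rewrite /pull (pinv_tangent (fJ Ux) h).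
apply: (smooth_mulmx oU (smooth_along sX)); exact: smooth_pull_mx oU sphi fJ.
Qed.

Lemma ls_smooth_e i : smooth U (e i).
Proof. by apply: smooth_pull; [exact: ls_smooth_E|exact: (ls_tangent ls)]. Qed.
Lemma ls_smooth_u : smooth U u.
Proof. by apply: smooth_pull; [exact: (ls_field_smooth ls)|exact: (ls_field_tangent ls)]. Qed.

Lemma push_e i x : U x -> push x (e i x) = E i (phi x).
Proof. by move=> Ux; apply: push_pull => //; exact: (ls_tangent ls). Qed.
Lemma push_u x : U x -> push x (u x) = v (phi x).
Proof. by move=> Ux; apply: push_pull => //; exact: (ls_field_tangent ls). Qed.

Lemma frame_dot q a b : O q -> dot (F a q) (F b q) = (a == b)%:R.
Proof. by move=> Oq; rewrite -(ls_orthonormal ls Oq a b) euclid_ip. Qed.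

Lemma e_orthonormal x : U x -> forall a b, ip g x (e a x) (e b x) = (a == b)%:R.
Proof.
move=> Ux a b; rewrite ip_g -[_ *m J x]/(push x _) -[_ *m J x]/(push x (e b x)).
by rewrite (push_e a Ux) (push_e b Ux) (frame_dot (inl a) (inl b) (UO Ux)).
Qed.

Lemma N_normal l x : U x -> N l (phi x) *m tang x = 0.
Proof.
by move=> Ux; apply/eqP; rewrite -(normal_Pi (fJ Ux)); exact: (ls_normal ls).
Qed.

Lemma tprojE x w : U x -> tproj phi x w = w *m tang x.
Proof. by move=> Ux; exact: (proj_tangentE (fJ Ux)). Qed.
Lemma nprojE x w : U x -> nproj phi x w = w - w *m tang x.
Proof. by move=> Ux; exact: (proj_normalE (fJ Ux)). Qed.

Lemma tang_eq (A B : 'rV[R]_(n + k)) x : U x -> A *m tang x = A -> B *m tang x = B ->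
  (forall z, dot A (push x z) = dot B (push x z)) -> A = B.
Proof.
move=> Ux tA tB h; apply: dot_nondeg => y.
by rewrite -tA -tB !dot_tang /tangent_projector mulmxA; exact: h.
Qed.

Lemma push_tangent x w : U x -> push x w *m tang x = push x w.
Proof. by move=> Ux; exact: (push_tang fJ). Qed.

Lemma tproj_tang x w : U x -> tproj phi x w *m tang x = tproj phi x w.
Proof. by move=> Ux; rewrite tprojE // -mulmxA (tang_idem fJ Ux). Qed.

Lemma dot_tproj x w z : U x -> dot (tproj phi x w) (push x z) = dot w (push x z).
Proof. by move=> Ux; rewrite tprojE // dot_tang push_tangent. Qed.

(** A derivative in a tangent direction only depends on the values along M. *)
Lemma chain_dir (W : normedModType R) (A : 'rV[R]_(n + k) -> W) x w : smooth O A -> U x ->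
  'D_(push x w) A (phi x) = 'D_w (fun y => A (phi y)) x.
Proof.
move=> sA Ux; have dphi := smooth_differentiable sphi Ux.
have dA := smooth_differentiable sA (UO Ux).
have -> : push x w = 'D_w phi x by rewrite (deriveEjacobian _ dphi).
by rewrite (derive_comp _ dphi dA).
Qed.

Lemma ddir_along (xi : vfield R n) X (A : vfield R (n + k)) x : smooth O A -> U x ->
  push x (xi x) = X (phi x) -> ddir X A (phi x) = ddir xi (fun y => A (phi y)) x.
Proof. by move=> sA Ux eX; rewrite /ddir -eX chain_dir. Qed.

(** Along M the extended field is the push forward of its components in the chart.
    *)
Lemma ddir_v_along (xi : vfield R n) X x : U x -> push x (xi x) = X (phi x) ->
  ddir X v (phi x) = ddir xi (fun y => push y (u y)) x.
Proof.
move=> Ux eX; rewrite (ddir_along (ls_field_smooth ls) Ux eX).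
by apply: (derive_near _ oU Ux) => y Uy; rewrite push_u.
Qed.

Lemma ddir_E_along i x : U x ->
  ddir (E i) (E i) (phi x) = ddir (e i) (fun y => push y (e i y)) x.
Proof.
move=> Ux; rewrite (ddir_along (ls_smooth_E i) Ux (push_e i Ux)).
by apply: (derive_near _ oU Ux) => y Uy; rewrite push_e.
Qed.

(** The normal part of D_(E_i) E_i is read off from the Gauss formula. *)
Lemma mean_curvatureE x : U x ->
  mean_curvature phi E x = n%:R^-1 *: \sum_i sff x (e i x) (e i x).
Proof.
move=> Ux; rewrite /mean_curvature; congr (_ *: _); apply: eq_bigr => i _.
rewrite /second_form nprojE // (ddir_E_along i Ux).
rewrite (gauss_formula oU sphi fJ (e i) Ux (ls_smooth_e i)).
by rewrite mulmxDl push_tangent // (sff_normal fJ) // addr0 addrC addKr.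
Qed.

Lemma weingarten_tang eta w : weingarten phi eta x0 w *m tang x0 = weingarten phi eta x0 w.
Proof. by rewrite /weingarten mulNmx tproj_tang. Qed.

Lemma weingarten_push eta w : exists om, weingarten phi eta x0 w = push x0 om.
Proof.
exists (weingarten phi eta x0 w *m pull_mx phi x0).
by rewrite -{1}weingarten_tang /tangent_projector mulmxA.
Qed.

(** This is the duality of the Weingarten map and the second fundamental form, for
    normal fields that are extended to the ambient neighborhood. *)
Lemma dot_weingarten eta w z : smooth O eta -> (forall x, U x -> eta (phi x) *m tang x = 0) ->
  dot (weingarten phi eta x0 (push x0 w)) (push x0 z) = dot (eta p) (sff x0 w z).
Proof.
move=> se neta; rewrite /weingarten dotNl dot_tproj // chain_dir //.
rewrite (dot_derive_normal oU sphi fJ) ?opprK ?phi0 //.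
exact: smooth_differentiable (smooth_along se) Ux0.
Qed.

(** The full frame is an orthonormal basis, and the part of it that is tangent does
    not contribute. *)
Lemma normal_expand x w : U x -> w *m tang x = 0 ->
  w = \sum_l dot w (N l (phi x)) *: N l (phi x).
Proof.
move=> Ux nw.
pose Q : 'M[R]_(n + k) := \matrix_(j < n + k) F (fintype.split j) (phi x).
have QQ : Q *m Q^T = 1%:M.
  apply/matrixP => i j; rewrite [RHS]mxE.
  transitivity (dot (F (fintype.split i) (phi x)) (F (fintype.split j) (phi x))).
    by rewrite dotE mxE; apply: eq_bigr => l _; rewrite !mxE.
  by rewrite (frame_dot _ _ (UO Ux)) (can_eq splitK).
transitivity (\sum_j dot w (F (fintype.split j) (phi x)) *: F (fintype.split j) (phi x)).
  rewrite -{1}[w]mulmx1 -(mulmx1C QQ) mulmxA mulmx_sum_row.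
  apply: eq_bigr => j _; rewrite rowK; congr (_ *: _).
  by rewrite dotE mxE; apply: eq_bigr => l _; rewrite !mxE.
rewrite big_split_ord /= big1 ?add0r => [|i _].
  by apply: eq_bigr => l _; rewrite [fintype.split _](unsplitK (inr l)).
rewrite [fintype.split _](unsplitK (inl i)) /= -(push_e i Ux).
by rewrite (dot_normal_push fJ) // scale0r.
Qed.

End LocalSetting.

(** * The identities in arbitrary codimension *)

Lemma rearrange_bochner (R : realFieldType) (a b c d : R) :
  - (a - b - (c + d)) = - (a - c) + b + d.
Proof. by lra. Qed.

Lemma rearrange_ricci (R : realFieldType) m (c : R) (a s h d : 'rV[R]_m) :
  a + s + c *: h = a - (c *: - d - s) + c *: (h - d).
Proof. by apply/rowP => i; rewrite !mxE; lra. Qed.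

Lemma rearrange_hodge_identity (R : realFieldType) m (c : R) (a s h w : 'rV[R]_m) :
  a + s + c *: h = a + (c *: w - s) + 2%:R *: s + c *: h - c *: w.
Proof. by apply/rowP => i; rewrite !mxE; lra. Qed.

Section GeneralCodimension.
Variables (R : realType) (n k : nat).
Variables (M : set 'rV[R]_(n + k)) (p : 'rV[R]_(n + k)) (O : set 'rV[R]_(n + k)).
Variables (U : set 'rV[R]_n) (phi : 'rV[R]_n -> 'rV[R]_(n + k)) (x0 : 'rV[R]_n).
Variables (E : 'I_n -> vfield R (n + k)) (N : 'I_k -> vfield R (n + k)) (v : vfield R (n + k)).
Hypothesis ls : local_setting M p O U phi x0 E N v.
Local Notation g := (induced_metric phi).
Local Notation J := (jacobian phi).
Local Notation tang := (tangent_projector phi).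
Local Notation push := (push phi).
Local Notation sff := (second_ff phi).
Local Notation e := (fun i => pull phi (E i)).
Local Notation u := (pull phi v).
Local Notation F := (full_frame E N).
Local Notation T := (tproj phi x0).
Local Notation P := (Defs.push phi x0).
Local Notation W := (fun eta => weingarten phi eta x0).

Let oU : open U. Proof. by have [] := ls_chart ls. Qed.
Let sphi : smooth U phi. Proof. by have [] := ls_chart ls. Qed.
Let fJ x : U x -> row_free (J x). Proof. by have [_ _ + _] := ls_chart ls; apply. Qed.
Let Ux0 : U x0. Proof. by have [] := ls_base ls. Qed.
Let phi0 : phi x0 = p. Proof. by have [] := ls_base ls. Qed.
Let oO : open O. Proof. by have [] := ls_nbhd ls. Qed.
Let UO x : U x -> O (phi x).
Proof. by move=> Ux; have [_] := ls_nbhd ls; apply; exists x. Qed.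
Let Op : O p. Proof. by rewrite -phi0; exact: UO. Qed.
Let se i : smooth U (e i) := ls_smooth_e ls i.
Let su : smooth U u := ls_smooth_u ls.

Variable D : connection R n.
Hypothesis lc : levi_civita U g D.

Let tangent_eq A B := @tang_eq _ _ _ U phi A B x0 Ux0.

Let T_tang w : T w *m tang x0 = T w. Proof. exact: (tproj_tang ls). Qed.
Let P_tang w : P w *m tang x0 = P w. Proof. exact: (push_tangent ls). Qed.
Lemma tprojD a b : T (a + b) = T a + T b. Proof. exact: mulmxDl. Qed.
Lemma tprojN a : T (- a) = - T a. Proof. exact: mulNmx. Qed.
Lemma tprojB a b : T (a - b) = T a - T b. Proof. exact: mulmxBl. Qed.
Lemma tprojZ c a : T (c *: a) = c *: T a. Proof. by rewrite /tproj scalemxAl. Qed.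
Lemma tproj_sum (I : finType) (a : I -> 'rV[R]_(n + k)) : T (\sum_i a i) = \sum_i T (a i).
Proof. exact: mulmx_suml. Qed.
Lemma pushD a b : P (a + b) = P a + P b. Proof. exact: mulmxDl. Qed.

Lemma dot_push a b : dot (P a) (P b) = ip g x0 a b.
Proof. by rewrite ip_g. Qed.

Lemma induced_metric_sym x : U x -> (g x)^T = g x. Proof. by move=> _; exact: gram_sym. Qed.
Let sg : smooth U g := smooth_induced_metric oU sphi.
Let eon := e_orthonormal ls.

(** The inner product with z of the sum over l of W_l W_l v, as [dot_WW] shows. *)
Definition sff_square z := \sum_i dot (sff x0 (e i x0) (u x0)) (sff x0 (e i x0) z).

Definition tangential_bochner : 'rV[R]_(n + k) :=
  - \sum_i (ddir (E i) (ddir (E i) v) p - ddir (ddir (E i) (E i)) v p).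

Definition normal_terms : 'rV[R]_(n + k) :=
  \sum_l T (ddir (N l) (ddir (N l) v) p - ddir (ddir (N l) (N l)) v p).

Lemma bochner_split : T (bochner (@ddir R _ _) F v p) = T tangential_bochner - normal_terms.
Proof.
rewrite /bochner big_sumType /= opprD tprojD.
by apply: (congr1 (fun t => T _ + t)); rewrite tprojN tproj_sum.
Qed.

Lemma smooth_ddirE i : smooth O (ddir (E i) v).
Proof. by apply: (smooth_ddir oO); [exact: (ls_smooth_E ls)|exact: (ls_field_smooth ls)]. Qed.

Lemma dot_ddir2 i z :
  dot (ddir (E i) (ddir (E i) v) p) (P z) =
  ip g x0 (D (e i) (D (e i) u) x0) z
  - dot (sff x0 (e i x0) (u x0)) (sff x0 (e i x0) z).
Proof.
have h := ip_conn2 oU sphi fJ lc z (se i) (se i) su Ux0.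
rewrite (canLR (addrK _) h) -phi0.
rewrite (ddir_along ls (smooth_ddirE i) Ux0 (push_e ls i Ux0)).
apply: (congr1 (fun t => dot t _)).
by apply: (derive_near _ oU Ux0) => y Uy; rewrite (ddir_v_along ls Uy (push_e ls i Uy)).
Qed.

Lemma dot_ddir1 i z :
  dot (ddir (ddir (E i) (E i)) v p) (P z) =
  ip g x0 (D (D (e i) (e i)) u x0) z + dot ('D_(sff x0 (e i x0) (e i x0)) v p) (P z).
Proof.
have sDe := lc_smooth lc (se i) (se i).
rewrite (ip_conn oU sphi fJ lc z sDe su Ux0) -dotDl; congr (dot _ _).
have dv : differentiable v (phi x0).
  exact: smooth_differentiable (ls_field_smooth ls) (UO Ux0).
have -> : ddir (ddir (E i) (E i)) v p
    = 'D_(push x0 (D (e i) (e i) x0) + sff x0 (e i x0) (e i x0)) v (phi x0).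
  rewrite /ddir -phi0; congr ('D_ _ v _); apply: (etrans (ddir_E_along ls i Ux0)).
  by rewrite (push_conn oU sphi fJ lc (se i) (se i) Ux0) subrK.
rewrite (derive_linD _ _ dv) -phi0; congr (_ + _).
exact: (ddir_v_along ls (xi := D (e i) (e i)) (X := fun _ => push x0 (D (e i) (e i) x0)) Ux0).
Qed.

(** In D_(D_(E_i) E_i) v the direction splits into a tangent part, which belongs to
    the Laplacian of M, and II(e_i, e_i); the square of the second fundamental form
    comes from [ip_conn2]. *)
Lemma dot_tangential_bochner z :
  dot tangential_bochner (P z) =
  ip g x0 (bochner D e u x0) z + sff_square z
  + dot ('D_(\sum_i sff x0 (e i x0) (e i x0)) v p) (P z).
Proof.
rewrite /tangential_bochner dotNl dot_suml /bochner ipNl ip_suml /sff_square.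
have dv : differentiable v p by exact: smooth_differentiable (ls_field_smooth ls) Op.
have -> : 'D_(\sum_i sff x0 (e i x0) (e i x0)) v p = \sum_i 'D_(sff x0 (e i x0) (e i x0)) v p.
  by rewrite (deriveE _ dv) linear_sum; apply: eq_bigr => i _; rewrite (deriveE _ dv).
rewrite dot_suml -!sumrN -!big_split; apply: eq_bigr => i _ /=.
rewrite dotBl (dot_ddir2 i z) (dot_ddir1 i z) ipBl; exact: rearrange_bochner.
Qed.

Lemma dot_N_sff l z : dot (W (N l) (W (N l) (v p))) (P z) =
  \sum_i dot (sff x0 (e i x0) (u x0)) (N l p) * dot (sff x0 (e i x0) z) (N l p).
Proof.
have sN := ls_smooth_N ls l; have nN x := @N_normal _ _ _ _ _ _ _ _ _ _ _ _ ls l x.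
have [om eom] := weingarten_push ls (N l) (v p).
rewrite eom (dot_weingarten ls om z sN nN).
rewrite (frame_expand eon om Ux0) (sff_suml oU sphi) // dot_sumr; apply: eq_bigr => i _.
rewrite (sff_scalel oU sphi) // dotZr [dot (sff _ _ z) _]dotC; congr (_ * _).
rewrite -dot_push -eom -phi0 -(push_u ls Ux0) (dot_weingarten ls _ _ sN nN) dotC.
by rewrite (sff_sym oU sphi (u x0) (e i x0) Ux0) phi0.
Qed.

(** Expand the tangent vector W_l v in the frame e_i and sum over the normal frame.
    *)
Lemma dot_WW z : dot (\sum_l W (N l) (W (N l) (v p))) (P z) = sff_square z.
Proof.
rewrite dot_suml (eq_bigr _ (fun l _ => dot_N_sff l z)) exchange_big /=.
apply: eq_bigr => i _.
rewrite {2}(normal_expand ls Ux0 (sff_normal fJ (e i x0) z Ux0)) phi0 dot_sumr.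
by apply: eq_bigr => l _; rewrite dotZr mulrC.
Qed.

Variable H : vfield R (n + k).
Hypotheses (sH : smooth O H) (eH : forall x, U x -> H (phi x) = mean_curvature phi E x).
Hypothesis n_gt0 : (0 < n)%N.

Lemma mean_curvature_trace x : U x -> n%:R *: H (phi x) = \sum_i sff x (e i x) (e i x).
Proof.
move=> Ux; rewrite eH // (mean_curvatureE ls Ux) scalerA mulfV ?scale1r //.
by rewrite pnatr_eq0 -lt0n.
Qed.

Lemma mean_curvature_normal x : U x -> H (phi x) *m tang x = 0.
Proof.
move=> Ux; rewrite eH // (mean_curvatureE ls Ux) -scalemxAl mulmx_suml big1 ?scaler0 // => i _.
exact: (sff_normal fJ).
Qed.

(** Inner products with pushed forward vectors suffice: both sides are tangent, the
    Weingarten maps being defined with a tangential projection. *)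
Lemma bochner_identity :
  T (bochner (@ddir R _ _) F v p) =
  P (bochner D e u x0) + \sum_l W (N l) (W (N l) (v p)) + n%:R *: T (ddir H v p) - normal_terms.
Proof.
rewrite bochner_split; congr (_ - _).
apply: tangent_eq.
- exact: T_tang.
- rewrite !mulmxDl P_tang -scalemxAl T_tang mulmx_suml; congr (_ + _ + _).
  by apply: eq_bigr => l _; exact: (weingarten_tang ls).
move=> z; rewrite (dot_tproj ls _ _ Ux0) dot_tangential_bochner !dotDl dot_push dot_WW.
congr (_ + _); rewrite dotZl (dot_tproj ls _ _ Ux0) -dotZl; congr (dot _ _).
have dv : differentiable v p by exact: smooth_differentiable (ls_field_smooth ls) Op.
by rewrite /ddir -(derive_linZ _ _ dv) -phi0 mean_curvature_trace.
Qed.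

Lemma dot_WH z : n%:R * dot (W H (v p)) (P z) =
  \sum_i dot (sff x0 (e i x0) (e i x0)) (sff x0 (u x0) z).
Proof.
rewrite -phi0 -(push_u ls Ux0) (dot_weingarten ls _ _ sH mean_curvature_normal) -dotZl -phi0 (mean_curvature_trace Ux0).
exact: dot_suml.
Qed.

Lemma ricci_sff X Y : smooth U X -> smooth U Y -> ricci D g e X Y x0 =
  \sum_i (dot (sff x0 (X x0) (Y x0)) (sff x0 (e i x0) (e i x0))
          - dot (sff x0 (e i x0) (Y x0)) (sff x0 (X x0) (e i x0))).
Proof.
move=> sX sY; apply: eq_bigr => i _.
exact: (gauss_equation oU sphi fJ lc (e i) (se i) sX sY Ux0).
Qed.

(** The Ricci form is only given on coordinate fields; by the Gauss equation it is
    linear in the second argument. *)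
Lemma ricci_expand X (z : 'rV[R]_n) : smooth U X -> \sum_j z 0 j * ricci D g e X (coord_field j) x0 =
  \sum_i (dot (sff x0 (X x0) z) (sff x0 (e i x0) (e i x0))
          - dot (sff x0 (e i x0) z) (sff x0 (X x0) (e i x0))).
Proof.
move=> sX; have sc j := smooth_coord_field oU j.
rewrite (eq_bigr _ (fun j _ => congr1 (fun t => z 0 j * t) (ricci_sff sX (sc j)))).
under eq_bigr => j _ do rewrite mulr_sumr.
rewrite exchange_big /=; apply: eq_bigr => i _.
have sz a : sff x0 a z = \sum_j z 0 j *: sff x0 a (delta_mx 0 j).
  rewrite {1}(rV_delta z) (sff_sym oU sphi a _ Ux0) (sff_suml oU sphi _ a Ux0).
  apply: eq_bigr => j _; rewrite (sff_scalel oU sphi _ _ _ Ux0).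
  by rewrite (sff_sym oU sphi (delta_mx 0 j) a Ux0).
move: (sff x0) (X x0) (pull phi (E i) x0) sz => f a b sz.
rewrite (sz a) (sz b) !dot_suml -sumrB; apply: eq_bigr => j _.
by rewrite !dotZl mulrBr.
Qed.

(** The trace of the Gauss equation: the first term contains sum_i II(e_i, e_i) = n
    H, the second is [sff_square]. *)
Lemma ricci_identity :
  P (Ric D g e u x0) = n%:R *: W H (v p) - \sum_l W (N l) (W (N l) (v p)).
Proof.
apply: tangent_eq.
- exact: P_tang.
- rewrite mulmxBl -scalemxAl (weingarten_tang ls) mulmx_suml; congr (_ - _).
  by apply: eq_bigr => l _; exact: (weingarten_tang ls).
move=> z; rewrite dotBl dotZl dot_WH dot_WW dot_push.
have -> : ip g x0 (Ric D g e u x0) z = \sum_j z 0 j * ricci D g e u (coord_field j) x0.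
  rewrite /ip /Ric /sharp mulmxKV ?(induced_metric_unit fJ) // mxE.
  by apply: eq_bigr => j _; rewrite !mxE mulrC.
apply: (etrans (ricci_expand z su)); rewrite /sff_square -sumrB; apply: eq_bigr => i _.
apply: (congr2 (fun a b => a - b)); first exact: dotC.
by rewrite (sff_sym oU sphi (u x0) (e i x0) Ux0); exact: dotC.
Qed.

Variables (ds1 : form1 R n -> form0 R n) (ds2 : form2 R n -> form1 R n).
Hypotheses (ads1 : formal_adjoint_d0 U g ds1) (ads2 : formal_adjoint_d1 U g ds2).

Lemma weitzenboeck : hodge g ds1 ds2 u x0 = bochner D e u x0 + Ric D g e u x0.
Proof.
apply/rowP => m; apply: (hodge_component oU sg induced_metric_sym lc se eon su Ux0 _ ads1 ads2).
have sZ := smooth_coord_grad oU sg eon m.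
apply: (etrans (ricci_sff sZ su)).
apply: (etrans _ (esym (ricci_expand (coord_grad g m x0) su))).
apply: eq_bigr => i _; apply: (congr2 (fun a b => a - b)).
  by rewrite (sff_sym oU sphi (coord_grad g m x0) (u x0) Ux0).
rewrite (sff_sym oU sphi (e i x0) (coord_grad g m x0) Ux0) (sff_sym oU sphi (u x0) (e i x0) Ux0).
exact: dotC.
Qed.

Lemma bochner_ricci_identity :
  T (bochner (@ddir R _ _) F v p) =
  P (bochner D e u x0) - P (Ric D g e u x0) + n%:R *: T (bracket H v p) - normal_terms.
Proof.
rewrite bochner_identity; congr (_ - _); rewrite ricci_identity.
have -> : W H (v p) = - T ('D_(v p) H p) by rewrite /weingarten phi0.
rewrite /bracket tprojB -/(ddir v H p).
exact: rearrange_ricci.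
Qed.

Lemma bochner_hodge_identity :
  T (bochner (@ddir R _ _) F v p) =
  P (hodge g ds1 ds2 u x0) + 2%:R *: \sum_l W (N l) (W (N l) (v p))
  + n%:R *: T (ddir H v p) - n%:R *: W H (v p) - normal_terms.
Proof.
rewrite bochner_identity; congr (_ - _); rewrite weitzenboeck pushD ricci_identity.
exact: rearrange_hodge_identity.
Qed.

Lemma dot_grad (h : 'rV[R]_n -> R) z : differentiable h x0 ->
  dot (P (grad g h x0)) (P z) = 'D_z h x0.
Proof.
move=> dh; rewrite dot_push (derive_delta _ dh) /ip /grad /sharp mulmxKV ?(induced_metric_unit fJ) // mxE.
by apply: eq_bigr => j _; rewrite !mxE mulrC.
Qed.

Lemma dot_grad_euclid (f : 'rV[R]_(n + k) -> R) w : differentiable f p ->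
  dot (grad (euclid (n := n + k)) f p) w = 'D_w f p.
Proof.
move=> df; rewrite (derive_delta _ df) /grad /sharp /euclid invmx1 mulmx1 dotE.
by apply: eq_bigr => j _; rewrite mxE mulrC.
Qed.

Let div_euclid (I : finType) (X : I -> vfield R (n + k)) : 'rV[R]_(n + k) -> R :=
  divergence (@ddir R _ _) (euclid (n := n + k)) X v.

Lemma smooth_div_euclid (I : finType) (X : I -> vfield R (n + k)) :
  (forall a, smooth O (X a)) -> smooth O (div_euclid X).
Proof.
move=> sX; apply: (smooth_sum oO) => a.
apply: (@smooth_ext _ _ _ oO _ (fun q => dot (ddir (X a) v q) (X a q))) => [q Oq|].
  by rewrite euclid_ip.
by apply: (smooth_dot oO) => //; apply: (smooth_ddir oO) => //; exact: (ls_field_smooth ls).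
Qed.

(** The tangent part of the frame yields the divergence on M, by the Gauss formula.
    *)
Lemma divergence_split x : U x ->
  div_euclid F (phi x) = divergence D g e u x + div_euclid N (phi x).
Proof.
move=> Ux; rewrite /div_euclid /divergence big_sumType /=; congr (_ + _).
apply: eq_bigr => i _; rewrite euclid_ip (ip_conn oU sphi fJ lc _ (se i) su Ux).
by rewrite (ddir_v_along ls Ux (push_e ls i Ux)) (push_e ls i Ux).
Qed.

(** A gradient is determined by its inner products with tangent vectors, that is by
    the derivatives of the function along M. *)
Lemma gradient_identity :
  T (grad (euclid (n := n + k)) (div_euclid F) p) =
  P (grad g (divergence D g e u) x0) + P (grad g (fun x => div_euclid N (phi x)) x0).
Proof.
have sF := smooth_div_euclid (ls_frame_smooth ls).
have sN := smooth_div_euclid (ls_smooth_N ls).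
have dN : differentiable (fun x => div_euclid N (phi x)) x0.
  apply: differentiable_comp; first exact: smooth_differentiable sphi Ux0.
  exact: smooth_differentiable sN (UO Ux0).
have dD : differentiable (divergence D g e u) x0.
  apply: differentiable_bigsum => i.
  by apply: smooth_differentiable (smooth_ip oU sg (lc_smooth lc (se i) su) (se i)) Ux0.
apply: tangent_eq; first exact: T_tang.
  by rewrite mulmxDl !P_tang.
move=> z; rewrite (dot_tproj ls _ _ Ux0) dotDl (dot_grad z dN) (dot_grad z dD).
rewrite (dot_grad_euclid _ (smooth_differentiable sF Op)) -phi0 (chain_dir ls _ sF Ux0).
rewrite -(derive_add _ dD dN); apply: (derive_near _ oU Ux0) => y Uy.
exact: divergence_split.
Qed.

Lemma bochner_grad_identity :
  T (bochner (@ddir R _ _) F v p + grad (euclid (n := n + k)) (div_euclid F) p) =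
  P (bochner D e u x0) - P (Ric D g e u x0) + P (grad g (divergence D g e u) x0)
  + n%:R *: T (bracket H v p) - normal_terms
  + P (grad g (fun x => div_euclid N (phi x)) x0).
Proof.
rewrite tprojD bochner_ricci_identity gradient_identity addrA; congr (_ + _).
by rewrite addrAC; congr (_ - _); rewrite addrAC.
Qed.

End GeneralCodimension.

(** * Hypersurfaces *)

Section Hypersurface.
Variables (R : realType) (n : nat).
Variables (M : set 'rV[R]_(n + 1)) (p : 'rV[R]_(n + 1)) (O : set 'rV[R]_(n + 1)).
Variables (U : set 'rV[R]_n) (phi : 'rV[R]_n -> 'rV[R]_(n + 1)) (x0 : 'rV[R]_n).
Variables (E : 'I_n -> vfield R (n + 1)) (N : vfield R (n + 1)) (v : vfield R (n + 1)).
Local Notation Ns := (fun _ : 'I_1 => N).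
Hypothesis ls : local_setting M p O U phi x0 E Ns v.
Local Notation g := (induced_metric phi).
Local Notation J := (jacobian phi).
Local Notation tang := (tangent_projector phi).
Local Notation push := (push phi).
Local Notation sff := (second_ff phi).
Local Notation e := (fun i => pull phi (E i)).
Local Notation u := (pull phi v).
Local Notation F := (full_frame E Ns).
Local Notation T := (tproj phi x0).
Local Notation P := (Defs.push phi x0).
Local Notation s := (weingarten phi N x0).
Local Notation div_euclid X := (divergence (@ddir R _ _) (euclid (n := n + 1)) X v).

Let oU : open U. Proof. by have [] := ls_chart ls. Qed.
Let sphi : smooth U phi. Proof. by have [] := ls_chart ls. Qed.
Let fJ x : U x -> row_free (J x). Proof. by have [_ _ + _] := ls_chart ls; apply. Qed.
Let Ux0 : U x0. Proof. by have [] := ls_base ls. Qed.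
Let phi0 : phi x0 = p. Proof. by have [] := ls_base ls. Qed.
Let oO : open O. Proof. by have [] := ls_nbhd ls. Qed.
Let UO x : U x -> O (phi x).
Proof. by move=> Ux; have [_] := ls_nbhd ls; apply; exists x. Qed.
Let Op : O p. Proof. by rewrite -phi0; exact: UO. Qed.
Let se i : smooth U (e i) := ls_smooth_e ls i.
Let su : smooth U u := ls_smooth_u ls.
Let sN : smooth O N := ls_smooth_N ls 0.
Let sv : smooth O v := ls_field_smooth ls.
Let dN q : O q -> differentiable N q. Proof. exact: smooth_differentiable sN. Qed.
Let dv q : O q -> differentiable v q. Proof. exact: smooth_differentiable sv. Qed.

Lemma N_unit q : O q -> dot (N q) (N q) = 1.
Proof. by move=> Oq; rewrite (frame_dot ls (inr 0) (inr 0) Oq) eqxx. Qed.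

(** A field of constant length is orthogonal to its derivatives. *)
Lemma dot_derive_unit q w : O q -> dot ('D_w N q) (N q) = 0.
Proof.
move=> Oq; have h := derive_dot w (dN Oq) (dN Oq).
have z : 'D_w (fun y => dot (N y) (N y)) q = 0.
  rewrite -(derive_cst (1 : R) q w); apply: (derive_near _ oO Oq) => y Oy.
  exact: N_unit.
have : dot ('D_w N q) (N q) *+ 2 == 0.
  by rewrite mulr2n {2}dotC -h z.
by rewrite mulrn_eq0 => /eqP.
Qed.

Lemma tangent_of_dot x w : U x -> dot w (N (phi x)) = 0 -> w *m tang x = w.
Proof.
move=> Ux wN; have nw : (w - w *m tang x) *m tang x = 0.
  by rewrite mulmxBl -mulmxA (tang_idem fJ Ux) subrr.
have := normal_expand ls Ux nw; rewrite big_ord1 dotBl wN dot_tang.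
rewrite (N_normal ls 0 Ux) dot0r subrr scale0r => /eqP.
by rewrite subr_eq0 => /eqP <-.
Qed.

Lemma tproj_id w : dot w (N p) = 0 -> T w = w.
Proof. by rewrite -phi0 => h; rewrite (tprojE ls) // tangent_of_dot. Qed.

Lemma tproj_normal : T (N p) = 0.
Proof. by rewrite (tprojE ls) // -phi0 (N_normal ls 0). Qed.

Definition scalar_mean_curvature q := n%:R^-1 * \sum_i dot (- ddir (E i) N q) (E i q).
(** The extension of the mean curvature vector along the extension of the unit
    normal. *)
Definition mean_curvature_field : vfield R (n + 1) := fun q => scalar_mean_curvature q *: N q.

Lemma smooth_scalar_mean_curvature : smooth O scalar_mean_curvature.
Proof.
apply: (smoothM oO); first by apply: smooth_cst; exact: oO.
apply: (smooth_sum oO) => i; apply: (smooth_dot oO); last exact: (ls_smooth_E ls).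
by apply: (smoothN oO); apply: (smooth_ddir oO) => //; exact: (ls_smooth_E ls).
Qed.

Lemma smooth_mean_curvature_field : smooth O mean_curvature_field.
Proof. by apply: (smoothZ oO) => //; exact: smooth_scalar_mean_curvature. Qed.

(** In codimension one II(e_i, e_i) is its component along N, which is found by
    differentiating the orthogonality of N and e_i. *)
Lemma mean_curvature_fieldE x : U x -> mean_curvature_field (phi x) = mean_curvature phi E x.
Proof.
move=> Ux; rewrite (mean_curvatureE ls Ux) /mean_curvature_field /scalar_mean_curvature -scalerA scaler_suml.
congr (_ *: _); apply: eq_bigr => i _.
rewrite [RHS](normal_expand ls Ux (sff_normal fJ (e i x) (e i x) Ux)) big_ord1; congr (_ *: _).
have dNphi := smooth_differentiable (smooth_along ls sN) Ux.
have nN y : U y -> N (phi y) *m tang y = 0 := fun Uy => N_normal ls 0 Uy.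
have h := dot_derive_normal oU sphi fJ (e i x) (e i x) Ux dNphi nN.
rewrite [RHS]dotC dotNl; apply: canLR (@opprK _) _; rewrite -h (push_e ls i Ux).
apply: (congr1 (fun t => dot t _)).
exact: (ddir_along ls (xi := e i) sN Ux (push_e ls i Ux)).
Qed.

(** Against tangent vectors the shape operator can be used without its projection.
    *)
Lemma scalar_mean_curvatureE : scalar_mean_curvature p = n%:R^-1 * \sum_i ip (euclid (n := n + 1)) p (s (E i p)) (E i p).
Proof.
congr (_ * _); apply: eq_bigr => i _.
rewrite euclid_ip /weingarten !dotNl phi0; congr (- _).
have tE : E i p *m tang x0 = E i p.
  by rewrite -phi0 -(push_e ls i Ux0) (push_tangent ls).
by rewrite (tprojE ls _ Ux0) dot_tang tE.
Qed.

Lemma ddir_mean_curvature : ddir mean_curvature_field v p = scalar_mean_curvature p *: ddir N v p.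
Proof. by rewrite /ddir (derive_linZ _ _ (dv Op)). Qed.

Lemma derive_mean_curvature w : 'D_w mean_curvature_field p = 'D_w scalar_mean_curvature p *: N p + scalar_mean_curvature p *: 'D_w N p.
Proof. exact: derive_scale (smooth_differentiable smooth_scalar_mean_curvature Op) (dN Op). Qed.

Lemma tproj_ddir_mean_curvature : T (ddir mean_curvature_field v p) = scalar_mean_curvature p *: T (ddir N v p).
Proof. by rewrite ddir_mean_curvature tprojZ. Qed.

(** The derivative of the coefficient of N is a multiple of N, which the projection
    kills. *)
Lemma tproj_bracket_mean_curvature : T (bracket mean_curvature_field v p) = scalar_mean_curvature p *: T (bracket N v p).
Proof.
rewrite /bracket !tprojB ddir_mean_curvature [ddir v mean_curvature_field p]derive_mean_curvature tprojD !tprojZ tproj_normal scaler0 add0r.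
by rewrite scalerBr.
Qed.

Lemma weingarten_mean_curvature : weingarten phi mean_curvature_field x0 (v p) = scalar_mean_curvature p *: s (v p).
Proof.
by rewrite /weingarten phi0 derive_mean_curvature tprojD !tprojZ tproj_normal scaler0 add0r scalerN.
Qed.

Variable D : connection R n.
Hypothesis lc : levi_civita U g D.

Definition hypersurface_terms : 'rV[R]_(n + 1) :=
  - T (ddir N (ddir N v) p) + P (D (pull phi (ddir N N)) u x0).

(** The unit length of N on the ambient neighborhood makes D_N N orthogonal to N,
    hence tangent. *)
Lemma ddirNN_tangent x : U x -> (ddir N N (phi x) <= tangent phi x)%MS.
Proof.
move=> Ux; have h : ddir N N (phi x) *m tang x = ddir N N (phi x).
  exact: tangent_of_dot Ux (dot_derive_unit _ (UO Ux)).
by rewrite genmxE -h /tangent_projector mulmxA submxMl.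
Qed.

Lemma normal_terms_hypersurface : - normal_terms p phi x0 Ns v = hypersurface_terms.
Proof.
have sNN : smooth O (ddir N N) by exact: (smooth_ddir oO).
have sY := smooth_pull ls sNN ddirNN_tangent.
have eY := push_pull Ux0 (ddirNN_tangent Ux0).
rewrite /normal_terms big_ord1 tprojB opprB addrC; congr (_ + _).
rewrite (lc_unique oU sphi fJ lc sY su Ux0) -[RHS]/(push x0 _) (push_induced_conn _ _ _ Ux0).
by rewrite -(tprojE ls) // -(ddir_v_along ls Ux0 eY) phi0.
Qed.

Section Identities.
Hypothesis n_gt0 : (0 < n)%N.
Variables (ds1 : form1 R n -> form0 R n) (ds2 : form2 R n -> form1 R n).
Hypotheses (ads1 : formal_adjoint_d0 U g ds1) (ads2 : formal_adjoint_d1 U g ds2).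
Local Notation lap := (T (bochner (@ddir R _ _) F v p)).
Local Notation H := (scalar_mean_curvature p).

Lemma hypersurface_bochner : lap = P (bochner D e u x0) + s (s (v p))
  + (n%:R * H) *: T (ddir N v p) + hypersurface_terms.
Proof.
rewrite (bochner_identity ls lc mean_curvature_fieldE n_gt0) normal_terms_hypersurface big_ord1.
by rewrite tproj_ddir_mean_curvature scalerA.
Qed.

Lemma hypersurface_ricci : lap = P (bochner D e u x0) - P (Ric D g e u x0)
  + (n%:R * H) *: T (bracket N v p) + hypersurface_terms.
Proof.
rewrite (bochner_ricci_identity ls lc smooth_mean_curvature_field mean_curvature_fieldE n_gt0) normal_terms_hypersurface.
by rewrite tproj_bracket_mean_curvature scalerA.
Qed.

Lemma hypersurface_hodge : lap = P (hodge g ds1 ds2 u x0) + 2%:R *: s (s (v p))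
  + (n%:R * H) *: T (ddir N v p) - (n%:R * H) *: s (v p) + hypersurface_terms.
Proof.
rewrite (bochner_hodge_identity ls lc smooth_mean_curvature_field mean_curvature_fieldE n_gt0 ads1 ads2) normal_terms_hypersurface big_ord1.
by rewrite tproj_ddir_mean_curvature weingarten_mean_curvature !scalerA.
Qed.

Lemma hypersurface_grad : T (bochner (@ddir R _ _) F v p
    + grad (euclid (n := n + 1)) (div_euclid F) p) =
  P (bochner D e u x0) - P (Ric D g e u x0) + P (grad g (divergence D g e u) x0)
  + (n%:R * H) *: T (bracket N v p) + hypersurface_terms
  + P (grad g (fun x => div_euclid Ns (phi x)) x0).
Proof.
rewrite (bochner_grad_identity ls lc smooth_mean_curvature_field mean_curvature_fieldE n_gt0) normal_terms_hypersurface.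
by rewrite tproj_bracket_mean_curvature scalerA.
Qed.

Section DivergenceFree.
Hypothesis divM : forall x, U x -> divergence D g e u x = 0.
Hypothesis divE : forall q, O q -> div_euclid F q = 0.

(** The divergence of the ambient space is the sum of the divergence on M and of the
    normal component of D_N v. *)
Lemma dot_ddir_normal : dot (ddir N v p) (N p) = 0.
Proof.
have := divergence_split ls lc Ux0; rewrite divM // add0r divE; last exact: UO.
by rewrite /divergence big_ord1 euclid_ip phi0.
Qed.

Lemma tproj_ddir_normal : T (ddir N v p) = ddir N v p.
Proof. by apply: tproj_id; exact: dot_ddir_normal. Qed.

Lemma tproj_bracket_normal : T (bracket N v p) = bracket N v p.
Proof. by apply: tproj_id; rewrite dotBl dot_ddir_normal [dot (ddir v N p) _]dot_derive_unit // subrr. Qed.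

End DivergenceFree.
End Identities.
End Hypersurface.

(** * The tangential part of the Euclidean Laplacian *)

Theorem corollary1p24 (R : realType) (n : nat) (n_ge2 : (2 <= n)%N) :
  (forall (k : nat) (k_ge1 : (1 <= k)%N)
      (M : set 'rV[R]_(n + k)) (p : 'rV[R]_(n + k)) (O : set 'rV[R]_(n + k))
      (U : set 'rV[R]_n) (phi : 'rV[R]_n -> 'rV[R]_(n + k)) (x0 : 'rV[R]_n)
      (E : 'I_n -> vfield R (n + k)) (N : 'I_k -> vfield R (n + k))
      (v H : vfield R (n + k))
      (D : connection R n)
      (ds1 : form1 R n -> form0 R n) (ds2 : form2 R n -> form1 R n),
    local_setting M p O U phi x0 E N v ->
    smooth O H -> (forall x, U x -> H (phi x) = mean_curvature phi E x) ->
    let g := induced_metric phi in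
    levi_civita U g D ->
    formal_adjoint_d0 U g ds1 -> formal_adjoint_d1 U g ds2 ->
    let e := fun i => pull phi (E i) in
    let u := pull phi v in
    let F := full_frame E N in
    let T := tproj phi x0 in
    let P := push phi x0 in
    let W := fun eta => weingarten phi eta x0 in
    let normal_terms := \sum_l
      T (ddir (N l) (ddir (N l) v) p - ddir (ddir (N l) (N l)) v p) in
    [/\ T (bochner (@ddir R _ _) F v p)
        = P (bochner D e u x0) + \sum_l W (N l) (W (N l) (v p))
          + n%:R *: T (ddir H v p) - normal_terms,
        T (bochner (@ddir R _ _) F v p)
        = P (bochner D e u x0) - P (Ric D g e u x0)
          + n%:R *: T (bracket H v p) - normal_terms,
        T (bochner (@ddir R _ _) F v p)
        = P (hodge g ds1 ds2 u x0)
          + 2%:R *: \sum_l W (N l) (W (N l) (v p))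
          + n%:R *: T (ddir H v p) - n%:R *: W H (v p) - normal_terms &
        T (bochner (@ddir R _ _) F v p
           + grad (euclid (n := n + k))
               (divergence (@ddir R _ _) (euclid (n := n + k)) F v) p)
        = P (bochner D e u x0) - P (Ric D g e u x0)
          + P (grad g (divergence D g e u) x0)
          + n%:R *: T (bracket H v p) - normal_terms
          + P (grad g (fun x => divergence (@ddir R _ _) (euclid (n := n + k))
                                  N v (phi x)) x0)])
  /\
  (forall (M : set 'rV[R]_(n + 1)) (p : 'rV[R]_(n + 1)) (O : set 'rV[R]_(n + 1))
      (U : set 'rV[R]_n) (phi : 'rV[R]_n -> 'rV[R]_(n + 1)) (x0 : 'rV[R]_n)
      (E : 'I_n -> vfield R (n + 1)) (N : vfield R (n + 1))
      (v : vfield R (n + 1))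
      (D : connection R n)
      (ds1 : form1 R n -> form0 R n) (ds2 : form2 R n -> form1 R n),
    local_setting M p O U phi x0 E (fun _ : 'I_1 => N) v ->
    let g := induced_metric phi in
    levi_civita U g D ->
    formal_adjoint_d0 U g ds1 -> formal_adjoint_d1 U g ds2 ->
    let e := fun i => pull phi (E i) in
    let u := pull phi v in
    let F := full_frame E (fun _ : 'I_1 => N) in
    let T := tproj phi x0 in
    let P := push phi x0 in
    let s := weingarten phi N x0 in
    let H := n%:R^-1 * \sum_i ip (euclid (n := n + 1)) p (s (E i p)) (E i p) in
    let lap := T (bochner (@ddir R _ _) F v p) in
    let normal_terms :=
      - T (ddir N (ddir N v) p) + P (D (pull phi (ddir N N)) u x0) in
    [/\ lap = P (bochner D e u x0) + s (s (v p))
              + (n%:R * H) *: T (ddir N v p) + normal_terms,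
        lap = P (bochner D e u x0) - P (Ric D g e u x0)
              + (n%:R * H) *: T (bracket N v p) + normal_terms,
        lap = P (hodge g ds1 ds2 u x0) + 2%:R *: s (s (v p))
              + (n%:R * H) *: T (ddir N v p)
              - (n%:R * H) *: s (v p) + normal_terms,
        (forall x, U x -> divergence D g e u x = 0) ->
        (forall q, O q ->
           divergence (@ddir R _ _) (euclid (n := n + 1)) F v q = 0) ->
        [/\ lap = P (bochner D e u x0) - P (Ric D g e u x0)
                  + (n%:R * H) *: bracket N v p + normal_terms,
            lap = P (bochner D e u x0) + s (s (v p))
                  + (n%:R * H) *: ddir N v p + normal_terms &
            lap = P (hodge g ds1 ds2 u x0) + 2%:R *: s (s (v p))
                  + (n%:R * H) *: ddir N v p
                  - (n%:R * H) *: s (v p) + normal_terms] &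
        T (bochner (@ddir R _ _) F v p
           + grad (euclid (n := n + 1))
               (divergence (@ddir R _ _) (euclid (n := n + 1)) F v) p)
        = P (bochner D e u x0) - P (Ric D g e u x0)
          + P (grad g (divergence D g e u) x0)
          + (n%:R * H) *: T (bracket N v p) + normal_terms
          + P (grad g (fun x => divergence (@ddir R _ _) (euclid (n := n + 1))
                                  (fun _ : 'I_1 => N) v (phi x)) x0)]).
Proof.
have n_gt0 : (0 < n)%N by exact: ltnW.
split=> [k _ M p O U phi x0 E N v H D ds1 ds2 ls sH eH g lc ads1 ads2 e u F T P W nt
        |M p O U phi x0 E N v D ds1 ds2 ls g lc ads1 ads2 e u F T P s H lap nt].
  split.
  - exact: (bochner_identity ls lc eH n_gt0).
  - exact: (bochner_ricci_identity ls lc sH eH n_gt0).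
  - exact: (bochner_hodge_identity ls lc sH eH n_gt0 ads1 ads2).
  - exact: (bochner_grad_identity ls lc sH eH n_gt0).
have eH : H = scalar_mean_curvature E N p := esym (scalar_mean_curvatureE ls).
split; rewrite eH.
- exact: (hypersurface_bochner ls lc n_gt0).
- exact: (hypersurface_ricci ls lc n_gt0).
- exact: (hypersurface_hodge ls lc n_gt0 ads1 ads2).
- move=> divM divE; split.
  + by rewrite -(tproj_bracket_normal ls lc divM divE); exact: (hypersurface_ricci ls lc n_gt0).
  + by rewrite -(tproj_ddir_normal ls lc divM divE); exact: (hypersurface_bochner ls lc n_gt0).
  + by rewrite -(tproj_ddir_normal ls lc divM divE); exact: (hypersurface_hodge ls lc n_gt0 ads1 ads2).
- exact: (hypersurface_grad ls lc n_gt0).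
Qed.
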